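(* Assume (C1)–(C8) (as listed in the context). Consider the integral equation $$u(t)=\gamma(t)\alpha[u]+\delta(t)\beta[u]+\int_0^1 k(t,s)g(s)f(s,u(s))\,ds,\quad t\in[0,1].\qquad ( * )$$ Equation $( * )$ has at least one non-zero solution in $K$ if one of the following conditions holds. - $(S_1)$ There exist $\rho_1,\rho_2\in(0,\infty)$ with $\rho_1/c<\rho_2$ such that $(\mathrm I^0_{\rho_1})$ and $(\mathrm I^1_{\rho_2})$ hold. - $(S_2)$ There exist $\rho_1,\rho_2\in(0,\infty)$ with $\rho_1<\rho_2$ such that $(\mathrm I^1_{\rho_1})$ and $(\mathrm I^0_{\rho_2})$ hold. Equation $( * )$ has at least two non-zero solutions in $K$ if one of the following conditions holds. - $(S_3)$ There exist $\rho_1,\rho_2,\rho_3\in(0,\infty)$ with $\rho_1/c<\rho_2<\rho_3$ such that $(\mathrm I^0_{\rho_1})$, $(\mathrm I^1_{\rho_2})$ and $(\mathrm I^0_{\rho_3})$ hold. - $(S_4)$ There exist $\rho_1,\rho_2,\rho_3\in(0,\infty)$ with $\rho_1<\rho_2$ and $\rho_2/c<\rho_3$ such that $(\mathrm I^1_{\rho_1})$, $(\mathrm I^0_{\rho_2})$ and $(\mathrm I^1_{\rho_3})$ hold. Equation $( * )$ has at least three non-zero solutions in $K$ if one of the following conditions holds. - $(S_5)$ There exist $\rho_1,\rho_2,\rho_3,\rho_4\in(0,\infty)$ with $\rho_1/c<\rho_2<\rho_3$ and $\rho_3/c<\rho_4$ such that $(\mathrm I^0_{\rho_1})$, $(\mathrm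 I^1_{\rho_2})$, $(\mathrm I^0_{\rho_3})$ and $(\mathrm I^1_{\rho_4})$ hold. - $(S_6)$ There exist $\rho_1,\rho_2,\rho_3,\rho_4\in(0,\infty)$ with $\rho_1<\rho_2$ and $\rho_2/c<\rho_3<\rho_4$ such that $(\mathrm I^1_{\rho_1})$, $(\mathrm I^0_{\rho_2})$, $(\mathrm I^1_{\rho_3})$ and $(\mathrm I^0_{\rho_4})$ hold.
   Context: $C[0,1]$ is the space of continuous real functions on $[0,1]$ with norm $\|w\|=\max_{t\in[0,1]}|w(t)|$. Given are $k$, $g$, $f$, $\gamma$, $\delta$, $A$, $B$, and $\alpha[u]=\int_0^1u(s)\,dA(s)$, $\beta[u]=\int_0^1u(s)\,dB(s)$ (Stieltjes integrals). Assumptions: (C1) $k:[0,1]\times[0,1]\to\mathbb R$ is measurable, and for every $\tau\in[0,1]$, $\lim_{t\to\tau}|k(t,s)-k(\tau,s)|=0$ for almost every $s\in[0,1]$. (C2) There exist a subinterval $[a,b]\subseteq[0,1]$, a function $\Phi\in L^\infty[0,1]$ and a constant $c_1\in(0,1]$ such that $|k(t,s)|\le\Phi(s)$ for $t\in[0,1]$ and a.e. $s\in[0,1]$, and $k(t,s)\ge c_1\Phi(s)$ for $t\in[a,b]$ and a.e. $s\in[0,1]$. (C3) $g\,\Phi\in L^1[0,1]$, $g(s)\ge0$ for a.e. $s\in[0,1]$, and $\int_a^b\Phi(s)g(s)\,ds>0$. (C4) $f:[0,1]\times\mathbb R\to[0,\infty)$ satisfies Carathéodory conditions: $f(\cdot,u)$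 is measurable for each fixed $u$, $f(t,\cdot)$ is continuous for a.e. $t$, and for each $r>0$ there is $\phi_r\in L^\infty[0,1]$ with $f(t,u)\le\phi_r(t)$ for all $u\in[-r,r]$ and a.e. $t\in[0,1]$. (C5) $A,B$ are functions of bounded variation and $\mathcal K_A(s):=\int_0^1k(t,s)\,dA(t)\ge0$, $\mathcal K_B(s):=\int_0^1k(t,s)\,dB(t)\ge0$ for a.e. $s\in[0,1]$. (C6) $\gamma\in C[0,1]$, $0\le\alpha[\gamma]<1$, $\beta[\gamma]\ge0$, and there is $c_2\in(0,1]$ with $\gamma(t)\ge c_2\|\gamma\|$ for $t\in[a,b]$. (C7) $\delta\in C[0,1]$, $0\le\beta[\delta]<1$, $\alpha[\delta]\ge0$, and there is $c_3\in(0,1]$ with $\delta(t)\ge c_3\|\delta\|$ for $t\in[a,b]$. (C8) $D:=(1-\alpha[\gamma])(1-\beta[\delta])-\alpha[\delta]\beta[\gamma]>0$. Let $c=\min\{c_1,c_2,c_3\}$ and let $K$ be the cone $$K=\{u\in C[0,1]:\ \min_{t\in[a,b]}u(t)\ge c\|u\|,\ \alpha[u]\ge0,\ \beta[u]\ge0\}.$$ Write $k^+=\max\{k,0\}$, $k^-=\max\{-k,0\}$. For $\rho>0$ let $$f^{-\rho,\rho}=\operatorname{ess\,sup}\Big\{\tfrac{f(t,u)}{\rho}:(t,u)\in[0,1]\times[-\rho,\rho]\Big\},\quad f_{\rho,\rho/c}=\operatorname{ess\,inf}\Big\{\tfrac{f(t,u)}{\rho}:(t,u)\in[a,b]\times[\rho,\rho/c]\Big\}.$$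 Condition $(\mathrm I^1_\rho)$ means: $$f^{-\rho,\rho}\sup_{t\in[0,1]}\Big\{\Big(\tfrac{|\gamma(t)|}{D}(1-\beta[\delta])+\tfrac{|\delta(t)|}{D}\beta[\gamma]\Big)\int_0^1\mathcal K_A(s)g(s)\,ds+\Big(\tfrac{|\gamma(t)|}{D}\alpha[\delta]+\tfrac{|\delta(t)|}{D}(1-\alpha[\gamma])\Big)\int_0^1\mathcal K_B(s)g(s)\,ds+\max\Big\{\int_0^1k^+(t,s)g(s)\,ds,\int_0^1k^-(t,s)g(s)\,ds\Big\}\Big\}<1.$$ Condition $(\mathrm I^0_\rho)$ means: $$f_{\rho,\rho/c}\inf_{t\in[a,b]}\Big\{\Big(\tfrac{\gamma(t)}{D}(1-\beta[\delta])+\tfrac{\delta(t)}{D}\beta[\gamma]\Big)\int_a^b\mathcal K_A(s)g(s)\,ds+\Big(\tfrac{\gamma(t)}{D}\alpha[\delta]+\tfrac{\delta(t)}{D}(1-\alpha[\gamma])\Big)\int_a^b\mathcal K_B(s)g(s)\,ds+\int_a^bk(t,s)g(s)\,ds\Big\}>1.$$ *)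

(* Defs.v *)
From HB Require Import structures.
From mathcomp Require Import all_boot all_order all_algebra.
From mathcomp Require Import all_classical all_reals all_analysis.
From mathcomp Require Import measurable_realfun ess_sup_inf.

Set Implicit Arguments.
Unset Strict Implicit.
Unset Printing Implicit Defensive.

Import Order.TTheory GRing.Theory Num.Theory.
Import numFieldNormedType.Exports.

Local Open Scope classical_set_scope.
Local Open Scope ring_scope.

(** Functions on [0,1] are represented by functions on [R] whose values outside
    [0,1] are irrelevant. "Measurable" means Lebesgue measurable, hence the
    completed measure. *)

Notation leb R := (@completed_lebesgue_measure R).

Definition lebType (R : realType) : measurableType _ :=
  caratheodory_type ((wlength (idfun : R -> R))^*)%mu.

Lemma measurable_itv_leb (R : realType) (i : interval R) :
  measurable ([set` i] : set (lebType R)).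
Proof. by apply: sub_caratheodory; exact: measurable_itv. Qed.

Definition leb_on (R : realType) (x y : R) :
    {measure set (lebType R) -> \bar R} :=
  mrestr (leb R) (measurable_itv_leb `[x, y]).

(** The completion of the product of two Lebesgue measures is the
    two-dimensional Lebesgue measure. *)
Definition leb2Type (R : realType) : measurableType _ :=
  g_sigma_algebraType (completed_algebra_gen (leb R \x leb R)%E).

Definition Linf01 (R : realType) (h : R -> R) : Prop :=
  measurable_fun (`[0, 1] : set (lebType R)) (h : lebType R -> R) /\
  (ess_sup (leb_on 0 1) (fun s => `|h s|%:E) < +oo)%E.

Definition norm01 (R : realType) (w : R -> R) : R :=
  sup [set `|w t| | t in `[0, 1]].

(** Riemann-Stieltjes integral of [u] against [dA] over [0,1], as the limit of
    the tagged sums when the mesh tends to 0. The partition points are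
    [0 :: p] and [xi i] is the tag of the [i]-th subinterval. *)
Definition rs_sum (R : realType) (A u : R -> R) (p : seq R) (xi : nat -> R) : R :=
  let t := nth 1 (0 :: p) in
  \sum_(0 <= i < size p) u (xi i) * (A (t i.+1) - A (t i)).

Definition is_stieltjes (R : realType) (A u : R -> R) (I : R) : Prop :=
  forall e : R, 0 < e -> exists2 d : R, 0 < d &
    forall (p : seq R) (xi : nat -> R),
      let t := nth 1 (0 :: p) in
      itv_partition 0 1 p ->
      (forall i, (i < size p)%N -> t i.+1 - t i < d) ->
      (forall i, (i < size p)%N -> t i <= xi i <= t i.+1) ->
      `|rs_sum A u p xi - I| < e.

Definition stieltjes_integrable (R : realType) (A u : R -> R) : Prop :=
  exists I : R, is_stieltjes A u I.

Definition stieltjes (R : realType) (A u : R -> R) : R :=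
  xget 0 [set I | is_stieltjes A u I].

Definition calK (R : realType) (k : R -> R -> R) (A : R -> R) (s : R) : R :=
  stieltjes A (fun t => k t s).

Definition C1 (R : realType) (k : R -> R -> R) : Prop :=
  measurable_fun (`[0, 1] `*` `[0, 1] : set (leb2Type R))
    ((fun x => k x.1 x.2) : leb2Type R -> R) /\
  forall tau : R, tau \in `[0, 1] ->
    {ae leb R, forall s, s \in `[0, 1] ->
      `|k t s - k tau s| @[t --> within `[0, 1] (nbhs tau)] --> (0 : R)}.

Definition C2 (R : realType) (k : R -> R -> R) (Phi : R -> R) (a b c1 : R) :
    Prop :=
  [/\ 0 <= a, a <= b & b <= 1] /\
  [/\ Linf01 Phi,
      0 < c1 <= 1,
      forall t, t \in `[0, 1] ->
        {ae leb R, forall s, s \in `[0, 1] -> `|k t s| <= Phi s}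
    & forall t, t \in `[a, b] ->
        {ae leb R, forall s, s \in `[0, 1] -> c1 * Phi s <= k t s}].

Definition C3 (R : realType) (g Phi : R -> R) (a b : R) : Prop :=
  [/\ (leb R).-integrable `[0, 1] (fun s => (g s * Phi s)%:E),
      {ae leb R, forall s, s \in `[0, 1] -> 0 <= g s}
    & 0 < \int[leb R]_(s in `[a, b]) (Phi s * g s)].

Definition C4 (R : realType) (f : R -> R -> R) : Prop :=
  [/\ forall t u, t \in `[0, 1] -> 0 <= f t u,
      forall u, measurable_fun (`[0, 1] : set (lebType R))
                  ((fun t => f t u) : lebType R -> R),
      {ae leb R, forall t, t \in `[0, 1] -> continuous (f t)}
    & forall r, 0 < r -> exists2 phi : R -> R, Linf01 phi &
        {ae leb R, forall t, t \in `[0, 1] ->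
           forall u, u \in `[- r, r] -> f t u <= phi t}].

(** [k^~ s] need not be continuous, so the existence of [calK k A s] has to be
    asserted along with its sign: [stieltjes] is [0] on non-integrable
    functions. *)
Definition C5 (R : realType) (k : R -> R -> R) (A B : R -> R) : Prop :=
  [/\ bounded_variation 0 1 A,
      bounded_variation 0 1 B,
      {ae leb R, forall s, s \in `[0, 1] ->
         stieltjes_integrable A (fun t => k t s) /\ 0 <= calK k A s}
    & {ae leb R, forall s, s \in `[0, 1] ->
         stieltjes_integrable B (fun t => k t s) /\ 0 <= calK k B s}].

Definition C6 (R : realType) (A B gamma : R -> R) (a b c2 : R) : Prop :=
  {within `[0, 1], continuous gamma} /\
  [/\ 0 <= stieltjes A gamma < 1,
      0 <= stieltjes B gamma,
      0 < c2 <= 1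
    & forall t, t \in `[a, b] -> c2 * norm01 gamma <= gamma t].

Definition C7 (R : realType) (A B delta : R -> R) (a b c3 : R) : Prop :=
  {within `[0, 1], continuous delta} /\
  [/\ 0 <= stieltjes B delta < 1,
      0 <= stieltjes A delta,
      0 < c3 <= 1
    & forall t, t \in `[a, b] -> c3 * norm01 delta <= delta t].

Definition detD (R : realType) (A B gamma delta : R -> R) : R :=
  (1 - stieltjes A gamma) * (1 - stieltjes B delta)
  - stieltjes A delta * stieltjes B gamma.

Definition cone (R : realType) (A B : R -> R) (a b c : R) (u : R -> R) : Prop :=
  [/\ {within `[0, 1], continuous u},
      c * norm01 u <= inf [set u t | t in `[a, b]],
      0 <= stieltjes A u
    & 0 <= stieltjes B u].

Definition is_solution (R : realType) (k : R -> R -> R) (g : R -> R)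
    (f : R -> R -> R) (gamma delta A B u : R -> R) : Prop :=
  forall t, t \in `[0, 1] ->
    u t = gamma t * stieltjes A u + delta t * stieltjes B u
          + \int[leb R]_(s in `[0, 1]) (k t s * g s * f s (u s)).

(** In [ess_supf] and [ess_inff] the null sets are taken in [t] only. For a
    Caratheodory [f] this agrees with the essential bounds over the rectangle
    when the latter has nonempty interior; for [c = 1] the range
    [[rho, rho/c]] is a point, every property holds almost everywhere on the
    degenerate rectangle, and only the present reading is meaningful. *)
Definition ess_supf (R : realType) (f : R -> R -> R) (rho : R) : \bar R :=
  ess_sup (leb_on 0 1)
    (fun t => ereal_sup [set (f t u / rho)%:E | u in `[- rho, rho]]).

Definition ess_inff (R : realType) (f : R -> R -> R) (a b c rho : R) : \bar R :=
  ess_inf (leb_on a b)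
    (fun t => ereal_inf [set (f t u / rho)%:E | u in `[rho, rho / c]]).

Definition condI1 (R : realType) (k : R -> R -> R) (g : R -> R)
    (f : R -> R -> R) (gamma delta A B : R -> R) (rho : R) : Prop :=
  let D := detD A B gamma delta in
  (ess_supf f rho *
   (sup [set (`|gamma t| / D * (1 - stieltjes B delta)
              + `|delta t| / D * stieltjes B gamma)
               * \int[leb R]_(s in `[0, 1]) (calK k A s * g s)
           + (`|gamma t| / D * stieltjes A delta
              + `|delta t| / D * (1 - stieltjes A gamma))
               * \int[leb R]_(s in `[0, 1]) (calK k B s * g s)
           + Num.max
               (\int[leb R]_(s in `[0, 1]) (Num.max (k t s) 0 * g s))
               (\int[leb R]_(s in `[0, 1]) (Num.max (- k t s) 0 * g s))
        | t in `[0, 1]])%:E < 1)%E.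

Definition condI0 (R : realType) (k : R -> R -> R) (g : R -> R)
    (f : R -> R -> R) (gamma delta A B : R -> R) (a b c rho : R) : Prop :=
  let D := detD A B gamma delta in
  (ess_inff f a b c rho *
   (inf [set (gamma t / D * (1 - stieltjes B delta)
              + delta t / D * stieltjes B gamma)
               * \int[leb R]_(s in `[a, b]) (calK k A s * g s)
           + (gamma t / D * stieltjes A delta
              + delta t / D * (1 - stieltjes A gamma))
               * \int[leb R]_(s in `[a, b]) (calK k B s * g s)
           + \int[leb R]_(s in `[a, b]) (k t s * g s)
        | t in `[a, b]])%:E > 1)%E.

Definition has_nonzero_solutions (R : realType) (k : R -> R -> R) (g : R -> R)
    (f : R -> R -> R) (gamma delta A B : R -> R) (a b c : R) (n : nat) : Prop :=
  exists u : 'I_n -> R -> R,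
    (forall i, [/\ cone A B a b c (u i),
                   is_solution k g f gamma delta A B (u i)
                 & exists2 t, t \in `[0, 1] & u i t != 0]) /\
    (forall i j, i != j -> exists2 t, t \in `[0, 1] & u i t != u j t).

(* Main.v *)
Require Import Defs.
From mathcomp Require Import all_boot all_order all_algebra.
From mathcomp Require Import all_classical all_reals all_analysis.
From mathcomp Require Import measurable_realfun ess_sup_inf.
From mathcomp Require Import zify ring lra.

Set Implicit Arguments.
Unset Strict Implicit.
Unset Printing Implicit Defensive.

Import Order.TTheory GRing.Theory Num.Theory.
Import numFieldNormedType.Exports.

(** Write F u (t) for the integral of k(t,s) g(s) f(s,u(s)) ds. If u solves the
    equation, then applying alpha and beta to it gives a linear system for
    (alpha[u], beta[u]) with determinant D > 0 and right-hand side
    (alpha[F u], beta[F u]). Interchanging the Stieltjes and the Lebesgue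
    integrals ([stieltjes_integral]) turns alpha[F u] into the integral of
    K_A(s) g(s) f(s,u(s)), which is nonnegative and makes sense for every bounded
    measurable u. Cramer's rule therefore expresses the right-hand side of the
    equation as an operator S u = cA alpha[F u] + cB beta[F u] + F u
    ([hammerstein]), whose fixed points are solutions with alpha[u] >= 0 and
    beta[u] >= 0 ([fixed_point_solution]). The lower bounds for k, gamma and delta
    on [a,b] make S take its values in the cone min u >= c max |u|. The brackets in
    condI1 and condI0 bound |S u| from above and S u from below when f(s,u(s)) is
    replaced by a constant. Thus condI1 at r makes S map the ball of radius r strictly
    inside itself ([condI1_contracts]), and condI0 at r makes S u > r on [a,b] as soon
    as r <= u <= r/c on [a,b] ([condI0_expands]); every cone function whose minimum
    over [a,b] is r has values in this range.

    The theorem thus reduces to the two halves of Krasnosel'skii's theorem, with the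
    inner or outer boundary measured by the minimum over [a,b] instead of the norm.
    Compression ([cone_compression]) is Schauder's theorem for a truncation of S
    that can only be active where the boundary conditions forbid a fixed point.
    Expansion ([expansion_fixed_point]) becomes compression after a substitution
    u = mu(w) w along rays, which exchanges the two boundaries. Each fixed point
    comes with strict inequalities on the norm or on the minimum over [a,b]; these
    separate the solutions obtained from successive pairs of radii.

    Schauder's theorem is needed only for sets of functions given by pointwise
    bounds ([schauder_box]). Sampling an equicontinuous family on a fine grid
    reduces it to an approximate Brouwer theorem on a cube ([brouwer_cube]), which
    follows from a parity argument of Scarf ([no_bullying]); approximate fixed
    points are then passed to the limit along one ultrafilter.

    On the analytic side, g itself need not be measurable, only g Phi is; a kernel
    bounded by Phi nevertheless has a measurable product with g
    ([measurable01_profile]). Product measurability of k controls almost all of its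
    sections, and the continuity in C1 extends this to all of them
    ([C1_measurable]). Continuity of S rests on dominated convergence: in t through
    C1 ([kernel_equicontinuous]) and in u through C4 ([nemytskii_uniform]). *)

(** * Scarf's parity argument *)

Section Scarf.
(* Sets are finite sets here, not classical ones. *)
Import mathcomp.boot.fintype mathcomp.boot.finset.

Variables (T I : finType) (w : I -> T -> nat) (l : T -> I) (t0 : T).
Implicit Types (C : {set T + I}) (u : T + I).

Definition ext_label (u : T + I) : I :=
  match u with inl t => l t | inr i => i end.

Definition ext_bound (i : I) : nat :=
  \sum_(t : T) (w i t * #|T| + enum_rank t).+2.

(** The i-th order on T, extended by one slack element for each index. The slack
    of i is the minimum of the i-th order, and for any other order it lies above all
    of T. Adding [enum_rank t] breaks ties, which makes the extended orders total. *)
Definition ext_rank (i : I) (u : T + I) : nat :=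
  match u with
  | inl t => (w i t * #|T| + enum_rank t).+1
  | inr j => if j == i then 0 else ext_bound i + enum_rank j
  end.

Lemma ext_rank_lt_bound i t : ext_rank i (inl t) < ext_bound i.
Proof. by rewrite /ext_bound (bigD1 t) //=; exact: leq_addr. Qed.

Lemma ext_rank_inj i : injective (ext_rank i).
Proof.
have b0 : 0 < ext_bound i by exact: leq_ltn_trans (ext_rank_lt_bound i t0).
move=> [t|j] [t'|j'] //=.
- move=> [e]; congr inl; apply: enum_rank_inj; apply: val_inj => /=.
  have T0 : 0 < #|T| by apply/card_gt0P; exists t0.
  have := congr1 (modn^~ #|T|) e.
  by rewrite !modnMDl !modn_small // ltn_ord.
- case: eqP => // _ e; have := ext_rank_lt_bound i t.
  by rewrite /= e ltnNge leq_addr.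
- case: eqP => // _ e; have := ext_rank_lt_bound i t'.
  by rewrite /= -e ltnNge leq_addr.
- case: eqP => [->|_]; case: eqP => [->|_] //.
  + by move=> e; move: b0; rewrite lt0n; case: (ext_bound i) e.
  + by move=> e; move: b0; rewrite lt0n; case: (ext_bound i) e.
  + by move/addnI/val_inj/enum_rank_inj ->.
Qed.

Lemma ext_rank_slack_min i u : u != inr i -> ext_rank i (inr i) < ext_rank i u.
Proof.
rewrite /= eqxx; case: u => [t|j] //= ji.
have -> : (j == i) = false by apply: contraNF ji => /eqP ->.
by rewrite addn_gt0 (leq_ltn_trans _ (ext_rank_lt_bound i t0)).
Qed.

Lemma ext_rank_slack_max i j t : j != i ->
  ext_rank i (inl t) < ext_rank i (inr j).
Proof.
move=> /negPf ji; rewrite [X in _ < X]/= ji.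
by rewrite (leq_trans (ext_rank_lt_bound i t)) // leq_addr.
Qed.

(** Each element of a dominant set is its lowest element for some order, so the
    set has at most #|I| elements. Dominant sets of this maximal size are the rooms of
    the argument, those with one element less are its doors. *)
Definition dominant (C : {set T + I}) :=
  [forall u, exists i, forall x in C, ext_rank i u <= ext_rank i x].

Lemma dominantP (C : {set T + I}) :
  reflect (forall u, exists i, forall x, x \in C -> ext_rank i u <= ext_rank i x)
          (dominant C).
Proof.
apply: (iffP forallP) => h u; have := h u.
  by move=> /existsP[i /'forall_implyP]; exists i.
by move=> [i hi]; apply/existsP; exists i; apply/'forall_implyP.
Qed.

Lemma dominantS (C C' : {set T + I}) : C' \subset C -> dominant C -> dominant C'.
Proof.
move=> /subsetP s /dominantP h; apply/dominantP => u; have [i hi] := h u.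
by exists i => x /s; exact: hi.
Qed.

Definition lowest (C : {set T + I}) i x :=
  (x \in C) && [forall y in C, ext_rank i x <= ext_rank i y].

Lemma lowestP C i x :
  reflect (x \in C /\ forall y, y \in C -> ext_rank i x <= ext_rank i y)
          (lowest C i x).
Proof.
by apply: (iffP andP) => -[xC h]; split=> //; apply/'forall_implyP.
Qed.

Lemma ex_lowest C i : C != set0 -> exists x, lowest C i x.
Proof.
case/set0Pn => x0 x0C.
case: (arg_minnP (fun u => ext_rank i u) x0C) => x xC h.
by exists x; apply/lowestP.
Qed.

Lemma lowest_inj C i x y : lowest C i x -> lowest C i y -> x = y.
Proof.
move=> /lowestP[xC hx] /lowestP[yC hy]; apply: (@ext_rank_inj i).
by apply/eqP; rewrite eqn_leq hx // hy.
Qed.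

Lemma dominant_lowest C x : dominant C -> x \in C -> exists i, lowest C i x.
Proof.
by move=> /dominantP /(_ x)[i hi] xC; exists i; apply/lowestP.
Qed.

Definition room (C : {set T + I}) := dominant C && (#|C| == #|I|).
Definition door (C : {set T + I}) := dominant C && (#|C|.+1 == #|I|).

Lemma door_card C : door C -> #|C|.+1 = #|I|.
Proof. by case/andP => _ /eqP. Qed.

Lemma subset_card_succ (U : finType) (C C1 : {set U}) :
  C \subset C1 -> #|C1| = #|C|.+1 -> exists2 u, u \notin C & C1 = u |: C.
Proof.
move=> sCC1 cC1.
have /cards1P[u uE] : #|C1 :\: C| == 1.
  by rewrite cardsD (setIidPr sCC1) cC1 subSnn.
exists u; first by have := set11 u; rewrite -uE inE => /andP[].
by rewrite -uE setUC -[in LHS](setID C1 C) (setIidPr sCC1).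
Qed.

(** A map that loses a single point identifies exactly one pair. This is used
    for the map sending an order to its lowest element in a door, and for the labels
    of a room. *)
Lemma card_imset_pred (U V : finType) (h : U -> V) (D : {set U}) :
  #|h @: D|.+1 = #|D| ->
  exists x y, [/\ x \in D, y \in D, x != y & h x = h y] /\
    [/\ {in D :\ x &, injective h}, {in D :\ y &, injective h},
        h @: (D :\ x) = h @: D & h @: (D :\ y) = h @: D].
Proof.
move=> cD.
have : ~~ [forall x in D, forall y in D, (h x == h y) ==> (x == y)].
  apply/negP => /forall_inP inj.
  have : {in D &, injective h}.
    move=> x y xD yD /eqP hxy.
    by apply/eqP; exact: (implyP (forall_inP (inj _ xD) _ yD) hxy).
  by move/card_in_imset => cE; move: cD; rewrite cE; lia.
rewrite negb_forall_in => /exists_inP[x xD]; rewrite negb_forall_in.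
case/exists_inP => y yD; rewrite negb_imply => /andP[/eqP hxy xy].
have key z z' : z \in D -> z' \in D -> z != z' -> h z = h z' ->
    {in D :\ z &, injective h} /\ h @: (D :\ z) = h @: D.
  move=> zD z'D zz' hz.
  have hD : h @: (D :\ z) = h @: D.
    apply/eqP; rewrite eqEsubset imsetS ?subsetDl //=.
    apply/subsetP => _ /imsetP[v vD ->].
    have [->|vz] := eqVneq v z; last by apply: imset_f; rewrite !inE vz.
    by rewrite hz; apply: imset_f; rewrite !inE eq_sym zz'.
  split=> //; apply/imset_injP; rewrite hD; apply/eqP/succn_inj.
  by rewrite cD (cardsD1 z) zD.
have [ix hx] := key _ _ xD yD xy hxy.
have yx : y != x by rewrite eq_sym.
have [iy hy] := key y x yD xD yx (esym hxy).
by exists x, y.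
Qed.

(** In a door one element is lowest for two orders i and j, the others for one
    order each. To enlarge the door into a room, choose k among i and j and add the
    highest element for k among those above the minima of all the other orders. *)
Lemma inner_door_rooms C : door C -> (exists t, inl t \in C) ->
  #|[set C' | room C' & C \subset C']| = 2.
Proof.
move=> dC [t tC]; have cC := door_card dC; have /andP[domC _] := dC.
have C0 : C != set0 by apply/set0Pn; exists (inl t).
have /fin_all_exists[m hm] : forall i, exists x, lowest C i x.
  by move=> i; exact: ex_lowest.
have mC i : m i \in C by case/lowestP: (hm i).
have m_le i x : x \in C -> ext_rank i (m i) <= ext_rank i x.
  by case/lowestP: (hm i) => _; apply.
have imC : m @: [set: I] = C.
  apply/setP => x; apply/imsetP/idP => [[i _ ->]//|xC].
  by have [i /(lowest_inj (hm i)) <-] := dominant_lowest domC xC; exists i.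
have [|i [j [[_ _ ij mij] [inji injj imi imj]]]] := @card_imset_pred _ _ m setT.
  by rewrite imC cardsT.
have cover k x : k \in [set i; j] -> x \in C -> exists2 k', k' != k & x = m k'.
  move=> kij; have <- : m @: (setT :\ k) = C by case/set2P: kij => ->; rewrite ?imi ?imj.
  by case/imsetP => k'; rewrite !inE andbT => k'k ->; exists k'.
pose M k := [pred u | [forall (k' | k' != k), ext_rank k' (m k') < ext_rank k' u]].
have MP k u : reflect (forall k', k' != k -> ext_rank k' (m k') < ext_rank k' u) (u \in M k).
  by apply: (iffP 'forall_implyP).
have Mk k : inr k \in M k.
  apply/MP => k' kk'; apply: (leq_ltn_trans (m_le k' _ tC)).
  by apply: ext_rank_slack_max; rewrite eq_sym.
pose top k := [arg max_(u > inr k in M k) ext_rank k u].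
have topP k : top k \in M k /\ forall u, u \in M k -> ext_rank k u <= ext_rank k (top k).
  by rewrite /top; case: arg_maxnP => //.
have M_low k u : u \in M k -> forall x, x \in C -> ext_rank k u <= ext_rank k x.
  move=> /MP uM; have /dominantP/(_ u)[k' hk'] := domC.
  have [<-//|k'k] := eqVneq k' k.
  by have := hk' _ (mC k'); rewrite leqNgt uM.
have top_notin k : k \in [set i; j] -> top k \notin C.
  move=> kij; apply/negP => topC.
  have [k' k'k topE] := cover _ _ kij topC.
  have [/MP/(_ _ k'k) + _] := topP k.
  by rewrite topE ltnn.
have top_room k : k \in [set i; j] -> room (top k |: C).
  move=> kij; rewrite /room cardsU1 top_notin // add1n cC eqxx andbT.
  apply/dominantP => u; case: (boolP (u \in M k)) => [uM|].
    exists k => x /setU1P[->|xC]; first by case: (topP k) => _; apply.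
    exact: M_low.
  rewrite inE negb_forall => /existsP[k']; rewrite negb_imply -leqNgt => /andP[k'k uk'].
  exists k' => x /setU1P[->|xC]; last exact: leq_trans (m_le _ _ xC).
  by apply: (leq_trans uk'); apply: ltnW; case: (topP k) => /MP + _; apply.
suff -> : [set C' | room C' & C \subset C'] = [set top i |: C; top j |: C].
  rewrite cards2; case: eqP => // e; exfalso.
  have : top i \in top j |: C by rewrite -e setU11.
  rewrite in_setU1 (negPf (top_notin _ _)) ?set21// orbF => /eqP tij.
  have [tiM _] := topP i; have [/MP/(_ _ ij) + _] := topP j.
  by rewrite -tij ltnNge M_low.
apply/setP => C'; rewrite !inE; apply/andP/orP => [[/andP[domC' /eqP cC'] sCC']|].
  have [u uC C'E] := subset_card_succ sCC' (etrans cC' (esym cC)).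
  subst C'.
  have /fin_all_exists[m' hm'] : forall i, exists x, lowest (u |: C) i x.
    by move=> k; apply: ex_lowest; apply/set0Pn; exists u; rewrite setU11.
  have imC' : m' @: [set: I] = u |: C.
    apply/setP => x; apply/imsetP/idP => [[k _ ->]|xC].
      by case/lowestP: (hm' k).
    by have [k /(lowest_inj (hm' k)) <-] := dominant_lowest domC' xC; exists k.
  have injm' : injective m'.
    have /imset_injP inj : #|m' @: [set: I]| == #|[set: I]| by rewrite imC' cC' cardsT.
    by move=> x y; apply: inj; rewrite inE.
  have [k _ uk] : exists2 k, k \in [set: I] & u = m' k.
    by apply/imsetP; rewrite imC' setU11.
  have m'm k' : k' != k -> m' k' = m k'.
    move=> k'k; apply: (lowest_inj _ (hm k')).
    have /lowestP[+ h] := hm' k'.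
    case/setU1P => [e|m'C]; first by move: k'k; rewrite -(inj_eq injm') e uk eqxx.
    by apply/lowestP; split=> // y yC; apply: h; rewrite setU1r.
  have kij : k \in [set i; j].
    apply/negPn/negP; rewrite !inE negb_or => /andP[ki kj].
    have := mij; rewrite -!m'm 1?eq_sym // => /injm' /eqP.
    by rewrite (negPf ij).
  have uM : u \in M k.
    apply/MP => k' k'k; rewrite ltn_neqAle -{2}(m'm _ k'k).
    case/lowestP: (hm' k') => _ -> //; last by rewrite setU11.
    rewrite andbT; apply: contraNneq uC => /(@ext_rank_inj _) <-; exact: mC.
  have -> : u = top k.
    apply: (@ext_rank_inj k); apply/eqP; rewrite eqn_leq; case: (topP k) => tM -> //=.
    have /dominantP/(_ (top k))[k' hk'] := domC'.
    case: (eqVneq k' k) hk' => [->|k'k] hk'; first by rewrite hk' // setU11.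
    have := hk' (m k'); rewrite setU1r // => /(_ isT).
    by rewrite leqNgt; move/MP: tM => ->.
  by case/set2P: kij => ->; rewrite eqxx; [left|right].
by case=> /eqP ->; rewrite subsetUr top_room // ?set21 ?set22.
Qed.

(** A door of slack elements lacks just one index i0. The slack of i0 would
    complete it to the set of all slacks, which is not dominant; the element to add is
    the highest of T for the order i0. *)
Lemma boundary_door_rooms i0 C :
  (forall t, inl t \notin C) -> door C -> inr i0 \notin C ->
  #|[set C' | room C' & C \subset C']| = 1.
Proof.
move=> noT dC i0C; have cC := door_card dC.
have CE : C = [set inr i | i in [set~ i0]].
  apply/eqP; rewrite eqEcard card_imset; last by move=> ? ? [].
  rewrite cardsC1 -cC leqnn andbT; apply/subsetP => -[t|j]; first by rewrite (negPf (noT t)).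
  move=> jC; apply: imset_f; rewrite !inE; apply: contraNneq i0C => <- //.
have slackC j : j != i0 -> inr j \in C by move=> ji; rewrite CE imset_f // !inE.
pose top := [arg max_(t > t0) ext_rank i0 (inl t)].
have topP t : ext_rank i0 (inl t) <= ext_rank i0 (inl top).
  by rewrite /top; case: arg_maxnP => // s _; apply.
suff -> : [set C' | room C' & C \subset C'] = [set inl top |: C] by rewrite cards1.
apply/setP => C'; rewrite !inE; apply/andP/eqP => [[/andP[domC' /eqP cC'] sCC']|->]; last first.
  rewrite subsetUr /room cardsU1 noT add1n cC eqxx andbT; split=> //.
  apply/dominantP => -[t|j]; last first.
    exists j => x _; have [->//|] := eqVneq x (inr j).
    by move/(ext_rank_slack_min)/ltnW.
  exists i0 => x /setU1P[->//|]; rewrite CE => /imsetP[j]; rewrite !inE => ji ->.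
  exact/ltnW/ext_rank_slack_max.
have [[t|j] uC C'E] := subset_card_succ sCC' (etrans cC' (esym cC)); subst C'.
  congr (inl _ |: _); have /dominantP/(_ (inl top))[i hi] := domC'.
  have ii0 : i = i0.
    apply/eqP/negPn/negP => ii0; have := hi (inr i); rewrite setU1r ?slackC // => /(_ isT).
    by rewrite /= eqxx.
  have := hi (inl t); rewrite setU11 ii0 => /(_ isT) le1.
  suff [] : inl t = inl top :> T + I by [].
  by apply: (@ext_rank_inj i0); apply/eqP; rewrite eqn_leq topP.
have ji0 : j = i0 by apply/eqP; apply: contraNT uC; exact: slackC.
have /dominantP/(_ (inl t0))[i hi] := domC'.
have : inr i \in inr j |: C.
  by have [->|ii0] := eqVneq i i0; rewrite ?ji0 ?setU11 // setU1r // slackC.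
by move/hi; rewrite /= eqxx.
Qed.

(** If a room has label set [set~ i0], two of its elements share a label, and
    the doors in question arise by deleting one or the other; for any other
    incomplete label set there are no such doors. *)
Lemma room_labelled_doors i0 C' :
  room C' -> ext_label @: C' != [set: I] ->
  ~~ odd #|[set C | [&& door C, ext_label @: C == [set~ i0] & C \subset C']]|.
Proof.
move=> /andP[domC' /eqP cC'] nfull.
have [lE|lNE] := eqVneq (ext_label @: C') [set~ i0]; last first.
  suff -> : [set C | [&& door C, ext_label @: C == [set~ i0] & C \subset C']] = set0.
    by rewrite cards0.
  apply/setP => C; rewrite !inE; apply/negP => /and3P[_ /eqP lC sC].
  case/eqP: lNE; apply/eqP; rewrite eqEsubset -{2}lC imsetS // andbT.
  apply/subsetP => j jC; rewrite !inE; apply: contraNneq nfull => ji0.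
  rewrite -subTset; apply/subsetP => i _; have [->|ii0] := eqVneq i i0; first by rewrite -ji0.
  by apply: (subsetP (imsetS _ sC)); rewrite lC !inE.
have I0 : 0 < #|I| by apply/card_gt0P; exists i0.
have [|x [y [[xC yC xy lxy] [injx injy imx imy]]]] := @card_imset_pred _ _ ext_label C'.
  by rewrite lE cardsC1 cC' prednK.
suff -> : [set C | [&& door C, ext_label @: C == [set~ i0] & C \subset C']]
          = [set C' :\ x; C' :\ y].
  rewrite cards2; case: eqP => // e; exfalso.
  have : x \in C' :\ y by rewrite !inE xy.
  by rewrite -e !inE eqxx.
have cD z : z \in C' -> #|C' :\ z|.+1 = #|I|.
  by move=> zC; rewrite -cC' (cardsD1 z C') zC.
apply/setP => C; rewrite !inE; apply/and3P/orP => [[dC /eqP lC sC]|]; last first.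
  by case=> /eqP ->; rewrite subsetDl ?imx ?imy lE eqxx /door cD // eqxx
    (dominantS (subsetDl _ _) domC').
have cC := door_card dC.
have [z zC C'E] := subset_card_succ sC (etrans cC' (esym cC)).
have CE : C = C' :\ z by rewrite C'E setU1K.
have inj : {in C &, injective ext_label}.
  apply/imset_injP; rewrite lC cardsC1; apply/eqP/succn_inj.
  by rewrite cC prednK.
case: (eqVneq z x) CE => [->|zx] CE; first by left; apply/eqP.
case: (eqVneq z y) CE => [->|zy] CE; first by right; apply/eqP.
exfalso; move/eqP: xy; apply; apply: inj => //; rewrite CE !inE ?xC ?yC andbT eq_sym //.
Qed.

(** Double counting of the pairs of a door with labels [set~ i0] and a room
    containing it. The set of slacks other than i0 is one such door and lies in one
    room; each of the other doors contains an element of T, hence lies in two, so the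
    number of pairs is odd. Without a fully labelled room it would be even by
    [room_labelled_doors]. *)
Lemma ex_full_room (i0 : I) : exists2 C, room C & ext_label @: C = [set: I].
Proof.
have I0 : 0 < #|I| by apply/card_gt0P; exists i0.
case: (pickP [pred C | room C && (ext_label @: C == [set: I])]) => [C /andP[rC /eqP]|none].
  by exists C.
have nfull C : room C -> ext_label @: C != [set: I].
  by move=> rC; have := none C; rewrite /= rC /= => ->.
exfalso.
pose D := [pred C | door C & ext_label @: C == [set~ i0]].
pose B : {set T + I} := [set inr i | i in [set~ i0]].
have BD : B \in D.
  rewrite inE /= /door /B card_imset; last by move=> ? ? [].
  rewrite cardsC1 prednK // eqxx andbT -imset_comp imset_id eqxx andbT.
  apply/dominantP => -[t|j].
    exists i0 => x /imsetP[j]; rewrite !inE => ji ->.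
    exact/ltnW/ext_rank_slack_max.
  exists j => x _; have [->//|] := eqVneq x (inr j).
  by move/(ext_rank_slack_min)/ltnW.
have count : \sum_(C' in [pred C' | room C']) #|[set C | [&& door C, ext_label @: C == [set~ i0] & C \subset C']]|
   = \sum_(C in D) #|[set C' | room C' & C \subset C']|.
  under eq_bigr do rewrite -sum1_card big_mkcond.
  rewrite exchange_big /= [RHS]big_mkcond; apply: eq_bigr => C _ /=.
  case: ifPn => CD.
    rewrite -sum1_card [in RHS]big_mkcond [LHS]big_mkcond; apply: eq_bigr => C' _.
    move: CD; rewrite !inE => /andP[-> ->] /=.
    by case: (room C'); case: (C \subset C').
  rewrite big1 // => C' _; rewrite inE; case: ifP => // /and3P[d1 d2 _].
  by move: CD; rewrite inE /= d1 d2.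
have : odd (\sum_(C in D) #|[set C' | room C' & C \subset C']|).
  rewrite (bigD1 B) //= (@boundary_door_rooms i0).
  - rewrite oddD /=; apply/negP; apply/negP.
    rewrite (big_morph odd oddD (erefl _)) big1 // => C /andP[+ CB].
    rewrite inE => /andP[dC /eqP lC]; rewrite inner_door_rooms //.
    apply/existsP; apply: contraNT CB; rewrite negb_exists => /forallP noT.
    rewrite eqEcard; apply/andP; split; last first.
      have /andP[_ /eqP] := dC; move: BD; rewrite inE => /andP[/andP[_ /eqP <-] _] [->] //.
    apply/subsetP => -[t|j] jC; first by have := noT t; rewrite jC.
    by apply: imset_f; rewrite -lC; apply/imsetP; exists (inr j).
  - by move=> t; apply/imsetP => -[].
  - by move: BD; rewrite inE => /andP[].
  - by apply/imsetP => -[j]; rewrite !inE => /eqP + [] => /[swap] ->.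
rewrite -count (big_morph odd oddD (erefl _)) big1 // => C' rC'.
by apply: negbTE; apply: (room_labelled_doors i0 rC'); exact: nfull.
Qed.

(** In a fully labelled room, let X be its elements from T and S the indices
    whose slack is absent. The labels in S are carried by X, and an index whose slack
    is present cannot witness the domination of an element of T, as the slack is lower. *)
Theorem no_bullying (i0 : I) :
  exists (S : {set I}) (X : {set T}),
    [/\ (forall i, i \in S -> exists2 x, x \in X & l x = i)
      & (forall y, exists2 i, i \in S & forall x, x \in X -> w i y <= w i x)].
Proof.
have [C /andP[/dominantP domC _] lC] := ex_full_room i0.
have T0 : 0 < #|T| by apply/card_gt0P; exists t0.
exists [set i | inr i \notin C], [set x | inl x \in C]; split=> [i|y].
  rewrite inE => iC; have : i \in ext_label @: C by rewrite lC inE.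
  case/imsetP => -[t|j] uC /= iE; first by exists t; rewrite ?inE.
  by rewrite iE uC in iC.
have [i hi] := domC (inl y); exists i.
  by rewrite inE; apply/negP => /hi; rewrite /= eqxx.
move=> x; rewrite inE => /hi; rewrite /= ltnS => h.
rewrite leqNgt; apply/negP => lt.
have h1 : (w i x).+1 * #|T| <= w i y * #|T| by rewrite leq_mul2r lt orbT.
have rx : enum_rank x < #|T| := ltn_ord (enum_rank x).
have := leq_trans (leq_trans h1 (leq_addr _ _)) h.
by rewrite mulSn addnC leq_add2l leqNgt rx.
Qed.

End Scarf.

(** * Brouwer's theorem on a cube, approximately *)

Local Open Scope ring_scope.

(** Scarf's lemma on the grid {0,...,M}^n, with the coordinate orders and one
    more, of index [None], that ranks a point by the smallness of its coordinate sum.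
    A point is labelled by a coordinate that h increases, or by [None] if there is no
    such coordinate. Raising by one the least values v_j over X of the coordinates in
    S, and setting the others to 0, yields a grid point that only [None] can dominate.
    Hence [None] is a label, and the coordinates of points of X stay within n steps of
    v. At the point labelled [None] all coordinates of h x - x are at most 0; they are
    nearly nonnegative, because for j in S some close point has its j-th coordinate
    increased by h, and for j outside S the coordinate x j itself is close to 0. *)
Lemma brouwer_cube (R : realType) n (h : ('I_n -> R) -> 'I_n -> R) (d e : R) :
  0 < d -> 0 < e ->
  (forall x, (forall i, 0 <= x i <= 1) -> forall i, 0 <= h x i <= 1) ->
  (forall x y, (forall i, 0 <= x i <= 1) -> (forall i, 0 <= y i <= 1) ->
     (forall i, `|x i - y i| <= d) -> forall i, `|h x i - h y i| <= e) ->
  exists2 x, (forall i, 0 <= x i <= 1) & forall i, `|h x i - x i| <= 2 * e.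
Proof.
move=> d0 e0 h01 hunif.
pose M := (Num.truncn (n%:R / Num.min d e)).+1.
have m0 : 0 < Num.min d e by rewrite lt_min d0.
have M0 : 0 < M%:R :> R by rewrite ltr0n.
have nM : n%:R / M%:R <= Num.min d e.
  rewrite ler_pdivrMr // mulrC -ler_pdivrMr //.
  by rewrite ltW // truncnS_gt.
have [nMd nMe] : n%:R / M%:R <= d /\ n%:R / M%:R <= e.
  by move: nM; rewrite le_min => /andP.
pose T := {ffun 'I_n -> 'I_M.+1}.
pose pt (y : T) i : R := (y i)%:R / M%:R.
have pt01 y i : 0 <= pt y i <= 1.
  by rewrite divr_ge0 ?ler0n // ler_pdivrMr // mul1r ler_nat -ltnS ltn_ord.
pose w (i : option 'I_n) (y : T) : nat :=
  if i is Some i then y i else (n * M - \sum_j y j)%N.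
pose l (y : T) := [pick i | pt y i < h (pt y) i].
have [S [X [SX dom]]] := no_bullying w l [ffun=> ord0] None.
have [x0 x0X] : exists x0, x0 \in X.
  by have [i /SX[x xX _] _] := dom [ffun=> ord0]; exists x.
pose v j : nat := if Some j \in S then [arg min_(x < x0 in X) x j] j else 0.
have v_le (x : T) j : x \in X -> (v j <= x j)%N.
  by rewrite /v; case: ifP => // _ xX; case: arg_minnP => // y _; apply.
have v_att j : Some j \in S -> exists2 x, x \in X & v j = x j.
  by rewrite /v => ->; case: arg_minnP => // y yX _; exists y.
have lab i : Some i \in S -> exists2 x, x \in X & pt x i < h (pt x) i.
  move=> /SX[x xX]; rewrite /l; case: pickP => // j hj [<-]; by exists x.
have v_lt j : Some j \in S -> (v j < M)%N.
  case/lab => x xX lt; apply: (leq_ltn_trans (v_le _ _ xX)).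
  rewrite -(ltr_nat R) -[ltRHS]mul1r -ltr_pdivrMr //; apply: (lt_le_trans lt).
  by case/andP: (h01 _ (pt01 x) j).
pose y : T := [ffun j => inord (if Some j \in S then (v j).+1 else 0)].
have yE j : y j = (v j + (Some j \in S))%N :> nat.
  rewrite ffunE inordK; last by case: ifP => // /v_lt.
  by rewrite /v; case: (Some j \in S); rewrite ?addn1 ?addn0.
(* [y] beats X in every coordinate order of S, so only [None] is left. *)
have [[i iS hy|NS hy]] : exists2 i, i \in S & forall x, x \in X -> (w i y <= w i x)%N by exact: dom.
  have [x xX vx] := v_att _ iS.
  by have := hy _ xX; rewrite /= yE iS -vx addn1 ltnn.
have sum_le (x : T) : (\sum_j x j <= n * M)%N.
  apply: (@leq_trans (\sum_(j < n) M)%N); last by rewrite sum_nat_const card_ord.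
  by apply: leq_sum => j _; rewrite -ltnS.
have x_le (x : T) j : x \in X -> (x j <= v j + n)%N.
  move=> xX; have := hy _ xX; rewrite /= => hyx.
  have {hyx} : (\sum_j x j <= \sum_j y j)%N by rewrite -(leq_sub2lE _ (sum_le x)).
  under [X in (_ <= X)%N]eq_bigr do rewrite yE.
  rewrite big_split /= (bigD1 j) //= [X in (_ <= X + _)%N](bigD1 j) //=.
  have : (\sum_(i < n | i != j) v i <= \sum_(i < n | i != j) x i)%N.
    by apply: leq_sum => i _; exact: v_le.
  have : (\sum_(i < n) (Some i \in S) <= n)%N.
    apply: (@leq_trans (\sum_(j < n) 1)%N); last by rewrite sum_nat_const card_ord muln1.
    by apply: leq_sum => i _; case: (_ \in _).
  move=> hS hv /(leq_trans (leq_add (leqnn (x j)) hv)).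
  by rewrite addnAC leq_add2r => /leq_trans; apply; rewrite leq_add2l.
have close x x' j : x \in X -> x' \in X -> `|pt x j - pt x' j| <= n%:R / M%:R.
  move=> xX x'X; rewrite /pt -mulrBl normrM (ger0_norm (ltW (_ : 0 < M%:R^-1))) ?invr_gt0 //.
  apply: ler_wpM2r; first by rewrite invr_ge0 ltW.
  have := v_le _ j xX; have := x_le _ j xX; have := v_le _ j x'X; have := x_le _ j x'X.
  move: (nat_of_ord _) (nat_of_ord _) (v j) => p q r h1 h2 h3 h4.
  rewrite ler_norml lerBlDr lerNl opprB lerBlDr -!natrD !ler_nat.
  by move: h1 h2 h3 h4; clear; lia.
have [x xX lx] := SX _ NS.
have hx j : h (pt x) j <= pt x j.
  move: lx; rewrite /l; case: pickP => // none _.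
  by have := none j; rewrite ltNge => /negbFE.
exists (pt x) => // j.
rewrite ler0_norm ?subr_le0 // opprB lerBlDr.
case: (boolP (Some j \in S)) => [jS|jS]; last first.
  have := x_le _ j xX; rewrite /v (negPf jS) add0n => xj.
  have /andP[hj _] := h01 _ (pt01 x) j.
  have : pt x j <= n%:R / M%:R by rewrite ler_pM2r ?invr_gt0 // ler_nat.
  lra.
have [x' x'X lt] := lab _ jS.
have := hunif _ _ (pt01 x') (pt01 x) (fun i => le_trans (close _ _ i x'X xX) nMd) j.
have := close _ _ j x'X xX.
rewrite !ler_norml => /andP[c1 c2] /andP[c3 c4]; lra.
Qed.

(** * Limits along an ultrafilter, and approximate fixed points *)

Local Open Scope classical_set_scope.
Local Open Scope ring_scope.

Lemma within_continuous01P (R : realType) (u : R -> R) :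
  {within `[0, 1], continuous u} <->
  forall tau : R, tau \in `[0, 1] -> forall e : R, 0 < e -> exists2 d : R, 0 < d &
    forall t : R, t \in `[0, 1] -> `|t - tau| < d -> `|u t - u tau| <= e.
Proof.
rewrite subspace_continuousP; split=> [h tau tau01 e e0|h tau tau01].
  have /cvgrPdist_le /(_ _ e0) := h tau tau01.
  rewrite near_withinE => /nbhs_ballP[d /= d0 hd]; exists d => // t t01 td.
  by rewrite distrC; apply: hd => //=; rewrite /ball /= distrC.
apply/cvgrPdist_le => e e0; have [d d0 hd] := h tau tau01 _ e0.
rewrite near_withinE; apply/nbhs_ballP; exists d => //= t td t01.
by rewrite distrC; apply: hd => //; rewrite distrC.
Qed.

(** Limits along one fixed filter are taken for all t at once, which saves the
    extraction of diagonal subsequences in compactness arguments. *)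
Lemma ultralimit (R : realType) : exists U : set_system nat,
  [/\ ProperFilter U, (forall A, (\oo : set_system nat) A -> U A) &
    forall (x : nat -> R) (M : R), (forall n, `|x n| <= M) ->
      exists l : R, forall e : R, 0 < e -> U [set n | `|x n - l| <= e]].
Proof.
have [U [UU oU]] := ultraFilterLemma (@eventually_filter).
exists U; split=> //; first exact: ultra_proper.
move=> x M xM; have UF : ProperFilter U by exact: ultra_proper.
have [l cl] : exists l : R, cluster (x @ U) l.
  have := @segment_compact R (- M) M (x @ U) _.
  case=> [|l [lM cl]]; last by exists l.
  by apply: (@filterS _ U _ setT _ _ filterT) => n _ /=; rewrite in_itv /= -ler_norml.
exists l => e e0.
have [//|UC] := in_ultra_setVsetC [set n | `|x n - l| <= e] UU.
have [y [/= [n hn <-]]] : [set x n | n in ~` [set n | `|x n - l| <= e]] `&` ball l e !=set0.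
  apply: cl; last exact: nbhsx_ballx.
  by apply: (@filterS _ U _ _ _ _ UC) => n hn /=; exists n.
by move=> /ltW; rewrite distrC => /hn.
Qed.

(** Heine's theorem for a pseudo-distance. Besides |u t - u s| for continuous u
    it is meant for the mean distance between two sections of a kernel. *)
Lemma uniform_on_segment (R : realType) (x y : R) (dist : R -> R -> R) :
  (forall t s, dist t s = dist s t) ->
  (forall r t s, r \in `[x, y] -> t \in `[x, y] -> s \in `[x, y] ->
    dist t s <= dist t r + dist r s) ->
  (forall tau : R, tau \in `[x, y] -> forall e : R, 0 < e -> exists2 d : R, 0 < d &
    forall t : R, t \in `[x, y] -> `|t - tau| < d -> dist t tau <= e) ->
  forall e : R, 0 < e -> exists2 d : R, 0 < d & forall t s : R, t \in `[x, y] -> s \in `[x, y] ->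
    `|t - s| <= d -> dist t s <= e.
Proof.
move=> distC tri cont e e0; apply: contrapT => H.
have bad (n : nat) : exists p : R * R, [/\ p.1 \in `[x, y], p.2 \in `[x, y],
    `|p.1 - p.2| <= n.+1%:R^-1 & e < dist p.1 p.2].
  apply: contrapT => hn; apply: H; exists n.+1%:R^-1; first by rewrite invr_gt0.
  move=> t s txy sxy ts; rewrite leNgt; apply/negP => lt.
  by apply: hn; exists (t, s).
have [p hp] := choice bad.
have [U [UF oU lim]] := ultralimit R.
have [n|l hl] := lim (fun n => (p n).1) (`|x| + `|y|).
  have [+ _ _ _] := hp n; rewrite in_itv /= => /andP[h1 h2].
  have := ler_norm y; have := lerNnormlW (lexx `|x|).
  have := normr_ge0 x; have := normr_ge0 y.
  by rewrite ler_norml => *; apply/andP; split; lra.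
have lxy : l \in `[x, y].
  rewrite in_itv /=; apply/andP; split.
    apply/ler_addgt0Pr => d /hl /filter_ex[n /=]; rewrite ler_norml => /andP[_].
    by have [+ _ _ _] := hp n; rewrite in_itv /= => /andP[h1 h2]; lra.
  apply/ler_addgt0Pr => d /hl /filter_ex[n /=]; rewrite ler_norml => /andP[].
  by have [+ _ _ _] := hp n; rewrite in_itv /= => /andP[h1 h2]; lra.
have e20 : 0 < e / 4 by lra.
have [d d0 hd] := cont _ lxy _ e20.
have d20 : 0 < d / 4 by lra.
have Us : U [set n | n.+1%:R^-1 <= d / 4].
  apply: oU; have := @near_infty_natSinv_lt R (PosNum d20).
  by apply: filterS => n /= /ltW.
have [n [/= h1 h2]] := filter_ex (filterI (hl _ d20) Us).
have [p1 p2 p12 ple] := hp n.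
have {}p12 := le_trans p12 h2.
have a1 : dist (p n).1 l <= e / 4 by apply: hd => //; lra.
have a2 : dist (p n).2 l <= e / 4.
  apply: hd => //; move: h1 p12; rewrite !ler_norml ltr_norml => /andP[? ?] /andP[? ?].
  by apply/andP; split; lra.
by have := tri l (p n).1 (p n).2 lxy p1 p2; rewrite (distC l); lra.
Qed.

Lemma dist_max_le (R : realFieldType) (l p q d : R) :
  `|p - q| <= d -> `|Num.max l p - Num.max l q| <= d.
Proof.
rewrite !ler_norml => /andP[? ?].
by case: (leP l p) => ?; case: (leP l q) => ?; apply/andP; split; lra.
Qed.

(** The convex sets on which Schauder's theorem is needed. *)
Definition box (R : realType) (a b lo hi : R) (u : R -> R) : Prop :=
  (forall t : R, t \in `[0, 1] -> `|u t| <= hi) /\ (forall t : R, t \in `[a, b] -> lo <= u t).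

Definition equicontinuous_on (R : realType) (Dom : (R -> R) -> Prop)
    (H : (R -> R) -> R -> R) : Prop :=
  forall e : R, 0 < e -> exists2 d : R, 0 < d & forall u, Dom u ->
    forall t s : R, t \in `[0, 1] -> s \in `[0, 1] -> `|t - s| <= d -> `|H u t - H u s| <= e.

Definition unif_continuous_on (R : realType) (Dom : (R -> R) -> Prop)
    (H : (R -> R) -> R -> R) : Prop :=
  forall e : R, 0 < e -> exists2 d : R, 0 < d & forall u v, Dom u -> Dom v ->
    (forall t : R, t \in `[0, 1] -> `|u t - v t| <= d) ->
    forall t : R, t \in `[0, 1] -> `|H u t - H v t| <= e.

(** Since the values of H are equicontinuous, H u is known up to e from one
    sample point in each cell of a fine subdivision, and replacing functions by step
    functions leads to a map of the cube of cell values. [Adm] stands for a class of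
    functions on which H is defined and which contains the step functions. In a cell
    that meets [a,b] the sample point lies in [a,b], so that the lower bound carries
    over from the samples to the step function. *)
Lemma approx_fixed_point (R : realType) (Adm : (R -> R) -> Prop) (H : (R -> R) -> R -> R)
    (a b lo hi : R) :
  0 < hi -> lo <= hi -> - hi <= lo -> {subset `[a, b] <= `[0, 1]} ->
  (forall n (x : nat -> R), Adm (fun t => x (Num.truncn (n%:R * t)))) ->
  let Dom u := Adm u /\ box a b lo hi u in
  (forall u, Dom u -> box a b lo hi (H u)) ->
  equicontinuous_on Dom H -> unif_continuous_on Dom H ->
  forall e : R, 0 < e -> exists2 u, Dom u & forall t : R, t \in `[0, 1] -> `|H u t - u t| <= e.
Proof.
move=> hi0 lohi hilo sub step Dom Hbox Heq Huc e e0.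
have e20 : 0 < e / 2 by lra.
have [d1 d10 hd1] := Heq _ e20.
pose eps := e / (8 * hi).
have eps0 : 0 < eps by rewrite divr_gt0 // mulr_gt0.
have hi20 : 0 < 2 * hi by lra.
have [d2 d20 hd2] := Huc (2 * hi * eps) (mulr_gt0 hi20 eps0).
pose m := (Num.truncn d1^-1).+1.
have m0 : 0 < m%:R :> R by rewrite ltr0n.
have md : m%:R^-1 <= d1.
  by rewrite -[d1]invrK lef_pV2 ?posrE ?invr_gt0 // ltW // truncnS_gt.
pose cell (t : R) := Num.truncn (m%:R * t).
have cellP t : t \in `[0, 1] -> (cell t)%:R <= m%:R * t < (cell t).+1%:R.
  by move=> /itvP t01; apply: truncn_itv; rewrite mulr_ge0 ?t01 // ltW.
have cell_lt t : t \in `[0, 1] -> (cell t < m.+1)%N.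
  move=> t01; have /andP[h _] := cellP t t01; rewrite ltnS -(ler_nat R).
  by apply: (le_trans h); rewrite ger_pMr // (itvP t01).
have cell_close t s : t \in `[0, 1] -> s \in `[0, 1] -> cell t = cell s -> `|t - s| <= d1.
  move=> t01 s01 ts; have := cellP _ t01; have := cellP _ s01; rewrite ts -addn1 natrD.
  move=> /andP[h1 h2] /andP[h3 h4]; apply: le_trans md.
  rewrite -(ler_pM2l m0) mulfV ?gt_eqF // -[X in X * _](gtr0_norm m0) -normrM ler_norml mulrBr.
  apply/andP; split; lra.
(* Sample points, in [a,b] for each cell that meets [a,b]. *)
have /choice[tau htau] : forall j : 'I_m.+1, exists s : R,
    [/\ s \in `[0, 1], cell s = j :> nat &
    forall t : R, t \in `[a, b] -> cell t = j :> nat -> s \in `[a, b]].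
  move=> j.
  have [[t [tab tj]]|no] := pselect (exists t, t \in `[a, b] /\ cell t = j).
    by exists t; split=> //; exact: sub.
  exists (j%:R / m%:R); split.
  - rewrite in_itv /= divr_ge0 ?ler0n // ler_pdivrMr // mul1r ler_nat.
    by rewrite -ltnS ltn_ord.
  - by rewrite /cell mulrC divfK ?gt_eqF // natrK.
  - by move=> t tab tj; case: no; exists t.
pose low j := if tau j \in `[a, b] then lo else - hi.
have low_le j : - hi <= low j <= hi.
  by rewrite /low; case: ifP => _; rewrite ?hilo ?lohi // lexx; lra.
pose val (x : 'I_m.+1 -> R) (j : 'I_m.+1) := Num.max (low j) ((2 * x j - 1) * hi).
pose ext (x : 'I_m.+1 -> R) (t : R) := val x (inord (cell t)).
have ext_tau x j : ext x (tau j) = val x j.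
  by rewrite /ext; have [_ -> _] := htau j; rewrite inord_val.
have ext_adm x : Adm (ext x) by exact: (step m (fun i => val x (inord i))).
have ext_box x : (forall j, 0 <= x j <= 1) -> box a b lo hi (ext x).
  move=> x01; split=> t ht; rewrite /ext /val.
    set j := inord _; have /andP[l1 l2] := low_le j; have /andP[x0 x1] := x01 j.
    rewrite ler_norml le_max ge_max l1 l2 /=.
    by rewrite -[leRHS]mul1r ler_pM2r //; lra.
  rewrite le_max /low; have [_ _ h] := htau (inord (cell t)).
  by rewrite (h t) ?lexx // inordK // cell_lt // sub.
have ext_dom x : (forall j, 0 <= x j <= 1) -> Dom (ext x).
  by move=> x01; split; [exact: ext_adm|exact: ext_box].
pose h x j := (H (ext x) (tau j) + hi) / (2 * hi).
have [||x x01 hx] := @brouwer_cube R m.+1 h (d2 / (2 * hi)) eps (divr_gt0 d20 hi20) eps0.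
- move=> x x01 j; have [Hb _] := Hbox _ (ext_dom x x01).
  have [tj _ _] := htau j; have := Hb _ tj; rewrite ler_norml => /andP[h1 h2].
  rewrite /h ler_pdivrMr // mul1r.
  apply/andP; split; last by lra.
  by apply: divr_ge0; lra.
- move=> x y x01 y01 xy j; have [tj _ _] := htau j.
  have -> : h x j - h y j = (H (ext x) (tau j) - H (ext y) (tau j)) / (2 * hi).
    by rewrite /h -mulrBl; congr (_ / _); ring.
  rewrite normrM [X in _ * X]gtr0_norm ?invr_gt0 // ler_pdivrMr //.
  rewrite [leRHS]mulrC; apply: hd2 => //; try exact: ext_dom.
  move=> t _; rewrite /ext /val; set i := inord _.
  have : `|(2 * x i - 1) * hi - (2 * y i - 1) * hi| <= d2.
    have -> : (2 * x i - 1) * hi - (2 * y i - 1) * hi = (x i - y i) * (2 * hi) by ring.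
    by rewrite normrM [X in _ * X]gtr0_norm // -ler_pdivlMr.
  exact: dist_max_le.
exists (ext x); first exact: ext_dom.
move=> t t01; pose j : 'I_m.+1 := inord (cell t).
have [tj cj _] := htau j.
have cjt : cell (tau j) = cell t by rewrite cj inordK // cell_lt.
have extE : ext x t = val x j by [].
have [Hb Hlo] := Hbox _ (ext_dom x x01).
have c1 : `|H (ext x) t - H (ext x) (tau j)| <= e / 2.
  by apply: hd1 => //; [exact: ext_dom|exact: cell_close].
have c2 : `|H (ext x) (tau j) - val x j| <= e / 2.
  have lowH : low j <= H (ext x) (tau j).
    rewrite /low; case: ifP => [/Hlo//|_].
    by have := Hb _ tj; rewrite ler_norml => /andP[].
  have : `|H (ext x) (tau j) - (2 * x j - 1) * hi| <= e / 2.
    have -> : H (ext x) (tau j) - (2 * x j - 1) * hi = (h x j - x j) * (2 * hi).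
      by rewrite /h; field; rewrite gt_eqF.
    rewrite normrM [X in _ * X]gtr0_norm //.
    apply: (le_trans (ler_wpM2r (ltW hi20) (hx j))).
    by rewrite /eps le_eqVlt; apply/orP; left; apply/eqP; field; rewrite gt_eqF.
  rewrite /val; move: lowH; move: (H _ _) (low j) ((2 * x j - 1) * hi) => p q r qp.
  by rewrite !ler_norml => /andP[? ?]; case: (leP q r) => ?; apply/andP; split; lra.
rewrite extE; move: c1 c2; rewrite !ler_norml => /andP[? ?] /andP[? ?]; apply/andP; split; lra.
Qed.

(** * Schauder's theorem for sets given by pointwise bounds *)

(** The images of approximate fixed points have a pointwise limit v along an
    ultrafilter. By equicontinuity v is continuous and the convergence is uniform;
    then uniform continuity of H yields H v = v. *)
Theorem schauder_box (R : realType) (Adm : (R -> R) -> Prop) (H : (R -> R) -> R -> R)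
    (a b lo hi : R) :
  0 < hi -> lo <= hi -> - hi <= lo -> {subset `[a, b] <= `[0, 1]} ->
  (forall n (x : nat -> R), Adm (fun t => x (Num.truncn (n%:R * t)))) ->
  (forall u : R -> R, {within `[0, 1], continuous u} -> Adm u) ->
  let Dom u := Adm u /\ box a b lo hi u in
  (forall u, Dom u -> box a b lo hi (H u)) ->
  equicontinuous_on Dom H -> unif_continuous_on Dom H ->
  exists u : R -> R, [/\ {within `[0, 1], continuous u}, box a b lo hi u &
    forall t : R, t \in `[0, 1] -> H u t = u t].
Proof.
move=> hi0 lohi hilo sub step cont Dom Hbox Heq Huc.
have approx (n : nat) : exists u, Dom u /\
    forall t : R, t \in `[0, 1] -> `|H u t - u t| <= n.+1%:R^-1.
  have [|u Du hu] := approx_fixed_point hi0 lohi hilo sub step Hbox Heq Huc (_ : 0 < n.+1%:R^-1).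
    by rewrite invr_gt0.
  by exists u.
have [u hu] := choice approx.
have [U [UF oU lim]] := ultralimit R.
have /choice[v hv] : forall t : R, exists l : R, t \in `[0, 1] ->
    forall e : R, 0 < e -> U [set n | `|H (u n) t - l| <= e].
  move=> t; have [t01|_] := boolP (t \in `[0, 1]); last by exists 0.
  have [n|l hl] := lim (fun n => H (u n) t) hi.
    by have [/Hbox[+ _] _] := hu n; apply.
  by exists l.
have vbox : box a b lo hi v.
  split=> t ht.
    apply/ler_addgt0Pr => e /(hv _ ht)/filter_ex[n /=].
    have [/Hbox[/(_ _ ht) + _] _] := hu n.
    rewrite !ler_norml => /andP[? ?] /andP[? ?]; apply/andP; split; lra.
  apply/ler_addgt0Pr => e /(hv _ (sub _ ht))/filter_ex[n /=].
  have [/Hbox[_ /(_ _ ht) +] _] := hu n.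
  by rewrite !ler_norml => ? /andP[? ?]; lra.
have veq (e d : R) : (forall u, Dom u ->
    forall t s : R, t \in `[0, 1] -> s \in `[0, 1] -> `|t - s| <= d -> `|H u t - H u s| <= e) ->
    forall t s : R, t \in `[0, 1] -> s \in `[0, 1] -> `|t - s| <= d -> `|v t - v s| <= e.
  move=> hd t s t01 s01 ts; apply/ler_addgt0Pr => e' e'0.
  have e'20 : 0 < e' / 2 by lra.
  have [n [/= h1 h2]] := filter_ex (filterI (hv _ t01 _ e'20) (hv _ s01 _ e'20)).
  have [Dn _] := hu n; have := hd _ Dn _ _ t01 s01 ts; move: h1 h2.
  by rewrite !ler_norml => /andP[? ?] /andP[? ?] /andP[? ?]; apply/andP; split; lra.
have vcont : {within `[0, 1], continuous v}.
  apply/within_continuous01P => tau tau01 e e0; have [d d0 hd] := Heq _ e0.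
  by exists d => // t t01 /ltW; exact: veq.
have Dv : Dom v by split=> //; exact: cont.
(* Finitely many grid points control the convergence everywhere. *)
have vunif (e : R) : 0 < e -> U [set n | forall t : R, t \in `[0, 1] -> `|H (u n) t - v t| <= e].
  move=> e0; have e30 : 0 < e / 3 by lra.
  have [d d0 hd] := Heq _ e30.
  pose m := (Num.truncn d^-1).+1.
  have m0 : 0 < m%:R :> R by rewrite ltr0n.
  have md : m%:R^-1 <= d.
    by rewrite -[d]invrK lef_pV2 ?posrE ?invr_gt0 // ltW // truncnS_gt.
  have grid (j : 'I_m.+1) : j%:R / m%:R \in `[0, 1 : R].
    rewrite in_itv /= divr_ge0 ?ler0n // ler_pdivrMr // mul1r ler_nat.
    by rewrite -ltnS ltn_ord.
  have : U [set n | forall j : 'I_m.+1, `|H (u n) (j%:R / m%:R) - v (j%:R / m%:R)| <= e / 3].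
    by apply: filter_forall => j; exact: hv.
  apply: filterS => n /= hn t t01.
  have [Dn _] := hu n.
  have tm : 0 <= m%:R * t by rewrite mulr_ge0 ?(itvP t01) // ltW.
  have /andP[h1 h2] := truncn_itv tm.
  have jm : (Num.truncn (m%:R * t) < m.+1)%N.
    by rewrite ltnS -(ler_nat R); apply: (le_trans h1); rewrite ger_pMr // (itvP t01).
  pose j := Ordinal jm.
  have tj : `|t - j%:R / m%:R| <= d.
    apply: le_trans md; rewrite -(ler_pM2l m0) mulfV ?gt_eqF //.
    rewrite -[X in X * _](gtr0_norm m0) -normrM ler_norml mulrBr (mulrCA m%:R) mulfV ?gt_eqF // mulr1.
    by move: h2; rewrite -addn1 natrD /= => h2; apply/andP; split; lra.
  have := hn j; have := hd _ Dn _ _ t01 (grid j) tj; have := veq _ _ hd _ _ t01 (grid j) tj.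
  by rewrite !ler_norml => /andP[? ?] /andP[? ?] /andP[? ?]; apply/andP; split; lra.
exists v; split=> // t t01; apply/eqP; rewrite -subr_eq0 -normr_le0; apply/ler_addgt0Pr => e e0.
have e20 : 0 < e / 2 by lra.
have [d d0 hd] := Huc _ e20.
have d20 : 0 < Num.min (d / 2) (e / 2) by rewrite lt_min; apply/andP; split; lra.
have Us : U [set n | n.+1%:R^-1 <= d / 2].
  have d40 : 0 < d / 2 by lra.
  by apply: oU; have := @near_infty_natSinv_lt R (PosNum d40); apply: filterS => n /= /ltW.
have [n [/= h1 h2]] := filter_ex (filterI (vunif _ d20) Us).
have [Dn hn] := hu n.
have close (s : R) : s \in `[0, 1] -> `|u n s - v s| <= d.
  move=> s01; have := le_trans (hn _ s01) h2; have := h1 _ s01; rewrite le_min => /andP[+ _].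
  by rewrite !ler_norml => /andP[? ?] /andP[? ?]; apply/andP; split; lra.
have := hd _ _ Dn Dv close _ t01; have := h1 _ t01; rewrite le_min => /andP[_ +].
by rewrite !ler_norml => /andP[? ?] /andP[? ?]; apply/andP; split; lra.
Qed.

(** * Compression of a cone *)

Definition bounded01 (R : realType) (M : R) (u : R -> R) : Prop :=
  forall t : R, t \in `[0, 1] -> `|u t| <= M.

Lemma norm01_ge (R : realType) (M : R) (u : R -> R) (t : R) :
  bounded01 M u -> t \in `[0, 1] -> `|u t| <= norm01 u.
Proof.
move=> uM t01; apply: ub_le_sup; last by exists t.
by exists M => _ [s /uM ? <-].
Qed.

Lemma norm01_le (R : realType) (M : R) (u : R -> R) :
  bounded01 M u -> norm01 u <= M.
Proof.
move=> uM; apply: ge_sup; last by move=> _ [s /uM ? <-].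
by exists `|u 0|, 0 => //=; rewrite in_itv /= lexx ler01.
Qed.

Definition min_on (R : realType) (a b : R) (u : R -> R) : R :=
  inf [set u t | t in `[a, b]].

Lemma min_on_le (R : realType) (a b M : R) (u : R -> R) (t : R) :
  (forall s, s \in `[a, b] -> M <= u s) -> t \in `[a, b] -> min_on a b u <= u t.
Proof.
move=> uM tab; apply: ge_inf; last by exists t.
by exists M => _ [s /uM ? <-].
Qed.

Lemma min_on_ge (R : realType) (a b M : R) (u : R -> R) : a <= b ->
  (forall s, s \in `[a, b] -> M <= u s) -> M <= min_on a b u.
Proof.
move=> ab uM; apply: lb_le_inf; last by move=> _ [s /uM ? <-].
by exists (u a), a => //=; rewrite in_itv /= lexx ab.
Qed.

Lemma norm01_dist (R : realType) (M d : R) (u v : R -> R) :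
  bounded01 M u -> bounded01 M v ->
  (forall t, t \in `[0, 1] -> `|u t - v t| <= d) -> `|norm01 u - norm01 v| <= d.
Proof.
move=> uM vM uv.
have half (x y : R -> R) : bounded01 M y ->
    (forall t, t \in `[0, 1] -> `|x t - y t| <= d) -> norm01 x - norm01 y <= d.
  move=> yM xy; rewrite lerBlDr; apply: norm01_le => t t01.
  have := norm01_ge yM t01; have := xy _ t01; have := ler_normD (x t - y t) (y t).
  by rewrite subrK; lra.
have h1 := half u v vM uv.
have h2 : norm01 v - norm01 u <= d by apply: half => // t t01; rewrite distrC uv.
by rewrite ler_norml; apply/andP; split; lra.
Qed.

Lemma min_on_dist (R : realType) (a b M d : R) (u v : R -> R) : a <= b ->
  (forall t, t \in `[a, b] -> M <= u t) -> (forall t, t \in `[a, b] -> M <= v t) ->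
  (forall t, t \in `[a, b] -> `|u t - v t| <= d) -> `|min_on a b u - min_on a b v| <= d.
Proof.
move=> ab uM vM uv.
have half (x y : R -> R) : (forall t, t \in `[a, b] -> M <= y t) ->
    (forall t, t \in `[a, b] -> `|x t - y t| <= d) -> min_on a b y - d <= min_on a b x.
  move=> yM xy; apply: min_on_ge => // t tab.
  by have := min_on_le yM tab; have := xy _ tab; rewrite ler_norml => /andP[? ?]; lra.
have h1 := half u v vM uv.
have h2 : min_on a b u - d <= min_on a b v by apply: half => // t t01; rewrite distrC uv.
by rewrite ler_norml; apply/andP; split; lra.
Qed.

(** Pointwise form of min u >= c max |u|, meaningful for discontinuous u. *)
Definition cone0 (R : realType) (a b c : R) (u : R -> R) : Prop :=
  forall t s, t \in `[a, b] -> s \in `[0, 1] -> c * `|u s| <= u t.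

Section Cone.
Variables (R : realType) (a b c : R).
Hypotheses (ab : a <= b) (a0 : 0 <= a) (b1 : b <= 1) (c0 : 0 < c) (c1 : c <= 1).

Lemma sub_ab t : t \in `[a, b] -> t \in `[0, 1].
Proof.
rewrite !in_itv /= => /andP[h1 h2].
by rewrite (le_trans a0 h1) (le_trans h2 b1).
Qed.

Lemma a_in : a \in `[a, b].
Proof. by rewrite in_itv /= lexx ab. Qed.

Lemma cone0_ge0 u t : cone0 a b c u -> t \in `[a, b] -> 0 <= u t.
Proof.
move=> K tab; apply: le_trans (K _ _ tab (sub_ab tab)).
by rewrite mulr_ge0 // ltW.
Qed.

Lemma cone0_norm_min u t : cone0 a b c u -> t \in `[0, 1] -> c * `|u t| <= min_on a b u.
Proof. by move=> K t01; apply: min_on_ge => // s sab; exact: K. Qed.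

Definition clamp (hi x : R) := Num.max (- hi) (Num.min hi x).

Lemma clamp_dist hi x y d : `|x - y| <= d -> `|clamp hi x - clamp hi y| <= d.
Proof.
move=> h; rewrite /clamp; apply: dist_max_le; move: h; rewrite !ler_norml => /andP[? ?].
by case: (leP hi x) => ?; case: (leP hi y) => ?; apply/andP; split; lra.
Qed.

Lemma clamp_bound hi x : 0 <= hi -> `|clamp hi x| <= hi.
Proof.
move=> hi0; rewrite /clamp ler_norml le_max lexx /= ge_max ge_min lexx /= andbT; lra.
Qed.

Lemma clamp_id hi x : `|x| <= hi -> clamp hi x = x.
Proof.
rewrite ler_norml => /andP[h1 h2]; rewrite /clamp.
by rewrite (min_idPr h2) (max_idPr h1).
Qed.

Lemma clamp_pos hi x : 0 <= hi -> 0 <= x -> clamp hi x = Num.min hi x.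
Proof.
by move=> h0 x0; rewrite /clamp; apply/max_idPr; rewrite le_min; apply/andP; split; lra.
Qed.

Lemma norm_clamp hi x : 0 <= hi -> `|clamp hi x| = Num.min hi `|x|.
Proof.
move=> h0; have [x0|x0] := leP 0 x.
  by rewrite (ger0_norm x0) clamp_pos // ger0_norm // le_min h0.
rewrite (ltr0_norm x0) /clamp (min_idPr (le_trans (ltW x0) h0)).
by case: (leP (- hi) x) => h; case: (leP hi (- x)) => h';
  rewrite ?normrN ?(ger0_norm h0) ?(ltr0_norm x0) //; lra.
Qed.

(** Schauder's theorem is applied to H u = clamp hi (G u + lam u), where lam u
    is the amount by which G u falls short of lo on [a,b], so that H maps the box to
    itself. Adding a nonnegative constant and truncating both preserve the cone, hence
    a fixed point w lies in it. If lam w > 0, then w has minimum lo, which the inner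
    condition excludes. If the truncation is active, then w has norm hi, and the outer
    condition makes it inactive. *)
Theorem cone_compression (Adm : (R -> R) -> Prop) (G : (R -> R) -> R -> R) (lo hi : R) :
  0 < lo -> lo / c < hi ->
  (forall n (x : nat -> R), Adm (fun t => x (Num.truncn (n%:R * t)))) ->
  (forall u : R -> R, {within `[0, 1], continuous u} -> Adm u) ->
  let Dom u := Adm u /\ box a b lo hi u in
  (forall u, Dom u -> cone0 a b c (G u)) ->
  equicontinuous_on Dom G -> unif_continuous_on Dom G ->
  (forall u, Dom u -> cone0 a b c u -> min_on a b u = lo -> lo < min_on a b (G u)) ->
  (forall u, Dom u -> cone0 a b c u -> norm01 u = hi -> bounded01 hi (G u)) ->
  exists u : R -> R, [/\ {within `[0, 1], continuous u}, Dom u, cone0 a b c u &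
    forall t : R, t \in `[0, 1] -> G u t = u t].
Proof.
move=> lo0 lohi step cont Dom GK Geq Guc inner outer.
have lohi' : lo < hi by apply: le_lt_trans lohi; rewrite ler_pdivlMr // ger_pMr.
have hi0 : 0 < hi by lra.
pose lam u := Num.max 0 (lo - min_on a b (G u)).
have lam0 u : 0 <= lam u by rewrite /lam le_max lexx.
pose H u t := clamp hi (G u t + lam u).
have lam_ge u t : Dom u -> t \in `[a, b] -> lo <= G u t + lam u.
  move=> /GK K tab; have := min_on_le (fun s h => cone0_ge0 K h) tab.
  have : lo - min_on a b (G u) <= lam u by rewrite /lam le_max lexx orbT.
  lra.
have Hbox u : Dom u -> box a b lo hi (H u).
  move=> Du; split=> t ht; first by apply: clamp_bound; lra.
  have := lam_ge u t Du ht => h.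
  by rewrite /H clamp_pos ?le_min; try lra; apply/andP; split; lra.
have Heq : equicontinuous_on Dom H.
  move=> e e0; have [d d0 hd] := Geq _ e0; exists d => // u Du t s t01 s01 ts.
  by apply: clamp_dist; rewrite (_ : _ - _ = G u t - G u s); [exact: hd|ring].
have Huc : unif_continuous_on Dom H.
  move=> e e0; have e20 : 0 < e / 2 by lra.
  have [d d0 hd] := Guc _ e20; exists d => // u v Du Dv uv t t01.
  apply: clamp_dist.
  have : `|lam u - lam v| <= e / 2.
    apply: dist_max_le.
    rewrite (_ : _ - _ = min_on a b (G v) - min_on a b (G u)); last by ring.
    apply: (@min_on_dist _ a b 0) => // s sab.
    - exact: (cone0_ge0 (GK _ Dv) sab).
    - exact: (cone0_ge0 (GK _ Du) sab).
    - by rewrite distrC; apply: hd => //; exact: sub_ab.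
  have := hd _ _ Du Dv uv _ t01.
  by rewrite !ler_norml => /andP[? ?] /andP[? ?]; apply/andP; split; lra.
have hilo : - hi <= lo by lra.
have [w [wc wbox wfix]] := schauder_box hi0 (ltW lohi') hilo sub_ab step cont Hbox Heq Huc.
have Dw : Dom w by split=> //; exact: cont.
pose v := G w; pose x t := v t + lam w.
have Kv : cone0 a b c v by exact: GK.
have Kx : cone0 a b c x.
  move=> t s tab s01; have := Kv _ _ tab s01; rewrite /x.
  have l0 := lam0 w; have := ler_normD (v s) (lam w); rewrite (ger0_norm l0).
  move: `|_ + _| `|v s| l0 => p q l0 hp hq.
  have : c * p <= c * (q + lam w) by rewrite ler_pM2l.
  have : c * lam w <= lam w by exact: ler_piMl.
  lra.
have wE t : t \in `[0, 1] -> w t = clamp hi (x t) by move=> /wfix <-.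
have Kw : cone0 a b c w.
  move=> t s tab s01; rewrite (wE _ s01) (wE _ (sub_ab tab)) (norm_clamp _ (ltW hi0)).
  rewrite (clamp_pos (ltW hi0) (cone0_ge0 Kx tab)).
  have := Kx _ _ tab s01; move: `|x s| (x t) => p q cp.
  rewrite le_min; apply/andP; split.
    by apply: (@le_trans _ _ (c * hi)); rewrite ?ler_pM2l ?ge_min ?lexx // ger_pMl.
  by apply: le_trans cp; rewrite ler_pM2l // ge_min lexx orbT.
have min_x : min_on a b x = min_on a b v + lam w.
  apply/eqP; rewrite eq_le; apply/andP; split.
    rewrite -lerBlDr; apply: min_on_ge => // t tab; rewrite lerBlDr.
    exact: (min_on_le (fun s => @cone0_ge0 _ s Kx) tab).
  apply: min_on_ge => // t tab; rewrite lerD2r.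
  exact: (min_on_le (fun s => @cone0_ge0 _ s Kv) tab).
have min_v : lo <= min_on a b v.
  rewrite leNgt; apply/negP => lt.
  have lamE : lam w = lo - min_on a b v by rewrite /lam; apply/max_idPr; rewrite -/v; lra.
  have minx_lo : min_on a b x = lo by rewrite min_x lamE; ring.
  have xw t : t \in `[0, 1] -> w t = x t.
    move=> t01; rewrite wE // clamp_id //.
    apply: ltW; apply: le_lt_trans lohi; rewrite ler_pdivlMr // mulrC -minx_lo.
    exact: cone0_norm_min.
  have : min_on a b w = lo.
    rewrite -minx_lo /min_on; congr inf; apply: eq_imagel => t tab; apply: xw.
    exact: sub_ab.
  by move/(inner _ Dw Kw); rewrite -/v; lra.
have lamE : lam w = 0 by rewrite /lam; apply/max_idPl; rewrite -/v; lra.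
have xv t : x t = v t by rewrite /x lamE addr0.
exists w; split=> // t t01; rewrite wE // xv clamp_id //.
have [//|lt] := leP `|v t| hi.
have wb : bounded01 hi w by case: wbox.
suff h : norm01 w = hi by have := outer _ Dw Kw h _ t01; rewrite leNgt lt.
apply/eqP; rewrite eq_le norm01_le //=.
apply: le_trans (norm01_ge wb t01).
by rewrite (wE _ t01) xv (norm_clamp _ (ltW hi0)) le_min lexx ltW.
Qed.

End Cone.

(** * Compression and expansion for an operator with values in a cone *)

Section Operator.
Variables (R : realType) (a b c : R).
Hypotheses (ab : a <= b) (a0 : 0 <= a) (b1 : b <= 1) (c0 : 0 < c) (c1 : c <= 1).
Variables (Adm : (R -> R) -> Prop) (S : (R -> R) -> R -> R).

Let Ball (M : R) (u : R -> R) : Prop := Adm u /\ bounded01 M u.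

Hypothesis adm_step : forall n (x : nat -> R), Adm (fun t => x (Num.truncn (n%:R * t))).
Hypothesis adm_cont : forall u : R -> R, {within `[0, 1], continuous u} -> Adm u.
Hypothesis adm_scale : forall u (r : R), Adm u -> Adm (fun t => r * u t).
Hypothesis S_cone : forall M u, Ball M u -> cone0 a b c (S u).
Hypothesis S_bounded : forall M, exists N, forall u, Ball M u -> bounded01 N (S u).
Hypothesis S_equi : forall M, equicontinuous_on (Ball M) S.
Hypothesis S_unif : forall M, unif_continuous_on (Ball M) S.

(** Here and in [contracts_at] the margin r' makes the fixed points obtained at
    radius r satisfy strict inequalities. *)
Definition expands_at (r : R) : Prop := exists2 r' : R, r < r' &
  forall M u, Ball M u -> (forall t, t \in `[a, b] -> r <= u t <= r / c) ->
    forall t, t \in `[a, b] -> r' <= S u t.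

Definition contracts_at (r : R) : Prop := exists2 r' : R, r' < r &
  forall u, Ball r u -> bounded01 r' (S u).

Lemma equicontinuous_onW (D D' : (R -> R) -> Prop) (H : (R -> R) -> R -> R) :
  (forall u, D u -> D' u) -> equicontinuous_on D' H -> equicontinuous_on D H.
Proof.
move=> DD' h e /h[d d0 hd]; exists d => // u /DD'; exact: hd.
Qed.

Lemma unif_continuous_onW (D D' : (R -> R) -> Prop) (H : (R -> R) -> R -> R) :
  (forall u, D u -> D' u) -> unif_continuous_on D' H -> unif_continuous_on D H.
Proof.
move=> DD' h e /h[d d0 hd]; exists d => // u v /DD' ? /DD'; exact: hd.
Qed.

Lemma cone0_range (u : R -> R) (r t : R) : cone0 a b c u -> min_on a b u = r ->
  t \in `[a, b] -> r <= u t <= r / c.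
Proof.
move=> K ur tab; rewrite -{1}ur (min_on_le (fun s => cone0_ge0 a0 b1 c0 K) tab) /=.
rewrite ler_pdivlMr // mulrC -ur; apply: le_trans (cone0_norm_min ab K (sub_ab a0 b1 tab)).
by rewrite ler_pM2l // ler_norm.
Qed.

Lemma expands_min (M r : R) (u : R -> R) : expands_at r -> Ball M u ->
  cone0 a b c u -> min_on a b u = r -> r < min_on a b (S u).
Proof.
move=> [r' rr' h] uB K ur; apply: (lt_le_trans rr'); apply: min_on_ge => //.
by apply: h uB _ => t; exact: cone0_range.
Qed.

Theorem compression_fixed_point (r1 r2 : R) :
  0 < r1 -> r1 / c < r2 -> expands_at r1 -> contracts_at r2 ->
  exists u : R -> R, [/\ {within `[0, 1], continuous u}, cone0 a b c u,
    (forall t : R, t \in `[0, 1] -> S u t = u t),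
    (forall t : R, t \in `[a, b] -> r1 < u t) & forall t : R, t \in `[0, 1] -> `|u t| < r2].
Proof.
move=> r10 r12 e1 [r2' r22' h2].
have DB u : Adm u /\ box a b r1 r2 u -> Ball r2 u by case=> uA [].
have [|||||u [uc Du K ufix]] := @cone_compression _ _ _ _ ab a0 b1 c0 c1 Adm S r1 r2 r10 r12
  adm_step adm_cont.
- by move=> u /DB; exact: S_cone.
- exact: equicontinuous_onW DB (S_equi r2).
- exact: unif_continuous_onW DB (S_unif r2).
- by move=> u /DB; exact: expands_min.
- by move=> u /DB uB _ _ t t01; rewrite ltW // (le_lt_trans (h2 _ uB _ t01)).
exists u; have uB := DB _ Du; split=> //.
- move=> t tab; apply: lt_le_trans (min_on_le (fun s => cone0_ge0 a0 b1 c0 K) tab).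
  have le1 : r1 <= min_on a b u by apply: min_on_ge => //; case: Du => _ [].
  rewrite lt_neqAle le1 andbT; apply/negP => /eqP/esym ur.
  have := expands_min e1 uB K ur.
  have -> : min_on a b (S u) = min_on a b u.
    by congr inf; apply: eq_imagel => s sab; apply: ufix; exact: sub_ab sab.
  by rewrite ur ltxx.
- by move=> t t01; rewrite -ufix // (le_lt_trans (h2 _ uB _ t01)).
Qed.

Let frac (w : R -> R) : R := Num.min 1 (2 - norm01 w).
(** For w in the cone, [ray r1 r2 w] scales w to norm r1 if w has norm 2, and to
    minimum r2 if w has norm at most 1; between these it interpolates. *)
Let ray (r1 r2 : R) (w : R -> R) : R :=
  (1 - frac w) * (r1 / norm01 w) + frac w * (r2 / min_on a b w).

Lemma min_on_scale (M r : R) (u : R -> R) : 0 < r ->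
  (forall t, t \in `[a, b] -> M <= u t) -> min_on a b (fun t => r * u t) = r * min_on a b u.
Proof.
move=> r0 uM; apply/eqP; rewrite eq_le; apply/andP; split.
  rewrite mulrC -ler_pdivrMr //; apply: min_on_ge => // t tab.
  rewrite ler_pdivrMr // mulrC; apply: (@min_on_le _ _ _ (r * M)) tab => s sab.
  by rewrite ler_pM2l // uM.
apply: min_on_ge => // t tab; rewrite ler_pM2l //; exact: min_on_le uM tab.
Qed.

Lemma dist_min_le (x y d e : R) : `|x - y| <= d -> `|Num.min e (2 - x) - Num.min e (2 - y)| <= d.
Proof.
rewrite !ler_norml => /andP[? ?].
by case: (leP e (2 - x)) => ?; case: (leP e (2 - y)) => ?; apply/andP; split; lra.
Qed.

Lemma dist_inv_le (x y d l r : R) : 0 < l -> 0 <= r -> l <= x -> l <= y -> `|x - y| <= d ->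
  `|r / x - r / y| <= r / l ^+ 2 * d.
Proof.
move=> l0 r0 lx ly xy; have x0 : 0 < x by lra.
have y0 : 0 < y by lra.
have -> : r / x - r / y = r / (x * y) * (y - x) by field; rewrite !gt_eqF.
have xy0 : 0 <= r / (x * y) by rewrite divr_ge0 // ltW // mulr_gt0.
rewrite normrM distrC (ger0_norm xy0).
apply: ler_pM => //.
apply: ler_wpM2l => //; rewrite lef_pV2 ?posrE ?mulr_gt0 ?exprn_gt0 //.
by rewrite expr2 ler_pM // ltW.
Qed.

(** The substitution u = mu w * w, with mu w := ray r1 r2 w, exchanges the two
    boundaries: cone functions w of minimum c correspond to u of minimum r2, and w of
    norm 2 to u of norm r1. Hence G w = S (mu w * w) / mu w is compressive between c
    and 2, and a fixed point w of G gives the fixed point mu w * w of S. Since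
    mu w lies between r1 / norm01 w and r2 / min_on a b w, its norm is at least r1 and
    its minimum at most r2; the margins in the hypotheses exclude equality. *)
Theorem expansion_fixed_point (r1 r2 : R) :
  0 < r1 -> r1 < r2 -> contracts_at r1 -> expands_at r2 ->
  exists u : R -> R, [/\ {within `[0, 1], continuous u}, cone0 a b c u,
    (forall t : R, t \in `[0, 1] -> S u t = u t),
    (exists2 t : R, t \in `[0, 1] & r1 < `|u t|) & exists2 t : R, t \in `[a, b] & u t < r2].
Proof.
move=> r10 r12 [r1' r11' h1] e2.
have r20 : 0 < r2 by lra.
pose Dom w := Adm w /\ box a b c 2 w.
pose mu := ray r1 r2.
have Nm w : Dom w -> [/\ c <= min_on a b w, min_on a b w <= norm01 w & norm01 w <= 2].
  move=> [_ [w2 wc]]; split.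
  - exact: min_on_ge.
  - apply: (le_trans (min_on_le wc (a_in ab))); apply: le_trans (ler_norm _) _.
    exact: norm01_ge w2 (sub_ab a0 b1 (a_in ab)).
  - exact: norm01_le.
have frac01 w : Dom w -> 0 <= frac w <= 1.
  by move=> /Nm[_ _ N2]; rewrite /frac le_min ge_min lexx /= andbT; lra.
have parts w : Dom w -> [/\ r1 / 2 <= r1 / norm01 w, r1 / norm01 w <= r2 / min_on a b w &
    r2 / min_on a b w <= r2 / c].
  move=> /Nm[cm mN N2]; have m0 : 0 < min_on a b w := lt_le_trans c0 cm.
  have N0 : 0 < norm01 w := lt_le_trans m0 mN.
  split; rewrite ?ler_pM2l ?lef_pV2 ?posrE //.
  by apply: ler_pM; rewrite ?invr_ge0 ?lef_pV2 ?posrE // ltW.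
have mu_bounds w : Dom w -> r1 / 2 <= mu w <= r2 / c.
  move=> Dw; have /andP[f0 f1] := frac01 _ Dw; have [p1 p2 p3] := parts _ Dw.
  rewrite /mu /ray; move: (frac w) (r1 / norm01 w) (r2 / min_on a b w) f0 f1 p1 p2 p3 => f p q.
  by move=> *; apply/andP; split; nra.
have mu0 w : Dom w -> 0 < mu w by move=> /mu_bounds/andP[h _]; lra.
pose L := r1 / c ^+ 2 + r2 / c + (r1 / c ^+ 2 + r2 / c ^+ 2).
have rc0 (r : R) : 0 < r -> 0 < r / c ^+ 2 by move=> ?; rewrite divr_gt0 // exprn_gt0.
have L0 : 0 < L.
  by rewrite /L; have := rc0 _ r10; have := rc0 _ r20; have := divr_gt0 r20 c0; lra.
(* [mu] is Lipschitz on the box, so that [G] below inherits the uniform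
   continuity of [S]. *)
have mu_lip w w' d : Dom w -> Dom w' -> (forall t, t \in `[0, 1] -> `|w t - w' t| <= d) ->
    `|mu w - mu w'| <= L * d.
  move=> Dw Dw' ww'.
  have [[cm mN N2] [cm' mN' N2']] := (Nm _ Dw, Nm _ Dw').
  have dN : `|norm01 w - norm01 w'| <= d.
    by apply: (@norm01_dist _ 2) => //; [case: Dw => _ []|case: Dw' => _ []].
  have dm : `|min_on a b w - min_on a b w'| <= d.
    apply: (@min_on_dist _ _ _ c) => //; [by case: Dw => _ []|by case: Dw' => _ []|].
    by move=> t tab; apply: ww'; exact: sub_ab tab.
  have cN : c <= norm01 w by lra.
  have cN' : c <= norm01 w' by lra.
  have d1 := dist_inv_le c0 (ltW r10) cN cN' dN.
  have d2 := dist_inv_le c0 (ltW r20) cm cm' dm.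
  have df := dist_min_le 1 dN; rewrite -/(frac w) -/(frac w') in df.
  have /andP[f0 f1] := frac01 _ Dw; have [p1 p2 p3] := parts _ Dw.
  have /andP[f0' f1'] := frac01 _ Dw'; have [p1' p2' p3'] := parts _ Dw'.
  have d0 : 0 <= d := le_trans (normr_ge0 _) dN.
  rewrite /mu /ray /L.
  move: (frac w) (frac w') (r1 / norm01 w) (r1 / norm01 w') (r2 / min_on a b w) (r2 / min_on a b w')
    (r1 / c ^+ 2) (r2 / c ^+ 2) (r2 / c) f0 f1 p1 p2 p3 f0' f1' p1' p2' p3' df d1 d2
    => f f' p p' q q' A B C f0 f1 p1 p2 p3 f0' f1' p1' p2' p3' df d1 d2.
  have -> : (1 - f) * p + f * q - ((1 - f') * p' + f' * q') =
    (p - p') + (f - f') * (q - p) + f' * ((q - q') - (p - p')) by ring.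
  have t1 : `|(f - f') * (q - p)| <= C * d.
    rewrite normrM [leRHS]mulrC; apply: ler_pM => //.
    by rewrite ger0_norm; lra.
  have t2 : `|f' * ((q - q') - (p - p'))| <= A * d + B * d.
    rewrite normrM (ger0_norm f0'); apply: (le_trans (ler_wpM2r (normr_ge0 _) f1')).
    by rewrite mul1r; apply: (le_trans (ler_normB _ _)); lra.
  apply: (le_trans (ler_normD _ _)); apply: (le_trans (lerD (ler_normD _ _) (lexx _))).
  lra.
pose M := 2 * (r2 / c).
have rays w : Dom w -> Ball M (fun t => mu w * w t).
  move=> Dw; split; first by apply: adm_scale; case: Dw.
  have /andP[_ m2] := mu_bounds _ Dw; have [_ [w2 _]] := Dw.
  move=> t t01; rewrite normrM (gtr0_norm (mu0 _ Dw)) /M mulrC.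
  by apply: ler_pM => //; [exact: ltW (mu0 _ Dw)|exact: w2].
pose G w t := S (fun s => mu w * w s) t / mu w.
have [N hN] := S_bounded M.
have GK w : Dom w -> cone0 a b c (G w).
  move=> Dw t s tab s01; have := S_cone (rays _ Dw) tab s01.
  rewrite /G normrM [X in _ * (_ * X)]gtr0_norm ?invr_gt0 ?mu0 // mulrA.
  by rewrite ler_pM2r // invr_gt0 mu0.
have Geq : equicontinuous_on Dom G.
  move=> e e0; have er0 : 0 < e * (r1 / 2) by rewrite mulr_gt0 //; lra.
  have [d d0 hd] := S_equi M er0; exists d => // w Dw t s t01 s01 ts.
  have /andP[m1 _] := mu_bounds _ Dw; have m0 := mu0 _ Dw.
  rewrite /G -mulrBl normrM [X in _ * X]gtr0_norm ?invr_gt0 // ler_pdivrMr //.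
  apply: (le_trans (hd _ (rays _ Dw) _ _ t01 s01 ts)).
  by rewrite ler_pM2l.
have Guc : unif_continuous_on Dom G.
  move=> e e0; have er0 : 0 < e / 2 * (r1 / 2) by rewrite mulr_gt0 //; lra.
  have [d d0 hd] := S_unif M er0.
  pose Q := r2 / c + 2 * L; pose P := `|N| * L / (r1 / 2) ^+ 2.
  have Q0 : 0 < Q by rewrite /Q; have := divr_gt0 r20 c0; lra.
  have r120 : 0 < r1 / 2 by lra.
  have P0 : 0 <= P by rewrite !mulr_ge0 // ?invr_ge0 ?exprn_ge0 // ltW.
  exists (Num.min (d / Q) (e / (2 * (P + 1)))).
    by rewrite lt_min !divr_gt0 // mulr_gt0 // ltr_wpDl.
  set d' := Num.min _ _.
  have [d'1 d'2] : Q * d' <= d /\ P * d' <= e / 2.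
    split; first by rewrite mulrC -ler_pdivlMr // ge_min lexx.
    have P1 : 0 < P + 1 by lra.
    apply: (@le_trans _ _ ((P + 1) * (e / (2 * (P + 1))))).
      apply: (@le_trans _ _ (P * (e / (2 * (P + 1))))).
        by rewrite ler_wpM2l // ge_min lexx orbT.
      by rewrite ler_wpM2r //; [rewrite divr_ge0 ?mulr_ge0 // ltW|lra].
    by rewrite le_eqVlt; apply/orP; left; apply/eqP; field; rewrite gt_eqF.
  move=> w w' Dw Dw' ww' t t01.
  have m0 := mu0 _ Dw; have m0' := mu0 _ Dw'.
  have /andP[m1 m2] := mu_bounds _ Dw; have /andP[m1' m2'] := mu_bounds _ Dw'.
  have dmu := mu_lip _ _ _ Dw Dw' ww'.
  have close s : s \in `[0, 1] -> `|mu w * w s - mu w' * w' s| <= d.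
    move=> s01; apply: le_trans d'1.
    have -> : mu w * w s - mu w' * w' s = mu w * (w s - w' s) + w' s * (mu w - mu w') by ring.
    apply: (le_trans (ler_normD _ _)); rewrite !normrM (gtr0_norm m0) /Q [leRHS]mulrDl.
    apply: lerD; first by apply: ler_pM => //; [exact: ltW|exact: ww'].
    rewrite -mulrA; apply: ler_pM => //.
    by have [_ [w2 _]] := Dw'; exact: w2.
  have s1 := hd _ _ (rays _ Dw) (rays _ Dw') close _ t01.
  have s2 := hN _ (rays _ Dw') _ t01.
  have s3 := dist_inv_le r120 ler01 m1 m1' dmu.
  rewrite /G; move: s1 s2 s3; set X := S _ t; set Y := S _ t => s1 s2 s3.
  have -> : X / mu w - Y / mu w' = (X - Y) / mu w + Y * (1 / mu w - 1 / mu w').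
    by field; rewrite !gt_eqF.
  have u1 : `|(X - Y) / mu w| <= e / 2.
    rewrite normrM [X in _ * X]gtr0_norm ?invr_gt0 // ler_pdivrMr //.
    by apply: (le_trans s1); rewrite ler_pM2l //; lra.
  have u2 : `|Y * (1 / mu w - 1 / mu w')| <= e / 2.
    apply: le_trans d'2; rewrite normrM.
    have -> : P * d' = `|N| * (1 / (r1 / 2) ^+ 2 * (L * d')) by rewrite /P; field; rewrite !gt_eqF //; lra.
    by apply: ler_pM => //; apply: (le_trans s2); exact: ler_norm.
  by apply: (le_trans (ler_normD _ _)); lra.
have ray_min w : Dom w -> min_on a b (fun t => mu w * w t) = mu w * min_on a b w.
  by move=> Dw; apply: (@min_on_scale c) => //; [exact: mu0|case: Dw => _ []].
have ray_cone w : Dom w -> cone0 a b c w -> cone0 a b c (fun t => mu w * w t).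
  move=> Dw K t s tab s01; rewrite normrM (gtr0_norm (mu0 _ Dw)) mulrCA.
  by rewrite ler_pM2l ?mu0 //; exact: K.
have cc : c / c < 2 by rewrite divff ?gt_eqF // ltr1n.
have [||w [wc Dw Kw wfix]] := @cone_compression _ _ _ _ ab a0 b1 c0 c1 Adm G c 2 c0 cc
  adm_step adm_cont GK Geq Guc.
(* At [w] of minimum c the norm is at most 1, hence [mu w * w] has minimum r2. *)
- move=> w Dw Kw mw.
  have muE : mu w = r2 / c.
    have [_ _ N2] := Nm _ Dw.
    have N1 : norm01 w <= 1.
      apply: norm01_le => t t01; rewrite -(ler_pM2l c0) mulr1 -[leRHS]mw; exact: cone0_norm_min.
    have fE : frac w = 1 by rewrite /frac; apply/min_idPl; lra.
    by rewrite /mu /ray fE mw subrr mul0r add0r mul1r.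
  have G_S t : S (fun s => mu w * w s) t = mu w * G w t.
    by rewrite /G mulrC divfK // gt_eqF // mu0.
  have mr : mu w * min_on a b w = r2 by rewrite mw muE divfK // gt_eqF.
  have := expands_min e2 (rays _ Dw) (ray_cone _ Dw Kw) (etrans (ray_min _ Dw) mr).
  have -> : min_on a b (S (fun s => mu w * w s)) = min_on a b (fun t => mu w * G w t).
    by congr inf; apply: eq_imagel => t tab; rewrite G_S.
  rewrite (@min_on_scale 0 _ _ (mu0 _ Dw) (fun s => cone0_ge0 a0 b1 c0 (GK _ Dw))).
  by rewrite -{1}mr ltr_pM2l ?mu0 // mw.
(* At [w] of norm 2 the function [mu w * w] has norm r1. *)
- move=> w Dw Kw Nw t t01.
  have fE : frac w = 0 by rewrite /frac Nw subrr; apply/min_idPr; lra.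
  have muE : mu w = r1 / 2 by rewrite /mu /ray fE Nw; lra.
  have wB : Ball r1 (fun s => mu w * w s).
    have [wA _] := rays _ Dw; split=> // s s01.
    have [_ [w2 _]] := Dw; rewrite muE normrM gtr0_norm; last lra.
    by have := w2 _ s01; move: `|w s| => q q2; nra.
  have := h1 _ wB t t01; rewrite /G normrM [X in _ -> _ * X <= _]gtr0_norm ?invr_gt0 ?mu0 //.
  by rewrite ler_pdivrMr ?mu0 // muE; lra.
- have mw0 := mu0 _ Dw.
  exists (fun t => mu w * w t); have Ku := ray_cone _ Dw Kw.
  have uc : {within `[0, 1], continuous (fun t => mu w * w t)}.
    apply/within_continuous01P => tau tau01 e e0.
    have /within_continuous01P/(_ _ tau01 _ (divr_gt0 e0 mw0))[d d0 hd] := wc.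
    exists d => // t t01 td; rewrite -mulrBr normrM gtr0_norm // mulrC.
    by rewrite -ler_pdivlMr //; exact: hd.
  have ufix t : t \in `[0, 1] -> S (fun s => mu w * w s) t = mu w * w t.
    by move=> t01; rewrite -(wfix _ t01) /G mulrC divfK // gt_eqF.
  have uB := rays _ Dw.
  have [[cm mN N2] [p1 p2 p3]] := (Nm _ Dw, parts _ Dw).
  have /andP[f0 f1] := frac01 _ Dw.
  have m0 : 0 < min_on a b w := lt_le_trans c0 cm.
  have N0 : 0 < norm01 w := lt_le_trans m0 mN.
  split=> //.
  + apply: contrapT => no.
    have u1 : bounded01 r1 (fun t => mu w * w t).
      by move=> t t01; rewrite leNgt; apply/negP => lt; apply: no; exists t.
    have [uA _] := uB.
    have : mu w * norm01 w <= r1'.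
      rewrite mulrC -ler_pdivlMr //; apply: norm01_le => t t01.
      rewrite ler_pdivlMr // mulrC -[X in X * _](gtr0_norm mw0) -normrM -ufix //.
      exact: h1.
    suff : r1 <= mu w * norm01 w by lra.
    rewrite -ler_pdivrMr // /mu /ray.
    by move: (frac w) (r1 / norm01 w) (r2 / min_on a b w) f0 f1 p1 p2 p3 => f p q *; nra.
  + apply: contrapT => no.
    have u1 t : t \in `[a, b] -> r2 <= mu w * w t.
      by move=> tab; rewrite leNgt; apply/negP => lt; apply: no; exists t.
    have mr : min_on a b (fun t => mu w * w t) = r2.
      apply/eqP; rewrite eq_le (min_on_ge ab u1) andbT ray_min // -ler_pdivlMr // /mu /ray.
      by move: (frac w) (r1 / norm01 w) (r2 / min_on a b w) f0 f1 p1 p2 p3 => f p q *; nra.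
    have := expands_min e2 uB Ku mr.
    have -> : min_on a b (S (fun s => mu w * w s)) = min_on a b (fun t => mu w * w t).
      by congr inf; apply: eq_imagel => t tab; rewrite ufix //; exact: sub_ab tab.
    by rewrite mr ltxx.
Qed.

End Operator.

(** * Riemann-Stieltjes integrals *)

Definition dominates_increments (R : realType) (V A : R -> R) : Prop :=
  forall x y : R, 0 <= x -> x <= y -> y <= 1 -> `|A y - A x| <= V y - V x.

(** V is the variation function of A. *)
Lemma bounded_variation_dominated (R : realType) (A : R -> R) :
  bounded_variation 0 1 A -> exists V, dominates_increments V A.
Proof.
move=> bvA; exists (fun x => fine (total_variation 0 x A)) => x y x0 xy y1.
have fin z : 0 <= z -> z <= 1 -> total_variation 0 z A \is a fin_num.
  by move=> z0 z1; apply/bounded_variationP => //; exact: bounded_variationl bvA.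
have y0 : 0 <= y by exact: le_trans xy.
have x1 : x <= 1 by exact: le_trans y1.
have finxy : total_variation x y A \is a fin_num.
  apply/bounded_variationP => //; apply: (@bounded_variationr _ 0) => //.
  exact: bounded_variationl bvA.
rewrite -lee_fin EFinB !fineK ?fin // (@total_variationD _ 0 y x) // addeAC.
by rewrite subee ?fin // add0e; exact: total_variation_ge.
Qed.

Section Sums.
Variable R : realType.
Implicit Types (A V u : R -> R) (s t xi eta : nat -> R).

Definition rs_partition (d : R) (n : nat) s xi : Prop :=
  [/\ s 0 = 0, s n = 1, (forall i, (i < n)%N -> s i <= s i.+1),
      (forall i, (i < n)%N -> s i.+1 - s i < d) &
      forall i, (i < n)%N -> s i <= xi i <= s i.+1].

Definition rsum A u n s xi : R := \sum_(0 <= i < n) u (xi i) * (A (s i.+1) - A (s i)).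

Lemma rs_partition_mono d n s xi i j : rs_partition d n s xi ->
  (i <= j)%N -> (j <= n)%N -> s i <= s j.
Proof.
move=> [_ _ h _ _] + jn; elim: j jn => [|j IH] jn; first by rewrite leqn0 => /eqP ->.
rewrite leq_eqVlt => /orP[/eqP -> //|ij]; apply: le_trans (h _ jn).
by apply: IH => //; exact: ltnW.
Qed.

Lemma rs_partition_ge0 d n s xi i : rs_partition d n s xi -> (i <= n)%N -> 0 <= s i.
Proof. by move=> P ni; have [<- _ _ _ _] := P; exact: rs_partition_mono P _ ni. Qed.

Lemma rs_partition_le1 d n s xi i : rs_partition d n s xi -> (i <= n)%N -> s i <= 1.
Proof. by move=> P ni; have [_ <- _ _ _] := P; exact: rs_partition_mono P ni _. Qed.

Lemma rs_partition_tag d n s xi i : rs_partition d n s xi -> (i < n)%N -> xi i \in `[0, 1].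
Proof.
move=> P ni; have [_ _ _ _ /(_ _ ni)/andP[h1 h2]] := P; rewrite in_itv /=.
rewrite (le_trans (rs_partition_ge0 P (ltnW ni)) h1) /=.
exact: le_trans h2 (rs_partition_le1 P ni).
Qed.

Lemma rsum_bound A V u M d n s xi : dominates_increments V A -> rs_partition d n s xi ->
  (forall i, (i < n)%N -> `|u (xi i)| <= M) -> `|rsum A u n s xi| <= M * (V 1 - V 0).
Proof.
move=> VA P uM; apply: (le_trans (ler_norm_sum _ _ _)).
have [s0 s1 mono _ _] := P.
apply: (@le_trans _ _ (\sum_(0 <= i < n) M * (V (s i.+1) - V (s i)))).
  apply: ler_sum_nat => i /andP[_ ni]; rewrite normrM; apply: ler_pM => //.
    exact: uM.
  apply: VA; [exact: rs_partition_ge0 P (ltnW ni)|exact: mono|exact: rs_partition_le1 P ni].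
by rewrite -mulr_sumr telescope_sumr // s0 s1.
Qed.

(** The increment of h over the intersection of [x, x'] and [y, y'] (see [mixedE]),
    in a form that telescopes in both pairs of variables. *)
Definition mixed (h : R -> R) (x x' y y' : R) : R :=
  h (Num.min x' y') - h (Num.min x' y) - (h (Num.min x y') - h (Num.min x y)).

Lemma mixedE h x x' y y' : x <= x' -> y <= y' ->
  mixed h x x' y y' = if Num.max x y <= Num.min x' y' then h (Num.min x' y') - h (Num.max x y) else 0.
Proof.
move=> xx' yy'; rewrite /mixed.
case: (leP x y) => xy; case: (leP x' y') => x'y'; case: (leP x' y) => x'y; case: (leP x y') => xy';
  try case: ifPn; rewrite -?ltNge => *; try lra.
all: try (have -> : x' = y by lra); try (have -> : x = y' by lra); try lra.
Qed.

Lemma mixed_sumr h x x' (t : nat -> R) m : t 0 = 0 -> t m = 1 ->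
  0 <= x <= 1 -> 0 <= x' <= 1 ->
  \sum_(0 <= j < m) mixed h x x' (t j) (t j.+1) = h x' - h x.
Proof.
move=> t0 t1 /andP[x0 x1] /andP[x'0 x'1].
pose k y := h (Num.min x' y) - h (Num.min x y).
rewrite (eq_big_nat _ _ (F2 := fun j => k (t j.+1) - k (t j))); last first.
  by move=> j _; rewrite /mixed /k; ring.
rewrite telescope_sumr // t0 t1 /k.
by rewrite (min_idPl x1) (min_idPl x'1) (min_idPr x0) (min_idPr x'0) subrr subr0.
Qed.

Lemma mixed_suml h y y' (s : nat -> R) n : s 0 = 0 -> s n = 1 ->
  0 <= y <= 1 -> 0 <= y' <= 1 ->
  \sum_(0 <= i < n) mixed h (s i) (s i.+1) y y' = h y' - h y.
Proof.
move=> s0 s1 yb y'b; rewrite -(mixed_sumr h s0 s1 yb y'b).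
by apply: eq_bigr => i _; rewrite /mixed !(minC y) !(minC y'); ring.
Qed.

(** Both sums are written over the cells of the common refinement. Only pairs of
    overlapping intervals contribute, and their tags are at distance at most 2 d. *)
Lemma rsum_close A V u e d n s xi m t eta : dominates_increments V A ->
  (forall x y, x \in `[0, 1] -> y \in `[0, 1] -> `|x - y| <= 2 * d -> `|u x - u y| <= e) ->
  rs_partition d n s xi -> rs_partition d m t eta ->
  `|rsum A u n s xi - rsum A u m t eta| <= e * (V 1 - V 0).
Proof.
move=> VA ue P Q.
have [s0 s1 smono sd stag] := P; have [t0 t1 tmono td ttag] := Q.
have s01 i : (i <= n)%N -> 0 <= s i <= 1.
  by move=> ni; rewrite (rs_partition_ge0 P ni) (rs_partition_le1 P ni).
have t01 j : (j <= m)%N -> 0 <= t j <= 1.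
  by move=> mj; rewrite (rs_partition_ge0 Q mj) (rs_partition_le1 Q mj).
pose W (h : R -> R) i j := mixed h (s i) (s i.+1) (t j) (t j.+1).
have -> : rsum A u n s xi = \sum_(0 <= i < n) \sum_(0 <= j < m) u (xi i) * W A i j.
  apply: eq_big_nat => i /andP[_ ni]; rewrite -mulr_sumr mixed_sumr ?s01 //.
  exact: ltnW.
have -> : rsum A u m t eta = \sum_(0 <= i < n) \sum_(0 <= j < m) u (eta j) * W A i j.
  rewrite exchange_big; apply: eq_big_nat => j /andP[_ mj].
  by rewrite -mulr_sumr mixed_suml ?t01 //; exact: ltnW.
rewrite -sumrB; apply: (le_trans (ler_norm_sum _ _ _)).
have -> : e * (V 1 - V 0) = \sum_(0 <= i < n) \sum_(0 <= j < m) e * W V i j.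
  rewrite [RHS](eq_big_nat _ _ (F2 := fun i => e * (V (s i.+1) - V (s i)))).
    by rewrite -mulr_sumr telescope_sumr // s0 s1.
  by move=> i /andP[_ ni]; rewrite -mulr_sumr mixed_sumr ?s01 //; exact: ltnW.
apply: ler_sum_nat => i /andP[_ ni]; rewrite -sumrB.
apply: (le_trans (ler_norm_sum _ _ _)); apply: ler_sum_nat => j /andP[_ mj].
rewrite -mulrBl normrM /W !mixedE ?smono ?tmono //.
case: ifPn => [le|_]; last by rewrite normr0 !mulr0.
have /andP[i1 i2] := stag _ ni; have /andP[j1 j2] := ttag _ mj.
have di := sd _ ni; have dj := td _ mj.
have mx1 : s i <= Num.max (s i) (t j) by rewrite le_max lexx.
have mx2 : t j <= Num.max (s i) (t j) by rewrite le_max lexx orbT.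
have mn1 : Num.min (s i.+1) (t j.+1) <= s i.+1 by rewrite ge_min lexx.
have mn2 : Num.min (s i.+1) (t j.+1) <= t j.+1 by rewrite ge_min lexx orbT.
apply: ler_pM => //.
  apply: ue; [exact: rs_partition_tag P ni|exact: rs_partition_tag Q mj|].
  move: (Num.max _ _) (Num.min _ _) le mx1 mx2 mn1 mn2 => p q *.
  by rewrite ler_norml; apply/andP; split; lra.
apply: VA => //; first by apply: le_trans mx1; case/andP: (s01 i (ltnW ni)).
by apply: (le_trans mn1); case/andP: (s01 _ ni).
Qed.

Definition unif_node (n i : nat) : R := i%:R / n.+1%:R.

Lemma unif_partition (n : nat) (d : R) : n.+1%:R^-1 < d ->
  rs_partition d n.+1 (unif_node n) (unif_node n).
Proof.
move=> nd; have n0 : 0 < n.+1%:R :> R by rewrite ltr0n.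
have step i : unif_node n i.+1 - unif_node n i = n.+1%:R^-1.
  by rewrite /unif_node -mulrBl -natrB // subSnn mul1r.
have stepP i : unif_node n i <= unif_node n i.+1.
  by rewrite -subr_ge0 step invr_ge0 ltW.
split=> [||i _|i _|i _].
- by rewrite /unif_node mul0r.
- by rewrite /unif_node divff // gt_eqF.
- exact: stepP.
- by rewrite step.
- by rewrite lexx stepP.
Qed.

Lemma itv_partition_rs (p : seq R) xi d : let t := nth 1 (0 :: p) in
  itv_partition 0 1 p -> (forall i, (i < size p)%N -> t i.+1 - t i < d) ->
  (forall i, (i < size p)%N -> t i <= xi i <= t i.+1) ->
  rs_partition d (size p) t xi.
Proof.
move=> t P td tag; split=> //; first exact: itv_partition_nth_size P.
move=> i ip; have [/(pathP 1)/(_ i ip) h _] := P.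
exact: ltW h.
Qed.

Lemma unif_itv_partition (n : nat) :
  let p := [seq unif_node n i.+1 | i <- iota 0 n.+1] in
  [/\ itv_partition 0 1 p, size p = n.+1 &
      forall i, (i <= n.+1)%N -> nth 1 (0 :: p) i = unif_node n i].
Proof.
move=> p; have sp : size p = n.+1 by rewrite size_map size_iota.
have nthE i : (i <= n.+1)%N -> nth 1 (0 :: p) i = unif_node n i.
  case: i => [_|i ni]; first by rewrite /= /unif_node mul0r.
  by rewrite /= (nth_map 0) ?size_iota // nth_iota.
split=> //; split.
  apply/(pathP 1) => i; rewrite sp => ni; rewrite nthE ?(ltnW ni) //.
  have -> : nth 1 p i = unif_node n i.+1 by rewrite -nthE.
  by rewrite /unif_node ltr_pM2r ?invr_gt0 ?ltr0n // ltr_nat.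
rewrite (last_nth 1) sp nthE // /unif_node divff // gt_eqF // ltr0n.
Qed.

End Sums.

(** Makes a Stieltjes integral the limit of a single sequence of sums, to which
    dominated convergence can be applied. *)
Lemma is_stieltjes_unif (R : realType) (A u : R -> R) (I : R) : is_stieltjes A u I ->
  rsum A u n.+1 (unif_node R n) (unif_node R n) @[n --> \oo] --> I.
Proof.
move=> h; apply/cvgrPdist_lt => e e0; have [d d0 hd] := h _ e0.
have := @near_infty_natSinv_lt R (PosNum d0); apply: filterS => n /= nd.
have [P sp nthE] := unif_itv_partition R n.
have [_ _ mono mesh tag] := unif_partition nd.
have := hd _ (unif_node R n) P; rewrite /rs_sum sp distrC.
rewrite (eq_big_nat _ _ (F2 := fun i => u (unif_node R n i) * (A (unif_node R n i.+1) - A (unif_node R n i)))).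
  by apply=> i ni; rewrite !nthE ?mesh ?tag // ltnW.
by move=> i /andP[_ ni]; rewrite !nthE // ltnW.
Qed.

Lemma is_stieltjes_unique (R : realType) (A u : R -> R) (I J : R) :
  is_stieltjes A u I -> is_stieltjes A u J -> I = J.
Proof.
move=> /is_stieltjes_unif hI /is_stieltjes_unif hJ.
exact: cvg_unique hI hJ.
Qed.

Lemma stieltjesE (R : realType) (A u : R -> R) (I : R) : is_stieltjes A u I -> stieltjes A u = I.
Proof.
move=> h; rewrite /stieltjes; case: xgetP => [J _ hJ|none]; last by case: (none I).
exact: is_stieltjes_unique hJ h.
Qed.

Lemma stieltjesP (R : realType) (A u : R -> R) :
  stieltjes_integrable A u -> is_stieltjes A u (stieltjes A u).
Proof. by move=> [I h]; rewrite (stieltjesE h). Qed.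

Lemma is_stieltjes_lin (R : realType) (A u v : R -> R) (I J x y : R) :
  is_stieltjes A u I -> is_stieltjes A v J ->
  is_stieltjes A (fun t => x * u t + y * v t) (x * I + y * J).
Proof.
move=> hI hJ e e0.
pose q := `|x| + `|y| + 1; have q0 : 0 < q by rewrite ltr_wpDl // addr_ge0.
have eq0 : 0 < e / q by rewrite divr_gt0.
have [d1 d10 h1] := hI _ eq0; have [d2 d20 h2] := hJ _ eq0.
exists (Num.min d1 d2); first by rewrite lt_min d10.
move=> p xi t P mesh tag.
have s1 : `|rs_sum A u p xi - I| < e / q.
  by apply: h1 => // i ip; apply: lt_le_trans (mesh _ ip) _; rewrite ge_min lexx.
have s2 : `|rs_sum A v p xi - J| < e / q.
  by apply: h2 => // i ip; apply: lt_le_trans (mesh _ ip) _; rewrite ge_min lexx orbT.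
have -> : rs_sum A (fun t => x * u t + y * v t) p xi - (x * I + y * J) =
    x * (rs_sum A u p xi - I) + y * (rs_sum A v p xi - J).
  have -> : rs_sum A (fun t => x * u t + y * v t) p xi =
      x * rs_sum A u p xi + y * rs_sum A v p xi.
    by rewrite /rs_sum !mulr_sumr -big_split /=; apply: eq_bigr => i _; ring.
  by ring.
apply: (le_lt_trans (ler_normD _ _)); rewrite !normrM.
have -> : e = (`|x| + `|y| + 1) * (e / q) by rewrite -/q mulrC divfK // gt_eqF.
have := ler_wpM2l (normr_ge0 x) (ltW s1); have := ler_wpM2l (normr_ge0 y) (ltW s2).
by rewrite !mulrDl; lra.
Qed.

Lemma is_stieltjes_ext (R : realType) (A u v : R -> R) (I : R) :
  (forall t, t \in `[0, 1] -> u t = v t) -> is_stieltjes A u I -> is_stieltjes A v I.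
Proof.
move=> uv h e e0; have [d d0 hd] := h _ e0; exists d => // p xi t P mesh tag.
have Q := itv_partition_rs P mesh tag.
have -> : rs_sum A v p xi = rs_sum A u p xi; last exact: hd.
apply: eq_big_nat => i /andP[_ ip]; rewrite uv //.
exact: rs_partition_tag Q ip.
Qed.

Lemma continuous_unif01 (R : realType) (u : R -> R) : {within `[0, 1], continuous u} ->
  forall e : R, 0 < e -> exists2 d : R, 0 < d & forall t s : R,
    t \in `[0, 1] -> s \in `[0, 1] -> `|t - s| <= d -> `|u t - u s| <= e.
Proof.
move=> uc; apply: (uniform_on_segment (dist := fun t s => `|u t - u s|)).
- by move=> t s; rewrite distrC.
- by move=> r t s _ _ _; exact: ler_distD.
- exact/within_continuous01P.
Qed.

Lemma continuous_bounded01 (R : realType) (u : R -> R) : {within `[0, 1], continuous u} ->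
  exists2 M : R, 0 <= M & bounded01 M u.
Proof.
move=> uc; have := @segment_compact R 0 1; move=> /(continuous_compact uc)/compact_bounded[M [_ hM]].
exists (`|M| + 1) => [|t t01]; first by rewrite addr_ge0.
apply: (hM (`|M| + 1)); first by have := ler_norm M; lra.
by exists t.
Qed.

(** The integral is a limit of sums over uniform partitions along an
    ultrafilter; by [rsum_close] all fine sums are close to it. *)
Lemma continuous_stieltjes (R : realType) (A u : R -> R) : bounded_variation 0 1 A ->
  {within `[0, 1], continuous u} -> stieltjes_integrable A u.
Proof.
move=> /bounded_variation_dominated[V VA] uc.
have unif := continuous_unif01 uc.
have V01 : 0 <= V 1 - V 0 := le_trans (normr_ge0 _) (VA _ _ (lexx 0) ler01 (lexx 1)).
have [M _ uM] := continuous_bounded01 uc.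
pose S n := rsum A u n.+1 (unif_node R n) (unif_node R n).
have [U [UF oU lim]] := ultralimit R.
have [n|I hI] := lim S (M * (V 1 - V 0)).
  have P := @unif_partition R n (n.+1%:R^-1 + 1) (ltr_pwDr ltr01 (lexx _)).
  by apply: (rsum_bound VA P) => i ni; apply: uM; exact: rs_partition_tag P ni.
exists I => e e0.
pose q := V 1 - V 0 + 1; have q0 : 0 < q by rewrite ltr_wpDl.
have eq0 : 0 < e / q / 3 by rewrite !divr_gt0.
have [d d0 hd] := unif _ eq0.
have d20 : 0 < d / 2 by lra.
exists (d / 2) => // p xi t P mesh tag.
have Q := itv_partition_rs P mesh tag.
have Us : U [set n | n.+1%:R^-1 < d / 2].
  by apply: oU; exact: (@near_infty_natSinv_lt R (PosNum d20)).
have e30 : 0 < e / 3 by lra.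
have [n [/= h1 h2]] := filter_ex (filterI (hI _ e30) Us).
have close : `|rs_sum A u p xi - S n| <= e / q / 3 * (V 1 - V 0).
  apply: (rsum_close VA _ Q (unif_partition h2)) => x y x01 y01 xy.
  by apply: hd => //; lra.
have : e / q / 3 * (V 1 - V 0) <= e / 3.
  have -> : e / 3 = e / q / 3 * q by field; rewrite gt_eqF.
  by apply: ler_wpM2l; [exact: ltW|rewrite /q; lra].
move: close h1; rewrite -(subrK (S n) (rs_sum A u p xi)) addrK -addrA => close h1 ?.
by apply: (le_lt_trans (ler_normD _ _)); lra.
Qed.

(** * Almost everywhere arguments for a complete measure *)

Section CompleteMeasure.
Context d (T : measurableType d) (R : realType) (mu : {measure set T -> \bar R}).
Hypothesis cmu : measure_is_complete mu.
Variables (D : set T) (mD : measurable D).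
Implicit Types (f g h : T -> R).

Lemma measurable_fun_null (N : set T) (f : T -> R) : mu.-negligible N -> measurable_fun N f.
Proof.
move=> nN _ Y mY; apply: cmu; apply: negligibleS nN; exact: subIsetl.
Qed.

(** By completeness a function is measurable on a null set whatever its values. *)
Lemma measurable_fun_off_null (N : set T) f : mu.-negligible N ->
  measurable_fun (D `\` N) f -> measurable_fun D f.
Proof.
move=> nN mf; have mN : measurable N by exact: cmu.
rewrite -(setUIDK D N); apply/measurable_funU; [exact: measurableI|exact: measurableD|split=> //].
by apply: measurable_fun_null; apply: negligibleS nN; exact: subIsetr.
Qed.

Lemma ae_cvg_measurable (h_ : nat -> T -> R) f :
  (forall n, measurable_fun D (h_ n)) ->
  {ae mu, forall x, D x -> h_ ^~ x @ \oo --> f x} -> measurable_fun D f.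
Proof.
move=> mh cv; apply: (measurable_fun_off_null cv).
have mN := cmu cv; apply: (measurable_fun_cvg (h := h_)).
  by move=> m; apply: measurable_funS (mh m) => //; exact: subDsetl.
by move=> x [Dx /= /contrapT]; exact.
Qed.

Lemma ae_eq_measurable f g : {ae mu, forall x, D x -> f x = g x} ->
  measurable_fun D f -> measurable_fun D g.
Proof.
move=> fg mf; apply: (ae_cvg_measurable (fun _ => mf)).
by apply: filterS fg => x h /h ->; exact: cvg_cst.
Qed.

Lemma ae_le_integrable f g : measurable_fun D f ->
  {ae mu, forall x, D x -> `|f x| <= g x} ->
  mu.-integrable D (EFin \o g) -> mu.-integrable D (EFin \o f).
Proof.
move=> mf fg ig.
have := @dominated_convergence _ T R mu D mD (fun _ => EFin \o f) (EFin \o f) (EFin \o g).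
case=> //.
- by move=> _; exact/measurable_EFinP.
- exact/measurable_EFinP.
- by apply: aeW => x _; exact: cvg_cst.
- by apply: filterS fg => x h n Dx; rewrite /= lee_fin; exact: h.
Qed.

Lemma ae_le_Rintegral f g : mu.-integrable D (EFin \o f) -> mu.-integrable D (EFin \o g) ->
  {ae mu, forall x, D x -> f x <= g x} -> \int[mu]_(x in D) f x <= \int[mu]_(x in D) g x.
Proof.
move=> fi gi fg; have [mf mg] := (measurable_int _ fi, measurable_int _ gi).
have mf' : measurable_fun D f by exact/measurable_EFinP.
have mg' : measurable_fun D g by exact/measurable_EFinP.
rewrite -subr_ge0 -RintegralB // /Rintegral.
rewrite (@ae_eq_integral _ _ _ _ D (fun x => (Num.max (g x - f x) 0)%:E)) //.
- apply: fine_ge0; apply: integral_ge0 => x _.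
  by rewrite lee_fin le_max lexx orbT.
- by apply/measurable_EFinP; apply: measurable_funB.
- by apply/measurable_EFinP; apply: measurable_maxr => //; apply: measurable_funB.
- by apply: filterS fg => x h Dx; rewrite (max_idPl _) // subr_ge0 h.
Qed.

Lemma dominated_Rintegral (f_ : nat -> T -> R) f g :
  (forall n, measurable_fun D (f_ n)) ->
  {ae mu, forall x, D x -> f_ ^~ x @ \oo --> f x} ->
  (forall n, {ae mu, forall x, D x -> `|f_ n x| <= g x}) ->
  mu.-integrable D (EFin \o g) ->
  \int[mu]_(x in D) f_ n x @[n --> \oo] --> \int[mu]_(x in D) f x.
Proof.
move=> mf_ cv dom ig; have mf := ae_cvg_measurable mf_ cv.
have [] := @dominated_convergence _ T R mu D mD (fun n => EFin \o f_ n) (EFin \o f) (EFin \o g).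
- by move=> n; exact/measurable_EFinP.
- exact/measurable_EFinP.
- by apply: filterS cv => x h Dx; apply: cvg_EFin; [exact: nearW|exact: h].
- exact: ig.
- move/ae_foralln : dom; apply: filterS => x h n Dx.
  by rewrite /= lee_fin; exact: h.
move=> fi _ cvI; rewrite /Rintegral.
by apply: fine_cvg; rewrite fineK //; exact: integrable_fin_num.
Qed.

End CompleteMeasure.

(** * Sections of functions measurable for the completed product *)

Notation unit_set R := ([set` `[0 : R, 1]] : set (lebType R)).

Lemma leb_complete (R : realType) : measure_is_complete (leb R).
Proof. exact: completed_lebesgue_measure_is_complete. Qed.

Lemma measurable_inv (R : realType) : measurable_fun [set: R] (fun x : R => x^-1).
Proof.
rewrite -(setUv [set (0 : R)]); apply/measurable_funU => //; first exact: measurableC.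
split.
  exact: measurable_fun_set1.
apply: open_continuous_measurable_fun.
  by apply: closed_openC; apply: accessible_closed_set1; apply: hausdorff_accessible; exact: Rhausdorff.
move=> x; rewrite inE /= => /eqP x0; exact: inv_continuous.
Qed.

(** A set of the completion differs from a measurable set of the product by a
    part of a null set, almost all of whose sections are null by Tonelli's theorem. *)
Lemma ae_xsection_measurable (R : realType) (E : set (lebType R * lebType R)) :
  measurable (E : set (leb2Type R)) -> {ae leb R, forall t, measurable (xsection E t)}.
Proof.
move=> mE.
pose G := [set E : set (lebType R * lebType R) | {ae leb R, forall t, measurable (xsection E t)}].
suff : <<s completed_algebra_gen (leb R \x leb R)%E >> `<=` G by apply.
apply: smallest_sub.
  split.
  - by apply: aeW => t; rewrite xsection0.
  - rewrite /G /= => A; apply: filterS => t mA.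
    have -> : xsection ([set: _] `\` A) t = ~` xsection A t by rewrite setTD !xsectionE.
    exact: measurableC.
  - rewrite /G /= => F GF.
    have : {ae leb R, forall t, forall n, measurable (xsection (F n) t)} by exact/ae_foralln.
    apply: filterS => t mF; rewrite xsection_bigcup; exact: bigcup_measurable.
move=> _ [A mA] [N [B [mB B0 NB]] <-].
have : {ae leb R, forall t, leb R (xsection B t) = 0%E}.
  have mf : measurable_fun [set: lebType R] (leb R \o xsection B) by exact: measurable_fun_xsection.
  have ae0 : ae_eq (leb R) setT (leb R \o xsection B) (cst 0%E).
    apply/(ae_eq_integral_abs (leb R) measurableT mf).
    rewrite -[RHS]B0 /product_measure1; apply: eq_integral => t _.
    by rewrite gee0_abs // measure_ge0.
  by apply: filterS ae0 => t h; exact: h.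
apply: filterS => t Bt.
have -> : xsection (A `|` N) t = xsection A t `|` xsection N t by rewrite !xsectionE.
apply: measurableU; first exact: measurable_xsection.
apply: leb_complete; exists (xsection B t); split=> //; first exact: measurable_xsection.
exact: le_xsection.
Qed.

(** Superlevel sets at rational thresholds generate, so that countably many
    exceptional null sets are involved. *)
Lemma ae_section_measurable (R : realType) (k : R -> R -> R) :
  measurable_fun (`[0, 1] `*` `[0, 1] : set (leb2Type R))
    ((fun x => k x.1 x.2) : leb2Type R -> R) ->
  {ae leb R, forall t, t \in `[0, 1] -> measurable_fun (unit_set R) (k t : lebType R -> R)}.
Proof.
move=> mk.
have mD : measurable (`[0, 1] `*` `[0, 1] : set (leb2Type R)).
  apply: sub_sigma_algebra; exists (`[0, 1] `*` `[0, 1]).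
    by apply: measurableX; exact: measurable_itv_leb.
  by exists set0; [exact: negligible_set0|rewrite setU0].
pose q (n : nat) : R := ratr (odflt 0 (unpickle n : option rat)).
pose E n : set (lebType R * lebType R) := (unit_set R `*` unit_set R) `&`
    ((fun x : lebType R * lebType R => k x.1 x.2) @^-1` `]q n, +oo[).
have mE n : measurable (E n : set (leb2Type R)).
  by apply: mk => //; exact: measurable_itv.
have : {ae leb R, forall t, forall n, measurable (xsection (E n) t)}.
  by apply/ae_foralln => n; exact: (ae_xsection_measurable (mE n)).
apply: filterS => t mt t01.
apply: (measurability _ (RGenOInfty.measurableE R)) => // _ [_ [x ->] <-].
have -> : unit_set R `&` k t @^-1` `]x, +oo[ = \bigcup_(n in [set n | x < q n]) xsection (E n) t.
  apply/seteqP; split=> s.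
    move=> [s01 xk]; have {}xk : x < k t s by move: xk; rewrite /= in_itv /= andbT.
    have [r] := rat_in_itvoo xk; rewrite in_itv /= => /andP[xr rk].
    exists (pickle r); first by rewrite /= /q pickleK.
    by rewrite xsectionE; split; [split|rewrite /= in_itv /= /q pickleK /= rk].
  move=> [n xq]; rewrite xsectionE => -[[_ s01] qk]; split=> //.
  have {}qk : q n < k t s by move: qk; rewrite /= in_itv /= andbT.
  by rewrite /= in_itv /= andbT; exact: lt_trans qk.
by apply: bigcup_measurable => n _; exact: mt.
Qed.

(** * Sections of the kernel *)

Lemma measurable_unit (R : realType) : measurable (unit_set R).
Proof. exact: measurable_itv_leb. Qed.
#[local] Hint Resolve measurable_unit : core.

#[global] Instance leb_ae_filter (R : realType) :
  Filter (nbhs (almost_everywhere (leb R))).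
Proof. exact: ae_filter_ringOfSetsType. Qed.

Lemma leb_itvoo (R : realType) (x y : R) : x < y -> leb R [set` `]x, y[] = (y - x)%:E.
Proof.
move=> xy; have := @lebesgue_measure_itv R `]x, y[; rewrite /= lte_fin xy.
exact.
Qed.

Lemma ae_exists_between (R : realType) (P : lebType R -> Prop) (x y : R) :
  {ae leb R, forall t, P t} -> x < y -> exists2 t : R, t \in `]x, y[ & P t.
Proof.
move=> Pae xy; apply: contrapT => no.
have : (leb R).-negligible [set` `]x, y[].
  apply: negligibleS Pae => t xt /= Pt; apply: no; exists t => //.
move/(negligibleP _ (measurable_itv_leb _)) => null.
have := leb_itvoo xy; rewrite [LHS]null => /esym/eqP.
by rewrite eqe subr_eq0 gt_eqF.
Qed.

Lemma C1_sequential (R : realType) (k : R -> R -> R) (tau : R) : C1 k -> tau \in `[0, 1] ->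
  {ae leb R, forall s, s \in `[0, 1] -> forall t_ : nat -> R,
    (forall n, t_ n \in `[0, 1]) -> t_ @ \oo --> tau -> k (t_ n) s @[n --> \oo] --> k tau s}.
Proof.
move=> [_ /(_ tau) h] tau01; apply: filterS (h tau01) => s {}h s01 t_ t01 tcv.
have hs := h s01.
apply/cvgrPdist_le => e e0.
move/cvgrPdist_le: hs => /(_ _ e0); rewrite near_withinE => /nbhs_ballP[d /= d0 hd].
move/cvgrPdist_lt: tcv => /(_ _ d0); apply: filterS => n tn.
by have := hd _ tn (t01 n); rewrite sub0r normrN normr_id distrC.
Qed.

(** By Fubini's theorem the section is measurable at almost every t, in particular
    along a sequence tending to tau; C1 carries this over to tau. *)
Lemma C1_measurable (R : realType) (k : R -> R -> R) (tau : R) : C1 k -> tau \in `[0, 1] ->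
  measurable_fun (unit_set R) (k tau : lebType R -> R).
Proof.
move=> kC1 tau01; have good := ae_section_measurable (proj1 kC1).
have approx (n : nat) : exists t : R, [/\ t \in `[0, 1], `|t - tau| <= n.+1%:R^-1 &
    measurable_fun (unit_set R) (k t : lebType R -> R)].
  have n0 : 0 < n.+1%:R^-1 :> R by rewrite invr_gt0 ltr0n.
  move: (n.+1%:R^-1) n0 => r n0.
  have /andP[tau0 tau1] : 0 <= tau <= 1 by move: tau01; rewrite in_itv.
  have [lt1|ge1] := ltP tau 1.
    have [y [ty y1 yn]] : exists y : R, [/\ tau < y, y <= 1 & y <= tau + r].
      by exists (Num.min 1 (tau + r)); rewrite lt_min lt1 ltrDl n0 !ge_min !lexx orbT.
    have [t] := ae_exists_between good ty; rewrite in_itv /= => /andP[h1 h2] mt; exists t.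
    have {h1 h2} [h1 h2] : tau < t /\ t < y by [].
    have t01 : t \in `[0, 1] by rewrite in_itv /=; apply/andP; split; lra.
    by split; [|rewrite ler_norml; apply/andP; split; lra|exact: mt].
  have [y [ty y1 yn]] : exists y : R, [/\ y < tau, 0 <= y & tau - r <= y].
    exists (Num.max 0 (tau - r)); rewrite gt_max !le_max !lexx orbT.
    by split=> //; apply/andP; split; lra.
  have [t] := ae_exists_between good ty; rewrite in_itv /= => /andP[h1 h2] mt; exists t.
  have {h1 h2} [h1 h2] : y < t /\ t < tau by [].
  have t01 : t \in `[0, 1] by rewrite in_itv /=; apply/andP; split; lra.
  by split; [|rewrite ler_norml; apply/andP; split; lra|exact: mt].
have [t_ ht] := choice approx.
have tcv : t_ @ \oo --> tau.
  apply/cvgrPdist_le => e e0; have := @near_infty_natSinv_lt R (PosNum e0).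
  apply: filterS => n /= /ltW ne; rewrite distrC.
  by have [_ h _] := ht n; exact: le_trans ne.
apply: (@ae_cvg_measurable _ _ _ (leb R) (@leb_complete R) _ _ (fun n => k (t_ n))) => //.
  by move=> n; have [] := ht n.
apply: filterS (C1_sequential kC1 tau01) => s h s01.
by apply: h => // n; have [] := ht n.
Qed.

(** * Measurable functions on the unit interval *)

Definition measurable01 (R : realType) (u : R -> R) : Prop :=
  measurable_fun (unit_set R) (u : lebType R -> R).

Lemma continuous_measurable01 (R : realType) (u : R -> R) :
  {within `[0, 1], continuous u} -> measurable01 u.
Proof.
move=> uc mD B mB.
have := subspace_continuous_measurable_fun (measurable_itv `[0, 1]) uc.
move=> /(_ (measurable_itv _) B mB); exact: sub_caratheodory.
Qed.

Lemma step_measurable01 (R : realType) (n : nat) (x : nat -> R) :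
  measurable01 (fun t => x (Num.truncn (n%:R * t))).
Proof.
move=> mD B mB.
have -> : unit_set R `&` (fun t : R => x (Num.truncn (n%:R * t))) @^-1` B =
    \bigcup_(i in [set i | B (x i)])
      (unit_set R `&` (fun t : R => n%:R * t) @^-1` `[i%:R, i.+1%:R[).
  apply/seteqP; split=> t.
    move=> [t01 Bt]; exists (Num.truncn (n%:R * t)) => //; split=> //.
    rewrite /= in_itv /=; apply: truncn_itv; rewrite mulr_ge0 //.
    by have /itvP := (t01 : t \in `[0, 1]); move=> ->.
  move=> [i Bi [t01 ti]]; split=> //=.
  by rewrite (@truncn_def _ _ i) //; move: ti; rewrite /= in_itv.
apply: bigcup_measurable => i _; apply: sub_caratheodory.
have mf : measurable_fun `[0 : R, 1] (fun t : R => n%:R * t).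
  by apply: measurable_funM => //; exact: measurable_id.
by apply: mf => //; exact: measurable_itv.
Qed.

(** For the approximations of u with values in the multiples of 1/(n+1), the
    composition is a countable gluing of the functions f(.,z); the limit exists almost
    everywhere since f(s,.) is continuous. *)
Lemma caratheodory_measurable (R : realType) (f : R -> R -> R) (u : R -> R) : C4 f ->
  measurable01 u -> measurable01 (fun s => f s (u s)).
Proof.
move=> [_ mf fc _] mu.
pose u_ n s : R := (Num.floor (n.+1%:R * u s))%:~R / n.+1%:R.
apply: (@ae_cvg_measurable _ _ _ (leb R) (@leb_complete R) _ (@measurable_unit R)
  (fun n s => f s (u_ n s))); last first.
  apply: filterS fc => s {}fc s01; apply: (continuous_cvg _ (fc s01 _)).
  apply/cvgrPdist_le => e e0; have := @near_infty_natSinv_lt R (PosNum e0).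
  apply: filterS => n /= /ltW; apply: le_trans.
  have n0 : 0 < n.+1%:R :> R by rewrite ltr0n.
  rewrite -(ler_pM2l n0) divff ?gt_eqF // -[X in X * _](gtr0_norm n0) -normrM mulrBr.
  rewrite (mulrC n.+1%:R (u_ n s)) divfK ?gt_eqF //.
  have := floor_itv (n.+1%:R * u s); rewrite intrD => /andP[h1 h2].
  by rewrite ger0_norm; lra.
move=> n; pose z (i : nat) : int := odflt 0 (unpickle i : option int).
pose E i := unit_set R `&` (u : lebType R -> R) @^-1` `[(z i)%:~R / n.+1%:R, ((z i)%:~R + 1) / n.+1%:R[.
have n0 : 0 < n.+1%:R :> R by rewrite ltr0n.
have mE i : measurable (E i) by apply: mu => //; exact: measurable_itv.
have EP i s : E i s -> Num.floor (n.+1%:R * u s) = z i.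
  move=> [_]; rewrite /= in_itv /= ler_pdivrMr // ltr_pdivlMr // => h.
  by apply: floor_def; rewrite intrD mulrC.
have -> : unit_set R = \bigcup_i E i.
  apply/seteqP; split=> s; last by move=> [i _ []].
  move=> s01; exists (pickle (Num.floor (n.+1%:R * u s))) => //; split=> //.
  rewrite /z pickleK /= in_itv /= ler_pdivrMr // ltr_pdivlMr // (mulrC (u s)).
  by have := floor_itv (n.+1%:R * u s); rewrite intrD.
apply/(measurable_fun_bigcup _ mE) => i.
have mfE : measurable_fun (E i) ((fun t => f t ((z i)%:~R / n.+1%:R)) : lebType R -> R).
  by apply: (measurable_funS (@measurable_unit R)) (mf _); exact: subIsetl.
apply: eq_measurable_fun mfE => s; rewrite inE => /EP e.
by rewrite /u_ e.
Qed.

(** * Integrals of a dominated kernel against a bounded density *)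

Section Weighted.
Variables (R : realType) (g Phi : R -> R).
Hypothesis mPhi : measurable01 Phi.
Hypothesis wint : (leb R).-integrable (unit_set R) (EFin \o (fun s : lebType R => g s * Phi s)).
Hypothesis g_ge0 : {ae leb R, forall s, s \in `[0, 1] -> 0 <= g s}.

Hypothesis Phi_ge0 : {ae leb R, forall s, s \in `[0, 1] -> 0 <= Phi s}.

(** The kernels k t, K_A and K_B are all of this kind, which is what makes their
    integrals against g f(s,u(s)) exist. *)
Definition profile (V : R) (q : R -> R) : Prop :=
  measurable01 q /\ {ae leb R, forall s, s \in `[0, 1] -> `|q s| <= V * Phi s}.

Definition density (N : R) (h : R -> R) : Prop :=
  measurable01 h /\ {ae leb R, forall s, s \in `[0, 1] -> `|h s| <= N}.

Lemma measurable01_weight : measurable01 (fun s => g s * Phi s).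
Proof. by apply/measurable_EFinP; exact: measurable_int wint. Qed.

Lemma profile_weight V q : profile V q -> {ae leb R, forall s, s \in `[0, 1] ->
  `|q s * g s| <= V * (g s * Phi s)}.
Proof.
move=> [_ qV]; apply: filterS2 qV g_ge0 => s h1 h2 s01.
rewrite normrM (ger0_norm (h2 s01)) mulrCA mulrC.
by apply: ler_wpM2l; [exact: h2|exact: h1].
Qed.

(** Write q g = (q / Phi) (g Phi), where q = 0 wherever Phi = 0. The function g
    alone need not be measurable. *)
Lemma measurable01_profile V q : profile V q -> measurable01 (fun s => q s * g s).
Proof.
move=> [mq qV].
have mi : measurable01 (fun s => (Phi s)^-1).
  by apply: (measurableT_comp (@measurable_inv R)); exact: mPhi.
apply: (@ae_eq_measurable _ _ _ (leb R) (@leb_complete R) _ (@measurable_unit R)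
  (fun s => q s * (Phi s)^-1 * (g s * Phi s))).
  apply: filterS qV => s h s01; have [P0|P0] := eqVneq (Phi s) 0.
    have := h s01; rewrite P0 mulr0 normr_le0 => /eqP ->.
    by rewrite !(mul0r, mulr0).
  by rewrite (mulrC (g s)) mulrA divfK.
apply: measurable_funM; last exact: measurable01_weight.
exact: measurable_funM.
Qed.

Lemma measurable01_integrand V N q h : profile V q -> density N h ->
  measurable01 (fun s => q s * g s * h s).
Proof.
move=> pq [mh _]; apply: measurable_funM; [exact: measurable01_profile pq|exact: mh].
Qed.

Lemma integrand_le V N q h : profile V q -> density N h ->
  {ae leb R, forall s, s \in `[0, 1] -> `|q s * g s * h s| <= V * N * (g s * Phi s)}.
Proof.
move=> pq [_ hN]; apply: filterS2 (profile_weight pq) hN => s h1 h2 s01.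
rewrite normrM mulrAC; apply: ler_pM => //; [exact: h1|exact: h2].
Qed.

Lemma weight_integrable (r : R) :
  (leb R).-integrable (unit_set R) (EFin \o (fun s : lebType R => r * (g s * Phi s))).
Proof.
rewrite (_ : EFin \o _ = (fun s => r%:E * (g s * Phi s)%:E)%E) //; exact: integrableZl.
Qed.

Lemma integrand_integrable V N q h : profile V q -> density N h ->
  (leb R).-integrable (unit_set R) (EFin \o (fun s : lebType R => q s * g s * h s)).
Proof.
move=> pq dh; apply: (@ae_le_integrable _ _ _ (leb R) _ (@measurable_unit R) _ (fun s => V * N * (g s * Phi s))).
- exact: measurable01_integrand pq dh.
- exact: integrand_le pq dh.
- exact: weight_integrable.
Qed.

Lemma integrand_integrable_sub (a b V N : R) q h : {subset `[a, b] <= `[0, 1]} ->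
  profile V q -> density N h ->
  (leb R).-integrable [set` `[a, b]] (EFin \o (fun s : lebType R => q s * g s * h s)).
Proof.
move=> sub pq dh; apply: (integrableS (@measurable_unit R)) (integrand_integrable pq dh).
  exact: measurable_itv_leb.
by move=> s; exact: sub.
Qed.

Lemma profile_Phi : profile 1 Phi.
Proof.
split=> //; apply: filterS Phi_ge0 => s h s01.
by rewrite mul1r ger0_norm // h.
Qed.

Lemma density_norm N h : density N h -> density N (fun s => `|h s|).
Proof.
move=> [mh hN]; split; first by apply: measurableT_comp => //; exact: mh.
by apply: filterS hN => s h0 s01; rewrite normr_id h0.
Qed.

Lemma weighted_bound V N q h : 0 <= V -> profile V q -> density N h ->
  `|\int[leb R]_(s in `[0, 1]) (q s * g s * h s)| <=
    V * \int[leb R]_(s in `[0, 1]) (Phi s * g s * `|h s|).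
Proof.
move=> V0 pq dh; have ii := integrand_integrable pq dh.
have iw := integrand_integrable profile_Phi (density_norm dh).
rewrite -RintegralZl //.
apply: (le_trans (le_normr_Rintegral _ _)) => //.
apply: ae_le_Rintegral => //.
- rewrite (_ : EFin \o _ = (fun s => `|(q s * g s * h s)%:E|)%E) //.
  exact: (integrable_abse ii).
- rewrite (_ : EFin \o _ = (fun s => V%:E * (Phi s * g s * `|h s|)%:E)%E) //.
  exact: integrableZl.
- apply: filterS2 (profile_weight pq) Phi_ge0 => s h1 h2 s01.
  rewrite normrM (mulrC (Phi s)) mulrA ler_wpM2r //.
  exact: h1.
Qed.

Lemma weighted_le V W N N' q q' h h' : profile V q -> profile W q' ->
  density N h -> density N' h' ->
  {ae leb R, forall s, s \in `[0, 1] -> q s * g s * h s <= q' s * g s * h' s} ->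
  \int[leb R]_(s in `[0, 1]) (q s * g s * h s) <= \int[leb R]_(s in `[0, 1]) (q' s * g s * h' s).
Proof.
move=> pq pq' dh dh'; apply: ae_le_Rintegral => //.
  exact: integrand_integrable pq dh.
exact: integrand_integrable pq' dh'.
Qed.

End Weighted.

(** * Essential bounds and superposition operators *)

Lemma ae_leb_on (R : realType) (x y : R) (P : R -> Prop) :
  {ae leb_on x y, forall s, P s} -> {ae leb R, forall s, s \in `[x, y] -> P s}.
Proof.
move=> [N [mN N0 PN]]; exists (N `&` [set` `[x, y]]); split.
- by apply: measurableI => //; exact: measurable_itv_leb.
- exact: N0.
- move=> s /= /not_implyP[sxy nP]; split=> //; exact: PN.
Qed.

Lemma Linf01_bounded (R : realType) (h : R -> R) : Linf01 h -> exists2 N : R, 0 <= N &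
  {ae leb R, forall s, s \in `[0, 1] -> `|h s| <= N}.
Proof.
move=> [_ hfin]; have := ess_sup_ge (leb_on (0 : R) 1) (fun s => `|h s|%:E).
move: hfin; case: (ess_sup _ _) => [r _ hr|//|_ hr].
- exists `|r| => //; apply: filterS (ae_leb_on hr) => s h0 /h0.
  by rewrite lee_fin => /le_trans; apply; exact: ler_norm.
- exists 0 => //; apply: filterS (ae_leb_on hr) => s h0 /h0.
  by rewrite leeNy_eq.
Qed.

Section Nemytskii.
Variables (R : realType) (f : R -> R -> R).
Hypothesis hC4 : C4 f.

Lemma nemytskii_ge0 u s : s \in `[0, 1] -> 0 <= f s (u s).
Proof. by case: hC4 => h _ _ _; exact: h. Qed.

Lemma nemytskii_density (M : R) : exists2 N : R, 0 <= N & forall u, measurable01 u ->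
  bounded01 M u -> density N (fun s => f s (u s)).
Proof.
have [f0 _ _ fb] := hC4.
have M0 : 0 < `|M| + 1 by rewrite ltr_wpDl.
have [phi /Linf01_bounded[N N0 hN] hphi] := fb _ M0.
exists N => // u mu uM; split; first exact: caratheodory_measurable.
apply: filterS2 hN hphi => s h1 h2 s01; rewrite ger0_norm ?f0 //.
apply: (le_trans (h2 s01 (u s) _)); last by apply: le_trans (h1 s01); exact: ler_norm.
have := uM _ s01; have := ler_norm M; rewrite in_itv /= -ler_norml; lra.
Qed.

(** By contradiction: along pairs of functions at distance 1/(n+1) the integrand
    tends to 0 at almost every s, since f(s,.) is uniformly continuous on [-M,M], and
    dominated convergence applies. *)
Lemma nemytskii_uniform (g Phi : R -> R) (M e : R) : measurable01 Phi ->
  (leb R).-integrable (unit_set R) (EFin \o (fun s : lebType R => g s * Phi s)) ->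
  {ae leb R, forall s, s \in `[0, 1] -> 0 <= g s} ->
  {ae leb R, forall s, s \in `[0, 1] -> 0 <= Phi s} -> 0 < e ->
  exists2 d : R, 0 < d & forall u v, measurable01 u -> bounded01 M u ->
    measurable01 v -> bounded01 M v -> (forall s, s \in `[0, 1] -> `|u s - v s| <= d) ->
    \int[leb R]_(s in `[0, 1]) (Phi s * g s * `|f s (u s) - f s (v s)|) <= e.
Proof.
move=> mPhi wint g0 Phi0 e0; apply: contrapT => H.
have [N N0 dens] := nemytskii_density M.
have bad (n : nat) : exists p : (R -> R) * (R -> R), [/\ measurable01 p.1 /\ bounded01 M p.1,
    measurable01 p.2 /\ bounded01 M p.2,
    (forall s, s \in `[0, 1] -> `|p.1 s - p.2 s| <= n.+1%:R^-1) &
    e < \int[leb R]_(s in `[0, 1]) (Phi s * g s * `|f s (p.1 s) - f s (p.2 s)|)].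
  apply: contrapT => hn; apply: H; exists n.+1%:R^-1; first by rewrite invr_gt0.
  move=> u v mu uM mv vM uv; rewrite leNgt; apply/negP => lt.
  by apply: hn; exists (u, v).
have [p hp] := choice bad.
have dens2 n : density (N + N) (fun s => `|f s ((p n).1 s) - f s ((p n).2 s)|).
  have [[m1 b1] [m2 b2] _ _] := hp n.
  have [mf1 d1] := dens _ m1 b1; have [mf2 d2] := dens _ m2 b2.
  split; first by apply: (measurableT_comp (@normr_measurable R setT)); exact: measurable_funB.
  apply: filterS2 d1 d2 => s h1 h2 s01; rewrite normr_id.
  by apply: (le_trans (ler_normB _ _)); apply: lerD; [exact: h1|exact: h2].
have pPhi := profile_Phi mPhi Phi0.
have : \int[leb R]_(s in `[0, 1]) (Phi s * g s * `|f s ((p n).1 s) - f s ((p n).2 s)|)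
    @[n --> \oo] --> \int[leb R]_(s in `[0, 1]) (0 : R).
  apply: (@dominated_Rintegral _ _ _ (leb R) (@leb_complete R) _ (@measurable_unit R)
    (fun n s => Phi s * g s * `|f s ((p n).1 s) - f s ((p n).2 s)|) _
    (fun s => 1 * (N + N) * (g s * Phi s))).
  - by move=> n; exact: measurable01_integrand pPhi (dens2 n).
  - have [_ _ fc _] := hC4; apply: filterS fc => s {}fc s01.
    rewrite -[X in _ --> X](mulr0 (Phi s * g s)); apply: cvgM; first exact: cvg_cst.
    apply/cvgrPdist_le => e' e'0.
    have [|||d d0 hd] := @uniform_on_segment R (- M) M (fun x y => `|f s x - f s y|) _ _ _ _ e'0.
    + by move=> t r; rewrite distrC.
    + by move=> r t q _ _ _; exact: ler_distD.
    + move=> tau _ e1 e10; have /cvgrPdist_le/(_ _ e10)/nbhs_ballP[d /= d0 hd] := fc s01 tau.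
      exists d => // t _ td; rewrite distrC; apply: hd; by rewrite /ball /= distrC.
    have := @near_infty_natSinv_lt R (PosNum d0); apply: filterS => n /= /ltW nd.
    rewrite sub0r normrN normr_id.
    have [[_ b1] [_ b2] h _] := hp n.
    apply: hd; rewrite ?in_itv /= -?ler_norml; [exact: b1|exact: b2|].
    by apply: le_trans nd; exact: h.
  - by move=> n; exact: integrand_le pPhi (dens2 n).
  - exact: weight_integrable.
have -> : \int[leb R]_(s in `[0, 1]) (0 : R) = 0.
  by rewrite /Rintegral integral0.
move/cvgrPdist_lt => /(_ _ e0)[n _ /(_ n (leqnn n))].
have [_ _ _ lt] := hp n; rewrite sub0r normrN => lt2.
by have := lt_trans lt (le_lt_trans (ler_norm _) lt2); rewrite ltxx.
Qed.

End Nemytskii.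

Lemma ae_on_leb (R : realType) (x y : R) (P : R -> Prop) :
  {ae leb R, forall s, s \in `[x, y] -> P s} -> {ae leb_on x y, forall s, P s}.
Proof.
move=> [N [mN N0 PN]]; have mI := @measurable_itv_leb R `[x, y].
exists (N `|` ~` [set` `[x, y]]); split.
- by apply: measurableU => //; exact: measurableC.
- have mNI : measurable (N `&` [set` `[x, y]]) by exact: measurableI.
  rewrite (_ : leb_on x y _ = leb R (N `&` [set` `[x, y]])); last first.
    by rewrite [LHS](_ : _ = leb R ((N `|` ~` [set` `[x, y]]) `&` [set` `[x, y]])) // setIUl setICl setU0.
  by apply: (subset_measure0 mNI mN _ N0) => s [].
- move=> s /= nP; case: (boolP (s \in `[x, y])) => sxy; [left|by right; exact/negP].
  by apply: PN => h; apply: nP; exact: h.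
Qed.

(** Replaces the essential supremum of f / r by a nonnegative real number m, so
    that condI1 becomes an inequality between reals. The supremum is finite by C4. *)
Lemma ess_supf_bound (R : realType) (f : R -> R -> R) (r x : R) : C4 f -> 0 < r ->
  (ess_supf f r * x%:E < 1)%E -> 0 <= x -> exists m : R, [/\ 0 <= m, m * x < 1 &
    {ae leb R, forall s, s \in `[0, 1] -> forall v, v \in `[- r, r] -> f s v <= m * r}].
Proof.
move=> [_ _ _ fb] r0 hE x0.
have [phi /Linf01_bounded[N N0 hN] hphi] := fb _ r0.
have Efin : (ess_supf f r <= (N / r)%:E)%E.
  apply/ess_supP; apply: ae_on_leb; apply: filterS2 hN hphi => s h1 h2 s01.
  apply: ge_ereal_sup => _ [v vr <-]; rewrite lee_fin ler_pM2r ?invr_gt0 //.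
  exact: le_trans (h2 s01 v vr) (le_trans (ler_norm _) (h1 s01)).
have : exists m : R, [/\ 0 <= m, m * x < 1 & (ess_supf f r <= m%:E)%E].
  move: hE Efin; case: (ess_supf f r) => [e|//|].
  - rewrite -EFinM lte_fin => ex _; exists (Num.max e 0); split.
    + by rewrite le_max lexx orbT.
    + by rewrite maxr_pMl // mul0r gt_max ex ltr01.
    + by rewrite lee_fin le_max lexx.
  - by move=> _ _; exists 0; rewrite mul0r ltr01 leNye lexx.
move=> [m [m0 mx Em]]; exists m; split => //.
have := ess_sup_ge (leb_on (0 : R) 1)
  (fun t => ereal_sup [set (f t u / r)%:E | u in `[- r, r]]).
move=> /ae_leb_on; apply: filterS => s h s01 v vr.
rewrite -ler_pdivrMr // -lee_fin; apply: le_trans Em; apply: le_trans (h s01).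
by apply: ereal_sup_ubound; exists v.
Qed.

(** As the product exceeds 1 it is not of the form 0 * oo, whence x > 0; if the
    essential infimum is infinite, m can then be chosen freely, for instance 2 / x. *)
Lemma ess_inff_bound (R : realType) (f : R -> R -> R) (a b c r x : R) : 0 < r ->
  (1 < ess_inff f a b c r * x%:E)%E -> 0 <= x -> exists m : R, [/\ 0 <= m, 1 < m * x &
    {ae leb R, forall s, s \in `[a, b] -> forall v, v \in `[r, r / c] -> m * r <= f s v}].
Proof.
move=> r0 hE; rewrite le_eqVlt => /orP[/eqP x0|x0].
  by move: hE; rewrite -x0 mule0 lte_fin ltr10.
have : exists m : R, [/\ 0 <= m, 1 < m * x & (m%:E <= ess_inff f a b c r)%E].
  move: hE; case: (ess_inff f a b c r) => [e||].
  - rewrite -EFinM lte_fin => ex; exists e; split => //.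
    by rewrite -(pmulr_lge0 e x0); apply: le_trans (ltW ex).
  - move=> _; exists (2 / x); split; last exact: leey.
      by rewrite divr_ge0 // ltW.
    by rewrite divfK ?gt_eqF // ltr1n.
  - by rewrite gt0_mulNye ?lte_fin.
move=> [m [m0 mx mE]]; exists m; split => //.
have := ess_inf_le (leb_on a b)
  (fun t => ereal_inf [set (f t u / r)%:E | u in `[r, r / c]]).
move=> /ae_leb_on; apply: filterS => s h sab v vr.
rewrite -ler_pdivlMr // -lee_fin; apply: (le_trans mE); apply: (le_trans (h sab)).
by apply: ereal_inf_lbound; exists v.
Qed.

(** * Continuity of the kernel in mean *)

Section Kernel.
Variables (R : realType) (k : R -> R -> R) (g Phi : R -> R).
Hypothesis kC1 : C1 k.
Hypothesis mPhi : measurable01 Phi.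
Hypothesis kPhi : forall t, t \in `[0, 1] ->
  {ae leb R, forall s, s \in `[0, 1] -> `|k t s| <= Phi s}.
Hypothesis wint : (leb R).-integrable (unit_set R) (EFin \o (fun s : lebType R => g s * Phi s)).
Hypothesis g_ge0 : {ae leb R, forall s, s \in `[0, 1] -> 0 <= g s}.

Lemma kernel_Phi_ge0 : {ae leb R, forall s, s \in `[0, 1] -> 0 <= Phi s}.
Proof.
have zero01 : (0 : R) \in `[0, 1] by rewrite in_itv /= lexx ler01.
by apply: filterS (kPhi zero01) => s h s01; exact: le_trans (h s01).
Qed.

Lemma kernel_profile t : t \in `[0, 1] -> profile Phi 1 (k t).
Proof.
move=> t01; split; first exact: C1_measurable.
by apply: filterS (kPhi t01) => s h s01; rewrite mul1r h.
Qed.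

Lemma profile_norm V q : profile Phi V q -> profile Phi V (fun s => `|q s|).
Proof.
move=> [mq hq]; split; first by apply: measurableT_comp => //; exact: mq.
by apply: filterS hq => s h s01; rewrite normr_id h.
Qed.

Lemma profile_lin V W q r x : profile Phi V q -> profile Phi W r ->
  profile Phi (V * `|x| + W) (fun s => q s * x + r s).
Proof.
move=> [mq hq] [mr hr]; split.
  apply: measurable_funD; last exact: mr.
  by apply: measurable_funM; [exact: mq|exact: measurable_cst].
apply: filterS2 hq hr => s h1 h2 s01; apply: (le_trans (ler_normD _ _)).
rewrite mulrDl; apply: lerD; last exact: h2.
by rewrite normrM mulrAC ler_wpM2r // h1.
Qed.

Lemma profile_diff t tau : t \in `[0, 1] -> tau \in `[0, 1] ->
  profile Phi 2 (fun s => `|k t s - k tau s|).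
Proof.
move=> t01 tau01; apply: profile_norm.
have [m h] := profile_lin (-1) (kernel_profile tau01) (kernel_profile t01).
split.
  by apply: measurable_funB; [case: (kernel_profile t01)|case: (kernel_profile tau01)].
apply: filterS h => s h s01; have := h s01; rewrite normrN1 mulrN1 addrC mulr1.
by rewrite (_ : 1 + 1 = 2) //; lra.
Qed.

Lemma density1 : density 1 (fun=> 1 : R).
Proof.
split; first exact: measurable_cst.
by apply: aeW => s _; rewrite normr1.
Qed.

(** Continuity at a point is dominated convergence based on C1; Heine's theorem
    for the mean distance of two sections makes it uniform. *)
Lemma kernel_equicontinuous (e : R) : 0 < e -> exists2 d : R, 0 < d &
  forall t tau, t \in `[0, 1] -> tau \in `[0, 1] -> `|t - tau| <= d ->
    \int[leb R]_(s in `[0, 1]) (`|k t s - k tau s| * g s * 1) <= e.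
Proof.
apply: (uniform_on_segment (dist := fun t tau =>
  \int[leb R]_(s in `[0, 1]) (`|k t s - k tau s| * g s * 1))).
- by move=> t s; apply: eq_Rintegral => x _; rewrite distrC.
- move=> r t s r01 t01 s01.
  have ii x y : x \in `[0, 1] -> y \in `[0, 1] ->
      (leb R).-integrable (unit_set R) (EFin \o (fun z : lebType R => `|k x z - k y z| * g z * 1)).
    move=> x01 y01; exact: (integrand_integrable mPhi wint g_ge0 (profile_diff x01 y01) density1).
  rewrite -RintegralD //; try exact: ii.
  apply: ae_le_Rintegral => //; first exact: ii.
    rewrite (_ : EFin \o _ = (fun z => (`|k t z - k r z| * g z * 1)%:E + (`|k r z - k s z| * g z * 1)%:E)%E) //.
    by apply: integrableD => //; exact: ii.
  apply: filterS g_ge0 => z h z01; rewrite !mulr1 -mulrDl ler_wpM2r ?h //.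
  exact: ler_distD.
- move=> tau tau01 e' e'0; apply: contrapT => H.
  have bad (n : nat) : exists t : R, [/\ t \in `[0, 1], `|t - tau| < n.+1%:R^-1 &
      e' < \int[leb R]_(s in `[0, 1]) (`|k t s - k tau s| * g s * 1)].
    apply: contrapT => hn; apply: H; exists n.+1%:R^-1; first by rewrite invr_gt0.
    by move=> t t01 tt; rewrite leNgt; apply/negP => lt; apply: hn; exists t.
  have [t_ ht] := choice bad.
  have t01 n : t_ n \in `[0, 1] by have [] := ht n.
  have tcv : t_ @ \oo --> tau.
    apply/cvgrPdist_lt => d d0; have := @near_infty_natSinv_lt R (PosNum d0).
    apply: filterS => n /= nd; rewrite distrC; have [_ h _] := ht n.
    exact: lt_trans h nd.
  have : \int[leb R]_(s in `[0, 1]) (`|k (t_ n) s - k tau s| * g s * 1) @[n --> \oo] -->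
      \int[leb R]_(s in `[0, 1]) (0 : R).
    apply: (@dominated_Rintegral _ _ _ (leb R) (@leb_complete R) _ (@measurable_unit R)
      (fun n s => `|k (t_ n) s - k tau s| * g s * 1) _ (fun s => 2 * 1 * (g s * Phi s))).
    - by move=> n; exact: (measurable01_integrand mPhi wint (profile_diff (t01 n) tau01) density1).
    - apply: filterS (C1_sequential kC1 tau01) => s h s01.
      have {}h := h s01 _ t01 tcv.
      rewrite -[X in _ --> X](mul0r (g s * 1)); under eq_fun do rewrite -mulrA.
      apply: cvgM; last exact: cvg_cst.
      by rewrite -[X in _ --> X](@normr0 _ R) -(subrr (k tau s)); apply: cvg_norm; apply: cvgB => //; exact: cvg_cst.
    - by move=> n; exact: (integrand_le g_ge0 (profile_diff (t01 n) tau01) density1).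
    - exact: weight_integrable.
  have -> : \int[leb R]_(s in `[0, 1]) (0 : R) = 0 by rewrite /Rintegral integral0.
  move/cvgrPdist_lt => /(_ _ e'0)[n _ /(_ n (leqnn n))].
  have [_ _ lt] := ht n; rewrite /= sub0r normrN => lt2.
  by have := lt_trans lt (le_lt_trans (ler_norm _) lt2); rewrite ltxx.
Qed.

End Kernel.

(** * Stieltjes integrals of the kernel *)

Lemma cvg_norm_le (R : realType) (x_ : nat -> R) (x M : R) :
  x_ @ \oo --> x -> (forall n, `|x_ n| <= M) -> `|x| <= M.
Proof.
move=> xc xM; apply/ler_addgt0Pr => e e0.
move/cvgrPdist_lt: xc => /(_ _ e0)[n _ /(_ n (leqnn n))] /= h.
by have := xM n; have := ler_normD (x - x_ n) (x_ n); rewrite subrK; lra.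
Qed.

Lemma unif_node01 (R : realType) (n i : nat) : (i <= n.+1)%N -> unif_node R n i \in `[0, 1].
Proof.
move=> ni; rewrite in_itv /= /unif_node divr_ge0 ?ler0n //.
by rewrite ler_pdivrMr ?ltr0n // mul1r ler_nat.
Qed.

Section KernelIntegrals.
Variables (R : realType) (k : R -> R -> R) (g Phi : R -> R).
Hypothesis kC1 : C1 k.
Hypothesis mPhi : measurable01 Phi.
Hypothesis kPhi : forall t, t \in `[0, 1] ->
  {ae leb R, forall s, s \in `[0, 1] -> `|k t s| <= Phi s}.
Hypothesis wint : (leb R).-integrable (unit_set R) (EFin \o (fun s : lebType R => g s * Phi s)).
Hypothesis g_ge0 : {ae leb R, forall s, s \in `[0, 1] -> 0 <= g s}.
Variable A : R -> R.
Hypothesis bvA : bounded_variation 0 1 A.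
Hypothesis kA : {ae leb R, forall s, s \in `[0, 1] -> stieltjes_integrable A (fun t => k t s)}.

Let sums (n : nat) (s : R) : R :=
  rsum A (fun t => k t s) n.+1 (unif_node R n) (unif_node R n).

Lemma sums_measurable n : measurable01 (sums n).
Proof.
rewrite /sums /rsum.
rewrite (_ : (fun s => _) = (fun s => \sum_(i < n.+1) k (unif_node R n i) s *
    (A (unif_node R n i.+1) - A (unif_node R n i)))); last first.
  by apply/funext => s; rewrite big_mkord.
apply: measurable_sum => i; apply: measurable_funM; last exact: measurable_cst.
by apply: C1_measurable => //; apply: unif_node01; exact: ltnW.
Qed.

Lemma sums_cvg : {ae leb R, forall s, s \in `[0, 1] -> sums n s @[n --> \oo] --> calK k A s}.
Proof.
apply: filterS kA => s h s01; apply: is_stieltjes_unif.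
exact: stieltjesP (h s01).
Qed.

Lemma sums_bound : exists2 V : R, 0 <= V &
  {ae leb R, forall s, s \in `[0, 1] -> forall n, `|sums n s| <= V * Phi s}.
Proof.
have [V VA] := bounded_variation_dominated bvA.
exists (V 1 - V 0); first exact: le_trans (normr_ge0 _) (VA _ _ (lexx 0) ler01 (lexx 1)).
have : {ae leb R, forall s, forall n, forall i, (i <= n.+1)%N -> s \in `[0, 1] ->
    `|k (unif_node R n i) s| <= Phi s}.
  apply/ae_foralln => n; apply/ae_foralln => i.
  have [ni|ni] := leqP i n.+1; last by apply: aeW => s.
  by apply: filterS (kPhi (unif_node01 R ni)) => s h _.
apply: filterS => s h s01 n; rewrite mulrC.
apply: (rsum_bound VA (@unif_partition R n (n.+1%:R^-1 + 1) (ltr_pwDr ltr01 (lexx _)))).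
by move=> i ni; apply: h => //; exact: ltnW.
Qed.

(** K_A is the limit almost everywhere of Riemann sums of sections of the kernel,
    each bounded by the variation of A times Phi. *)
Lemma calK_profile : exists2 V : R, 0 <= V & profile Phi V (calK k A).
Proof.
have [V V0 hV] := sums_bound; exists V => //; split.
  apply: (@ae_cvg_measurable _ _ _ (leb R) (@leb_complete R) _ (@measurable_unit R) sums).
    exact: sums_measurable.
  exact: sums_cvg.
apply: filterS2 sums_cvg hV => s h1 h2 s01.
by apply: cvg_norm_le (h1 s01) _ => n; exact: h2.
Qed.

Lemma sum_integrals N h (q : nat -> R -> R) (x : nat -> R) n : density N h ->
  (forall i, (i < n)%N -> profile Phi 1 (q i)) ->
  (exists V, profile Phi V (fun s => \sum_(0 <= i < n) q i s * x i)) /\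
  \sum_(0 <= i < n) (\int[leb R]_(s in `[0, 1]) (q i s * g s * h s)) * x i =
    \int[leb R]_(s in `[0, 1]) ((\sum_(0 <= i < n) q i s * x i) * g s * h s).
Proof.
move=> dh; elim: n => [|n IH] pq.
  split.
    exists 0; split; last first.
      apply: filterS (kernel_Phi_ge0 kPhi) => s _ _.
      by rewrite big_geq // normr0 mul0r.
    rewrite (_ : (fun s => _) = cst 0); first exact: measurable_cst.
    by apply/funext => s; rewrite big_geq.
  rewrite big_geq //; transitivity (\int[leb R]_(s in `[0, 1]) (0 : R)).
    by rewrite /Rintegral integral0.
  by apply: eq_Rintegral => s _; rewrite big_geq // !mul0r.
have [|[V pV] IHe] := IH; first by move=> i ni; apply: pq; exact: ltnW.
have pn := pq n (ltnSn n).
have pS := profile_lin (x n) pn pV.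
have sumE s : \sum_(0 <= i < n.+1) q i s * x i = q n s * x n + \sum_(0 <= i < n) q i s * x i.
  by rewrite big_nat_recr //= addrC.
split.
  by exists (1 * `|x n| + V); under eq_fun do rewrite sumE.
rewrite big_nat_recr //= IHe.
have i1 := integrand_integrable mPhi wint g_ge0 pn dh.
have i2 := integrand_integrable mPhi wint g_ge0 pV dh.
rewrite -RintegralZr; [|exact: (@measurable_unit R)|exact: i1].
rewrite -RintegralD; [|exact: (@measurable_unit R)|exact: i2|]; last first.
  rewrite (_ : EFin \o _ = (fun s => (q n s * g s * h s)%:E * (x n)%:E)%E) //.
  exact: integrableZr.
by apply: eq_Rintegral => s _; rewrite sumE; ring.
Qed.

(** The uniform sums of the integral in t are integrals of the uniform sums of the
    kernel; the latter tend to K_A and are dominated by a multiple of Phi. *)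
Lemma stieltjes_integral N h : density N h ->
  {within `[0, 1], continuous (fun t => \int[leb R]_(s in `[0, 1]) (k t s * g s * h s))} ->
  is_stieltjes A (fun t => \int[leb R]_(s in `[0, 1]) (k t s * g s * h s))
    (\int[leb R]_(s in `[0, 1]) (calK k A s * g s * h s)).
Proof.
move=> dh Fc; have [I hI] := continuous_stieltjes bvA Fc.
suff <- : I = \int[leb R]_(s in `[0, 1]) (calK k A s * g s * h s) by [].
have [V V0 hV] := sums_bound.
have E n : rsum A (fun t => \int[leb R]_(s in `[0, 1]) (k t s * g s * h s)) n.+1
    (unif_node R n) (unif_node R n) = \int[leb R]_(s in `[0, 1]) (sums n s * g s * h s).
  apply: (proj2 (sum_integrals (q := fun i => k (unif_node R n i)) _ dh _)) => i ni.
  by apply: (kernel_profile kC1 kPhi); apply: unif_node01; exact: ltnW.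
have hI' : \int[leb R]_(s in `[0, 1]) (sums n s * g s * h s) @[n --> \oo] --> I.
  by move: (is_stieltjes_unif hI); apply: cvg_trans; apply: near_eq_cvg; apply: nearW => n; rewrite E.
have ps n : profile Phi V (sums n).
  split; first exact: sums_measurable.
  by apply: filterS hV => s hs s01; exact: hs.
apply: (cvg_unique _ hI') => //.
apply: (@dominated_Rintegral _ _ _ (leb R) (@leb_complete R) _ (@measurable_unit R)
  (fun n s => sums n s * g s * h s) _ (fun s => V * N * (g s * Phi s))).
- by move=> n; exact: (measurable01_integrand mPhi wint (ps n) dh).
- apply: filterS sums_cvg => s hs s01.
  by under eq_fun do rewrite -mulrA; rewrite -mulrA; apply: cvgM; [exact: hs|exact: cvg_cst].
- by move=> n; exact: (integrand_le g_ge0 (ps n) dh).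
- exact: weight_integrable.
Qed.

End KernelIntegrals.

(** * Comparison of weighted integrals *)

Lemma dist_le_scaled_max (R : realFieldType) (N x y P Q : R) : 0 <= N -> 0 <= x -> 0 <= y ->
  x <= N * P -> y <= N * Q -> `|x - y| <= N * Num.max P Q.
Proof.
move=> N0 x0 y0 xP yQ.
have hP : N * P <= N * Num.max P Q by rewrite ler_wpM2l // le_max lexx.
have hQ : N * Q <= N * Num.max P Q by rewrite ler_wpM2l // le_max lexx orbT.
by rewrite ler_norml; apply/andP; split; lra.
Qed.

Section Comparison.
Variables (R : realType) (g Phi : R -> R).
Hypothesis mPhi : measurable01 Phi.
Hypothesis wint : (leb R).-integrable (unit_set R) (EFin \o (fun s : lebType R => g s * Phi s)).
Hypothesis g_ge0 : {ae leb R, forall s, s \in `[0, 1] -> 0 <= g s}.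
Hypothesis Phi_ge0 : {ae leb R, forall s, s \in `[0, 1] -> 0 <= Phi s}.

Implicit Types (V N : R) (q h : R -> R).

Lemma density_cst (N : R) : 0 <= N -> density N (fun=> N).
Proof.
move=> N0; split; first exact: measurable_cst.
by apply: aeW => s _; rewrite ger0_norm.
Qed.

Lemma densityB N h h' : density N h -> density N h' -> density (N + N) (fun s => h s - h' s).
Proof.
move=> [m1 d1] [m2 d2]; split; first exact: measurable_funB.
apply: filterS2 d1 d2 => s h1 h2 s01.
by apply: (le_trans (ler_normB _ _)); apply: lerD; [exact: h1|exact: h2].
Qed.

Lemma weighted_bound_cst V N q h : 0 <= V -> 0 <= N -> profile Phi V q -> density N h ->
  `|\int[leb R]_(s in `[0, 1]) (q s * g s * h s)| <=
    V * \int[leb R]_(s in `[0, 1]) (Phi s * g s * N).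
Proof.
move=> V0 N0 pq dh; apply: (le_trans (weighted_bound mPhi wint g_ge0 Phi_ge0 V0 pq dh)).
apply: ler_wpM2l => //.
have pPhi := profile_Phi mPhi Phi_ge0.
apply: (weighted_le mPhi wint g_ge0 pPhi pPhi (density_norm dh) (density_cst N0)).
have [_ hN] := dh; apply: filterS2 (filterI Phi_ge0 g_ge0) hN => s [h1 h2] h3 s01.
by apply: ler_wpM2l; [exact: mulr_ge0 (h1 s01) (h2 s01)|exact: h3].
Qed.

Lemma weighted_diff V N q h h' : 0 <= V -> profile Phi V q -> density N h -> density N h' ->
  `|\int[leb R]_(s in `[0, 1]) (q s * g s * h s) - \int[leb R]_(s in `[0, 1]) (q s * g s * h' s)| <=
    V * \int[leb R]_(s in `[0, 1]) (Phi s * g s * `|h s - h' s|).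
Proof.
move=> V0 pq dh dh'.
rewrite -RintegralB; [|exact: (@measurable_unit R)
  |exact: (integrand_integrable mPhi wint g_ge0 pq dh)
  |exact: (integrand_integrable mPhi wint g_ge0 pq dh')].
under eq_Rintegral do rewrite -mulrBr.
exact: (weighted_bound mPhi wint g_ge0 Phi_ge0 V0 pq (densityB dh dh')).
Qed.

Lemma weighted_ge0 V N q h : profile Phi V q -> density N h ->
  {ae leb R, forall s, s \in `[0, 1] -> 0 <= q s} -> (forall s, s \in `[0, 1] -> 0 <= h s) ->
  0 <= \int[leb R]_(s in `[0, 1]) (q s * g s * h s).
Proof.
move=> pq dh q0 h0.
have e0 : \int[leb R]_(s in `[0, 1]) (0 : R) = 0 by rewrite /Rintegral integral0.
rewrite -[leLHS]e0.
apply: ae_le_Rintegral; [exact: (@measurable_unit R)| |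
  exact: (integrand_integrable mPhi wint g_ge0 pq dh)|].
  by rewrite (_ : EFin \o _ = cst 0%E) //; exact: integrable0.
apply: filterS2 g_ge0 q0 => s h1 h2 s01.
by rewrite !mulr_ge0 ?h0 //; [exact: h2|exact: h1].
Qed.

Lemma weighted_sub V N q h x y : {subset `[x, y] <= `[0, 1]} -> profile Phi V q -> density N h ->
  {ae leb R, forall s, s \in `[0, 1] -> 0 <= q s} -> (forall s, s \in `[0, 1] -> 0 <= h s) ->
  \int[leb R]_(s in `[x, y]) (q s * g s * h s) <= \int[leb R]_(s in `[0, 1]) (q s * g s * h s).
Proof.
move=> sub pq dh q0 h0.
have mxy : measurable ([set` `[x, y]] : set (lebType R)) by exact: measurable_itv_leb.
have sxy : [set` `[x, y]] `<=` unit_set R by move=> s; exact: sub.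
have mD : measurable (unit_set R `\` [set` `[x, y]]).
  by apply: measurableD => //; exact: (@measurable_unit R).
have ii := integrand_integrable mPhi wint g_ge0 pq dh.
have -> : \int[leb R]_(s in `[0, 1]) (q s * g s * h s) =
    \int[leb R]_(s in `[x, y]) (q s * g s * h s) +
    \int[leb R]_(s in unit_set R `\` [set` `[x, y]]) (q s * g s * h s).
  rewrite -Rintegral_setU //.
  - by rewrite setDUK.
  - by rewrite setDUK.
  - by apply/disj_setPS => s [h1 [_ h2]].
rewrite lerDl.
have e0 : \int[leb R]_(s in unit_set R `\` [set` `[x, y]]) (0 : R) = 0.
  by rewrite /Rintegral integral0.
rewrite -[leLHS]e0.
apply: ae_le_Rintegral => //.
- by rewrite (_ : EFin \o _ = cst 0%E) //; exact: integrable0.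
- by apply: (integrableS (@measurable_unit R) mD _ ii); exact: subDsetl.
- apply: filterS2 g_ge0 q0 => s h1 h2 [s01 _].
  by rewrite !mulr_ge0 ?h0 //; [exact: h2|exact: h1].
Qed.

Lemma kernel_difference (k k' : R -> R) N h : profile Phi 1 k -> profile Phi 1 k' ->
  profile Phi 2 (fun s => `|k s - k' s|) -> 0 <= N -> density N h ->
  `|\int[leb R]_(s in `[0, 1]) (k s * g s * h s) - \int[leb R]_(s in `[0, 1]) (k' s * g s * h s)| <=
    N * \int[leb R]_(s in `[0, 1]) (`|k s - k' s| * g s * 1).
Proof.
move=> pk pk' pd N0 dh; have d1 := density1 R.
have i1 := integrand_integrable mPhi wint g_ge0 pk dh.
have i2 := integrand_integrable mPhi wint g_ge0 pk' dh.
have i3 := integrand_integrable mPhi wint g_ge0 pd d1.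
have mD := @measurable_unit R.
rewrite -RintegralB // -RintegralZl //.
have ib : (leb R).-integrable (unit_set R) (EFin \o (fun s : lebType R =>
    k s * g s * h s - k' s * g s * h s)).
  rewrite (_ : EFin \o _ = (fun s => (k s * g s * h s)%:E - (k' s * g s * h s)%:E)%E) //.
  exact: integrableB.
apply: (le_trans (le_normr_Rintegral _ ib)) => //.
apply: ae_le_Rintegral => //.
- rewrite (_ : EFin \o _ = (fun s => `|(k s * g s * h s - k' s * g s * h s)%:E|)%E) //.
  exact: (integrable_abse ib).
- rewrite (_ : EFin \o _ = (fun s => N%:E * (`|k s - k' s| * g s * 1)%:E)%E) //.
  exact: integrableZl.
- have [_ hN] := dh; apply: filterS2 g_ge0 hN => s h1 h2 s01.
  rewrite -!mulrA -mulrBl normrM normrM mulr1 (ger0_norm (h1 s01)) [leRHS]mulrCA.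
  by apply: ler_wpM2l => //; rewrite mulrC; apply: ler_wpM2r; [exact: h1|exact: h2].
Qed.

Lemma mass_integrable V q x y : {subset `[x, y] <= `[0, 1]} -> profile Phi V q ->
  (leb R).-integrable [set` `[x, y]] (EFin \o (fun s : lebType R => q s * g s)).
Proof.
move=> sub pq.
have := integrand_integrable_sub mPhi wint g_ge0 sub pq (density1 R).
by rewrite (_ : (fun s : lebType R => q s * g s * 1) = (fun s => q s * g s)) //; apply/funext => s; rewrite mulr1.
Qed.

Lemma mass_scale_integrable V q x y N : {subset `[x, y] <= `[0, 1]} -> profile Phi V q ->
  (leb R).-integrable [set` `[x, y]] (EFin \o (fun s : lebType R => N * (q s * g s))).
Proof.
move=> sub pq; rewrite (_ : EFin \o _ = (fun s => N%:E * (q s * g s)%:E)%E) //.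
by apply: integrableZl; [exact: measurable_itv_leb|exact: (mass_integrable sub pq)].
Qed.

Lemma mass_le V N N' q h x y : {subset `[x, y] <= `[0, 1]} -> profile Phi V q ->
  density N h -> {ae leb R, forall s, s \in `[0, 1] -> 0 <= q s} ->
  {ae leb R, forall s, s \in `[x, y] -> h s <= N'} ->
  \int[leb R]_(s in `[x, y]) (q s * g s * h s) <= N' * \int[leb R]_(s in `[x, y]) (q s * g s).
Proof.
move=> sub pq dh q0 hN; rewrite -RintegralZl; [|exact: measurable_itv_leb|exact: (mass_integrable sub pq)].
apply: ae_le_Rintegral; [exact: measurable_itv_leb|
  exact: (integrand_integrable_sub mPhi wint g_ge0 sub pq dh)|exact: (mass_scale_integrable N' sub pq)|].
apply: filterS2 (filterI g_ge0 q0) hN => s [h1 h2] h3 sxy; have s01 := sub _ sxy.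
by rewrite mulrC; apply: ler_wpM2r; [exact: mulr_ge0 (h2 s01) (h1 s01)|exact: h3].
Qed.

Lemma mass_ge V N N' q h x y : {subset `[x, y] <= `[0, 1]} -> profile Phi V q ->
  density N h -> {ae leb R, forall s, s \in `[0, 1] -> 0 <= q s} ->
  {ae leb R, forall s, s \in `[x, y] -> N' <= h s} ->
  N' * \int[leb R]_(s in `[x, y]) (q s * g s) <= \int[leb R]_(s in `[x, y]) (q s * g s * h s).
Proof.
move=> sub pq dh q0 hN; rewrite -RintegralZl; [|exact: measurable_itv_leb|exact: (mass_integrable sub pq)].
apply: ae_le_Rintegral; [exact: measurable_itv_leb|exact: (mass_scale_integrable N' sub pq)|
  exact: (integrand_integrable_sub mPhi wint g_ge0 sub pq dh)|].
apply: filterS2 (filterI g_ge0 q0) hN => s [h1 h2] h3 sxy; have s01 := sub _ sxy.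
by rewrite mulrC; apply: ler_wpM2l; [exact: mulr_ge0 (h2 s01) (h1 s01)|exact: h3].
Qed.

Lemma mass_ge0 V q x y : {subset `[x, y] <= `[0, 1]} -> profile Phi V q ->
  {ae leb R, forall s, s \in `[0, 1] -> 0 <= q s} ->
  0 <= \int[leb R]_(s in `[x, y]) (q s * g s).
Proof.
move=> sub pq q0.
have e0 : \int[leb R]_(s in `[x, y]) (0 : R) = 0 by rewrite /Rintegral integral0.
rewrite -[leLHS]e0; apply: ae_le_Rintegral;
  [exact: measurable_itv_leb| |exact: (mass_integrable sub pq)|].
  by rewrite (_ : EFin \o _ = cst 0%E) //; exact: integrable0.
apply: filterS2 g_ge0 q0 => s h1 h2 sxy; have s01 := sub _ sxy.
exact: mulr_ge0 (h2 s01) (h1 s01).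
Qed.

Lemma mass_mono V W q q' : profile Phi V q -> profile Phi W q' ->
  {ae leb R, forall s, s \in `[0, 1] -> q s <= q' s} ->
  \int[leb R]_(s in `[0, 1]) (q s * g s) <= \int[leb R]_(s in `[0, 1]) (q' s * g s).
Proof.
move=> pq pq' qq'; have sub : {subset `[0 : R, 1] <= `[0, 1]} by [].
apply: ae_le_Rintegral; [exact: measurable_itv_leb|exact: (mass_integrable sub pq)|
  exact: (mass_integrable sub pq')|].
apply: filterS2 g_ge0 qq' => s h1 h2 s01.
by apply: ler_wpM2r; [exact: h1|exact: h2].
Qed.

Lemma profile_pos V q : profile Phi V q -> profile Phi V (fun s => Num.max (q s) 0).
Proof.
move=> [mq hq]; split; first by apply: measurable_maxr; [exact: mq|exact: measurable_cst].
apply: filterS hq => s h s01; apply: le_trans (h s01).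
by rewrite ger0_norm ?le_max ?lexx ?orbT // ge_max ler_norm normr_ge0.
Qed.

Lemma profile_opp V q : profile Phi V q -> profile Phi V (fun s => - q s).
Proof.
move=> [mq hq]; split; first by apply: measurableT_comp => //; exact: mq.
by apply: filterS hq => s h s01; rewrite normrN h.
Qed.

(** The integral is the difference of two nonnegative ones, from the positive and
    the negative part of q, so its absolute value is at most the larger. This is the
    source of the maximum in condI1. *)
Lemma weighted_abs_le_max V N q h : 0 <= N -> profile Phi V q -> density N h ->
  (forall s, s \in `[0, 1] -> 0 <= h s) -> {ae leb R, forall s, s \in `[0, 1] -> h s <= N} ->
  `|\int[leb R]_(s in `[0, 1]) (q s * g s * h s)| <=
    N * Num.max (\int[leb R]_(s in `[0, 1]) (Num.max (q s) 0 * g s))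
                (\int[leb R]_(s in `[0, 1]) (Num.max (- q s) 0 * g s)).
Proof.
move=> N0 pq dh h0 hN; have sub : {subset `[0 : R, 1] <= `[0, 1]} by [].
have pp := profile_pos pq; have pn := profile_pos (profile_opp pq).
have pos r : {ae leb R, forall s, s \in `[0, 1] -> 0 <= Num.max (r s) 0 :> R}.
  by apply: aeW => s _; rewrite le_max lexx orbT.
have -> : \int[leb R]_(s in `[0, 1]) (q s * g s * h s) =
    \int[leb R]_(s in `[0, 1]) (Num.max (q s) 0 * g s * h s) -
    \int[leb R]_(s in `[0, 1]) (Num.max (- q s) 0 * g s * h s).
  rewrite -RintegralB; [|exact: measurable_itv_leb
    |exact: (integrand_integrable mPhi wint g_ge0 pp dh)
    |exact: (integrand_integrable mPhi wint g_ge0 pn dh)].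
  apply: eq_Rintegral => s _; rewrite -!mulrBl; congr (_ * _ * _).
  case: (leP (q s) 0) => qs; case: (leP (- q s) 0) => qs'; lra.
have i1 := mass_le sub pp dh (pos _) hN; have i2 := mass_le sub pn dh (pos _) hN.
have n1 := weighted_ge0 pp dh (pos _) h0; have n2 := weighted_ge0 pn dh (pos _) h0.
exact: (dist_le_scaled_max N0 n1 n2 i1 i2).
Qed.

End Comparison.

(** * The Hammerstein operator *)

Lemma continuous01_lin (R : realType) (x y : R) (u v : R -> R) :
  {within `[0, 1], continuous u} -> {within `[0, 1], continuous v} ->
  {within `[0, 1], continuous (fun t => x * u t + y * v t)}.
Proof.
move=> /within_continuous01P uc /within_continuous01P vc; apply/within_continuous01P => tau tau01 e e0.
pose q := `|x| + `|y| + 1; have q0 : 0 < q by rewrite ltr_wpDl // addr_ge0.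
have eq0 : 0 < e / q by rewrite divr_gt0.
have [d1 d10 h1] := uc _ tau01 _ eq0; have [d2 d20 h2] := vc _ tau01 _ eq0.
exists (Num.min d1 d2); first by rewrite lt_min d10.
move=> t t01; rewrite lt_min => /andP[td1 td2].
have -> : x * u t + y * v t - (x * u tau + y * v tau) =
  x * (u t - u tau) + y * (v t - v tau) by ring.
apply: (le_trans (ler_normD _ _)); rewrite !normrM.
have := ler_wpM2l (normr_ge0 x) (h1 _ t01 td1); have := ler_wpM2l (normr_ge0 y) (h2 _ t01 td2).
have eE : e = `|x| * (e / q) + `|y| * (e / q) + e / q.
  have -> : `|x| * (e / q) + `|y| * (e / q) + e / q = q * (e / q) by rewrite /q; ring.
  by rewrite mulrC divfK // gt_eqF.
by move=> p1 p2; rewrite [leRHS]eE; lra.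
Qed.

(** Three integrals that vary by at most e, weighted by bounded coefficients.
    Applied with the roles of x, y and of p, q exchanged it also handles varying
    coefficients of fixed integrals. *)
Lemma dist_combination (R : realFieldType) (x y p p' q q' r r' X Y e : R) :
  `|x| <= X -> `|y| <= Y -> `|p - p'| <= e -> `|q - q'| <= e -> `|r - r'| <= e ->
  `|x * p + y * q + r - (x * p' + y * q' + r')| <= (X + Y + 1) * e.
Proof.
move=> xX yY pp qq rr.
have -> : x * p + y * q + r - (x * p' + y * q' + r') = x * (p - p') + y * (q - q') + (r - r') by ring.
rewrite !mulrDl mul1r; apply: (le_trans (ler_normD _ _)); apply: lerD => //.
by apply: (le_trans (ler_normD _ _)); rewrite !normrM; apply: lerD; apply: ler_pM.
Qed.

Section Hammerstein.
Variables (R : realType) (k : R -> R -> R) (g : R -> R)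
    (f : R -> R -> R) (gamma delta A B Phi : R -> R) (a b c1 c2 c3 : R).
Hypotheses (hC1 : C1 k) (hC2 : C2 k Phi a b c1) (hC3 : C3 g Phi a b) (hC4 : C4 f)
  (hC5 : C5 k A B) (hC6 : C6 A B gamma a b c2) (hC7 : C7 A B delta a b c3)
  (hC8 : 0 < detD A B gamma delta).

Let c := Num.min c1 (Num.min c2 c3).
Let D := detD A B gamma delta.
Let ag := stieltjes A gamma.
Let bg := stieltjes B gamma.
Let ad := stieltjes A delta.
Let bd := stieltjes B delta.

Let a0 : 0 <= a. Proof. by case: hC2 => -[]. Qed.
Let ab : a <= b. Proof. by case: hC2 => -[]. Qed.
Let b1 : b <= 1. Proof. by case: hC2 => -[]. Qed.
Let mPhi : measurable01 Phi. Proof. by case: hC2 => _ [[]]. Qed.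
Let kPhi t : t \in `[0, 1] -> {ae leb R, forall s, s \in `[0, 1] -> `|k t s| <= Phi s}.
Proof. by case: hC2 => _ [_ _ h _]; exact: h. Qed.
Let wint : (leb R).-integrable (unit_set R) (EFin \o (fun s : lebType R => g s * Phi s)).
Proof. by case: hC3. Qed.
Let g_ge0 : {ae leb R, forall s, s \in `[0, 1] -> 0 <= g s}.
Proof. by case: hC3. Qed.
Let Phi_ge0 := kernel_Phi_ge0 kPhi.
Let c_gt0 : 0 < c.
Proof.
have [_ [_ /andP[h1 _] _ _]] := hC2; have [_ [_ _ /andP[h2 _] _]] := hC6.
by have [_ [_ _ /andP[h3 _] _]] := hC7; rewrite !lt_min h1 h2 h3.
Qed.
Let cc1 : c <= c1. Proof. by rewrite ge_min lexx. Qed.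
Let cc2 : c <= c2. Proof. by rewrite !ge_min lexx orbT. Qed.
Let cc3 : c <= c3. Proof. by rewrite !ge_min lexx !orbT. Qed.
Let c_le1 : c <= 1.
Proof. by have [_ [_ /andP[_ h1] _ _]] := hC2; exact: le_trans h1. Qed.
Let sub01 : {subset `[a, b] <= `[0, 1]}.
Proof. by move=> t tab; exact: (sub_ab a0 b1 tab). Qed.

Let gc : {within `[0, 1], continuous gamma}. Proof. by case: hC6. Qed.
Let dc : {within `[0, 1], continuous delta}. Proof. by case: hC7. Qed.
Let ag01 : 0 <= ag < 1. Proof. by case: hC6 => _ []. Qed.
Let bg0 : 0 <= bg. Proof. by case: hC6 => _ []. Qed.
Let bd01 : 0 <= bd < 1. Proof. by case: hC7 => _ []. Qed.
Let ad0 : 0 <= ad. Proof. by case: hC7 => _ []. Qed.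

(** [cA] and [cB] multiply alpha[F u] and beta[F u] once alpha[u] and beta[u] have
    been eliminated by Cramer's rule. *)
Let cA (t : R) := gamma t / D * (1 - bd) + delta t / D * bg.
Let cB (t : R) := gamma t / D * ad + delta t / D * (1 - ag).

Let density_of (X : R -> R) (u : R -> R) : R :=
  \int[leb R]_(s in `[0, 1]) (calK k X s * g s * f s (u s)).
Let F (u : R -> R) (t : R) : R := \int[leb R]_(s in `[0, 1]) (k t s * g s * f s (u s)).

Definition hammerstein (u : R -> R) (t : R) : R :=
  cA t * density_of A u + cB t * density_of B u + F u t.

Let S := hammerstein.
Let Ball (M : R) (u : R -> R) : Prop := measurable01 u /\ bounded01 M u.

Let kA : {ae leb R, forall s, s \in `[0, 1] -> stieltjes_integrable A (fun t => k t s)}.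
Proof. by case: hC5 => _ _ h _; apply: filterS h => s h /h[]. Qed.
Let kB : {ae leb R, forall s, s \in `[0, 1] -> stieltjes_integrable B (fun t => k t s)}.
Proof. by case: hC5 => _ _ _ h; apply: filterS h => s h /h[]. Qed.
Let kA0 : {ae leb R, forall s, s \in `[0, 1] -> 0 <= calK k A s}.
Proof. by case: hC5 => _ _ h _; apply: filterS h => s h /h[]. Qed.
Let kB0 : {ae leb R, forall s, s \in `[0, 1] -> 0 <= calK k B s}.
Proof. by case: hC5 => _ _ _ h; apply: filterS h => s h /h[]. Qed.
Let bvA : bounded_variation 0 1 A. Proof. by case: hC5. Qed.
Let bvB : bounded_variation 0 1 B. Proof. by case: hC5. Qed.
Let profA : exists2 V : R, 0 <= V & profile Phi V (calK k A) := calK_profile hC1 kPhi bvA kA.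
Let profB : exists2 V : R, 0 <= V & profile Phi V (calK k B) := calK_profile hC1 kPhi bvB kB.

Let nem0 u s : s \in `[0, 1] -> 0 <= f s (u s).
Proof. exact: (nemytskii_ge0 hC4 u). Qed.

Let F_equi M : equicontinuous_on (Ball M) F.
Proof.
have [N N0 dens] := nemytskii_density hC4 M.
move=> e e0.
have [d d0 hd] := kernel_equicontinuous hC1 mPhi kPhi wint g_ge0 (divr_gt0 e0 (ltr_wpDl N0 ltr01)).
exists d => // u [mu uM] t tau t01 tau01 td.
apply: (le_trans (kernel_difference mPhi wint g_ge0 (kernel_profile hC1 kPhi t01)
  (kernel_profile hC1 kPhi tau01) (profile_diff hC1 kPhi t01 tau01) N0 (dens _ mu uM))).
apply: (le_trans (ler_wpM2l N0 (hd _ _ t01 tau01 td))).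
rewrite mulrCA -[leRHS]mulr1; apply: ler_wpM2l; first exact: ltW.
by rewrite ler_pdivrMr ?mul1r; lra.
Qed.

Let Fcont M u : Ball M u -> {within `[0, 1], continuous (F u)}.
Proof.
move=> Bu; apply/within_continuous01P => tau tau01 e e0.
by have [d d0 hd] := F_equi M e0; exists d => // t t01 /ltW; exact: hd.
Qed.

Let cA_cont : {within `[0, 1], continuous cA}.
Proof.
rewrite (_ : cA = fun t => (1 - bd) / D * gamma t + bg / D * delta t).
  exact: continuous01_lin.
by apply/funext => t; rewrite /cA; ring.
Qed.
Let cB_cont : {within `[0, 1], continuous cB}.
Proof.
rewrite (_ : cB = fun t => ad / D * gamma t + (1 - ag) / D * delta t).
  exact: continuous01_lin.
by apply/funext => t; rewrite /cB; ring.
Qed.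

Let density_ge0A M u : Ball M u -> 0 <= density_of A u.
Proof.
move=> [mu uM]; have [V V0 pV] := profA; have [N N0 dens] := nemytskii_density hC4 M.
by apply: (weighted_ge0 mPhi wint g_ge0 pV (dens _ mu uM) kA0) => s; exact: nem0.
Qed.
Let density_ge0B M u : Ball M u -> 0 <= density_of B u.
Proof.
move=> [mu uM]; have [V V0 pV] := profB; have [N N0 dens] := nemytskii_density hC4 M.
by apply: (weighted_ge0 mPhi wint g_ge0 pV (dens _ mu uM) kB0) => s; exact: nem0.
Qed.

Let integrals_bounded M : exists2 N : R, 0 <= N & forall u, Ball M u ->
  [/\ `|density_of A u| <= N, `|density_of B u| <= N & bounded01 N (F u)].
Proof.
have [VA VA0 pA] := profA; have [VB VB0 pB] := profB.
have [N N0 dens] := nemytskii_density hC4 M.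
pose W := \int[leb R]_(s in `[0, 1]) (Phi s * g s * N).
have W0 : 0 <= W.
  by apply: (weighted_ge0 mPhi wint g_ge0 (profile_Phi mPhi Phi_ge0) (density_cst N0) Phi_ge0).
exists (VA * W + VB * W + 1 * W); first by rewrite !addr_ge0 ?mulr_ge0.
have AW : 0 <= VA * W by rewrite mulr_ge0.
have BW : 0 <= VB * W by rewrite mulr_ge0.
move=> u [mu uM]; have du := dens _ mu uM.
have hA := weighted_bound_cst mPhi wint g_ge0 Phi_ge0 VA0 N0 pA du.
have hB := weighted_bound_cst mPhi wint g_ge0 Phi_ge0 VB0 N0 pB du.
split.
- by apply: (le_trans hA); rewrite -addrA lerDl addr_ge0 // mul1r.
- by apply: (le_trans hB); rewrite addrAC lerDr addr_ge0 // mul1r.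
- move=> t t01.
  apply: le_trans (weighted_bound_cst mPhi wint g_ge0 Phi_ge0 ler01 N0 (kernel_profile hC1 kPhi t01) du) _.
  by rewrite lerDr addr_ge0.
Qed.

Let integrals_unif M (e : R) : 0 < e -> exists2 d : R, 0 < d & forall u v, Ball M u -> Ball M v ->
  (forall t, t \in `[0, 1] -> `|u t - v t| <= d) ->
  [/\ `|density_of A u - density_of A v| <= e, `|density_of B u - density_of B v| <= e &
      forall t, t \in `[0, 1] -> `|F u t - F v t| <= e].
Proof.
move=> e0; have [VA VA0 pA] := profA; have [VB VB0 pB] := profB.
have [N N0 dens] := nemytskii_density hC4 M.
pose V := VA + VB + 1; have V0 : 0 < V by rewrite /V; lra.
have [d d0 hd] := nemytskii_uniform hC4 M mPhi wint g_ge0 Phi_ge0 (divr_gt0 e0 V0).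
exists d => // u v [mu uM] [mv vM] uv; have E := hd _ _ mu uM mv vM uv.
have du := dens _ mu uM; have dv := dens _ mv vM.
have key V' : 0 <= V' -> V' <= V ->
    V' * \int[leb R]_(s in `[0, 1]) (Phi s * g s * `|f s (u s) - f s (v s)|) <= e.
  move=> V'0 V'V; apply: (le_trans (ler_wpM2l V'0 E)).
  by rewrite mulrCA -[leRHS]mulr1; apply: ler_wpM2l; [exact: ltW|rewrite ler_pdivrMr // mul1r].
split.
- apply: (le_trans (weighted_diff mPhi wint g_ge0 Phi_ge0 VA0 pA du dv)); apply: key => //.
  by rewrite /V; lra.
- apply: (le_trans (weighted_diff mPhi wint g_ge0 Phi_ge0 VB0 pB du dv)); apply: key => //.
  by rewrite /V; lra.
- move=> t t01.
  apply: (le_trans (weighted_diff mPhi wint g_ge0 Phi_ge0 ler01 (kernel_profile hC1 kPhi t01) du dv)).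
  by apply: key; rewrite ?ler01 // /V; lra.
Qed.

Let S_bounded M : exists N, forall u, Ball M u -> bounded01 N (S u).
Proof.
have [N N0 hN] := integrals_bounded M.
have [MA MA0 hA] := continuous_bounded01 cA_cont; have [MB MB0 hB] := continuous_bounded01 cB_cont.
exists (MA * N + MB * N + N) => u /hN[h1 h2 h3] t t01.
apply: (le_trans (ler_normD _ _)); apply: lerD; last exact: h3.
apply: (le_trans (ler_normD _ _)); rewrite !normrM; apply: lerD; apply: ler_pM => //.
  exact: hA.
exact: hB.
Qed.

Let S_unif M : unif_continuous_on (Ball M) S.
Proof.
have [MA MA0 hA] := continuous_bounded01 cA_cont; have [MB MB0 hB] := continuous_bounded01 cB_cont.
move=> e e0; pose V := MA + MB + 1; have V0 : 0 < V by rewrite /V; lra.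
have [d d0 hd] := integrals_unif M (divr_gt0 e0 V0).
exists d => // u v Bu Bv uv t t01; have [h1 h2 h3] := hd _ _ Bu Bv uv.
apply: (le_trans (dist_combination (hA _ t01) (hB _ t01) h1 h2 (h3 _ t01))).
by rewrite -/V mulrC divfK // gt_eqF.
Qed.

Let S_equi M : equicontinuous_on (Ball M) S.
Proof.
have [N N0 hN] := integrals_bounded M.
move=> e e0; pose e' := e / (N + N + 1).
have N1 : 0 < N + N + 1 by lra.
have e'0 : 0 < e' by rewrite divr_gt0.
have [d1 d10 h1] := continuous_unif01 cA_cont e'0.
have [d2 d20 h2] := continuous_unif01 cB_cont e'0.
have [d3 d30 h3] := F_equi M e'0.
exists (Num.min d1 (Num.min d2 d3)); first by rewrite !lt_min d10 d20.
move=> u Bu t s t01 s01; rewrite !le_min => /and3P[ts1 ts2 ts3].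
have [b1' b2' b3'] := hN _ Bu.
rewrite /S /hammerstein (mulrC (cA t)) (mulrC (cB t)) (mulrC (cA s)) (mulrC (cB s)).
apply: (le_trans (dist_combination b1' b2' (h1 _ _ t01 s01 ts1) (h2 _ _ t01 s01 ts2)
  (h3 _ Bu _ _ t01 s01 ts3))).
by rewrite mulrC divfK // gt_eqF.
Qed.

Let gamma_cone t s : t \in `[a, b] -> s \in `[0, 1] -> c * `|gamma s| <= gamma t.
Proof.
move=> tab s01; have [_ [_ _ _ h]] := hC6; apply: le_trans (h _ tab).
have [M _ gM] := continuous_bounded01 gc.
by apply: ler_pM => //; [exact: ltW|exact: (norm01_ge gM s01)].
Qed.
Let delta_cone t s : t \in `[a, b] -> s \in `[0, 1] -> c * `|delta s| <= delta t.
Proof.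
move=> tab s01; have [_ [_ _ _ h]] := hC7; apply: le_trans (h _ tab).
have [M _ gM] := continuous_bounded01 dc.
by apply: ler_pM => //; [exact: ltW|exact: (norm01_ge gM s01)].
Qed.

Let absA (t : R) := `|gamma t| / D * (1 - bd) + `|delta t| / D * bg.
Let absB (t : R) := `|gamma t| / D * ad + `|delta t| / D * (1 - ag).

Let bd1 : 0 <= 1 - bd. Proof. by rewrite subr_ge0 ltW //; case/andP: bd01. Qed.
Let ag1 : 0 <= 1 - ag. Proof. by rewrite subr_ge0 ltW //; case/andP: ag01. Qed.
Let D0 : 0 <= D^-1. Proof. by rewrite invr_ge0 ltW. Qed.

Let abs_le (x y p q : R) : 0 <= p -> 0 <= q ->
  `|x / D * p + y / D * q| <= `|x| / D * p + `|y| / D * q.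
Proof.
move=> p0 q0; apply: (le_trans (ler_normD _ _)).
by rewrite !normrM (ger0_norm p0) (ger0_norm q0) (ger0_norm D0).
Qed.
Let cA_abs t : `|cA t| <= absA t. Proof. exact: abs_le. Qed.
Let cB_abs t : `|cB t| <= absB t. Proof. exact: abs_le. Qed.

Let cone_coef t s (p q : R) : t \in `[a, b] -> s \in `[0, 1] -> 0 <= p -> 0 <= q ->
  c * (`|gamma s| / D * p + `|delta s| / D * q) <= gamma t / D * p + delta t / D * q.
Proof.
move=> tab s01 p0 q0; rewrite mulrDr !mulrA; apply: lerD.
  by do 2 apply: ler_wpM2r => //; exact: gamma_cone.
by do 2 apply: ler_wpM2r => //; exact: delta_cone.
Qed.

Let k_lower t : t \in `[a, b] -> {ae leb R, forall s, s \in `[0, 1] -> c1 * Phi s <= k t s}.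
Proof. by case: hC2 => _ [_ _ _ h]; exact: h. Qed.
Let k_ge0 t : t \in `[a, b] -> {ae leb R, forall s, s \in `[0, 1] -> 0 <= k t s}.
Proof.
move=> tab; apply: filterS2 (k_lower tab) Phi_ge0 => s h1 h2 s01.
apply: le_trans (h1 s01); apply: mulr_ge0 (h2 s01).
exact: le_trans (ltW c_gt0) cc1.
Qed.

(** F u on [a,b] is at least c1, and F u anywhere at most 1, times the integral of
    Phi g f(s,u(s)). *)
Let F_cone M u t s : Ball M u -> t \in `[a, b] -> s \in `[0, 1] -> c * `|F u s| <= F u t.
Proof.
move=> [mu uM] tab s01; have [N N0 dens] := nemytskii_density hC4 M.
have du := dens _ mu uM; have t01 := sub01 tab.
have pPhi := profile_Phi mPhi Phi_ge0.
have c10 : 0 <= c1 := le_trans (ltW c_gt0) cc1.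
pose J := \int[leb R]_(s in `[0, 1]) (Phi s * g s * `|f s (u s)|).
have J0 : 0 <= J.
  by apply: (weighted_ge0 mPhi wint g_ge0 pPhi (density_norm du) Phi_ge0) => z _; exact: normr_ge0.
have hs : `|F u s| <= 1 * J :=
  weighted_bound mPhi wint g_ge0 Phi_ge0 ler01 (kernel_profile hC1 kPhi s01) du.
apply: (@le_trans _ _ (c1 * J)).
  by rewrite mul1r in hs; apply: ler_pM => //; exact: ltW.
rewrite -RintegralZl; [|exact: measurable_itv_leb
  |exact: (integrand_integrable mPhi wint g_ge0 pPhi (density_norm du))].
apply: ae_le_Rintegral; [exact: measurable_itv_leb| |
  exact: (integrand_integrable mPhi wint g_ge0 (kernel_profile hC1 kPhi t01) du)|].
  rewrite (_ : EFin \o _ = (fun s => c1%:E * (Phi s * g s * `|f s (u s)|)%:E)%E) //.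
  apply: integrableZl; first exact: measurable_itv_leb.
  exact: (integrand_integrable mPhi wint g_ge0 pPhi (density_norm du)).
apply: filterS2 (k_lower tab) g_ge0 => z h1 h2 z01.
rewrite (ger0_norm (nem0 u z01)) !mulrA; apply: ler_wpM2r; first exact: nem0.
by apply: ler_wpM2r; [exact: h2|exact: h1].
Qed.

Let S_cone M u : Ball M u -> cone0 a b c (S u).
Proof.
move=> Bu t s tab s01; have dA := density_ge0A Bu; have dB := density_ge0B Bu.
have hF := F_cone Bu tab s01.
rewrite /S /hammerstein.
apply: (@le_trans _ _ (c * absA s * density_of A u + c * absB s * density_of B u + c * `|F u s|)).
  rewrite -!mulrA -!mulrDr; apply: ler_wpM2l; first exact: ltW.
  apply: (le_trans (ler_normD _ _)); rewrite lerD2r.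
  apply: (le_trans (ler_normD _ _)); rewrite !normrM (ger0_norm dA) (ger0_norm dB).
  by apply: lerD; apply: ler_wpM2r.
by apply: lerD hF; apply: lerD; apply: ler_wpM2r => //; exact: cone_coef.
Qed.

(** By Cramer's rule [P_of u] and [Q_of u] are the values of alpha and beta at a
    fixed point u; see [fixed_point_functionals]. *)
Let P_of u := (density_of A u * (1 - bd) + density_of B u * ad) / D.
Let Q_of u := (density_of A u * bg + density_of B u * (1 - ag)) / D.

Let S_split u t : S u t = P_of u * gamma t + 1 * (Q_of u * delta t + 1 * F u t).
Proof.
rewrite /S /hammerstein /cA /cB /P_of /Q_of.
by move: (density_of A u) (density_of B u) (F u t) => *; ring.
Qed.

Let S_stieltjes (X : R -> R) (x y n : R) u : is_stieltjes X gamma x -> is_stieltjes X delta y ->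
  is_stieltjes X (F u) n -> is_stieltjes X (S u) (P_of u * x + 1 * (Q_of u * y + 1 * n)).
Proof.
move=> hx hy hn.
apply: is_stieltjes_ext (is_stieltjes_lin (P_of u) 1 hx (is_stieltjes_lin (Q_of u) 1 hy hn)).
by move=> t _; rewrite S_split.
Qed.

Let F_stieltjesA M u : Ball M u -> is_stieltjes A (F u) (density_of A u).
Proof.
move=> Bu; have [mu uM] := Bu; have [N N0 dens] := nemytskii_density hC4 M.
exact: (stieltjes_integral hC1 mPhi kPhi wint g_ge0 bvA kA (dens _ mu uM) (Fcont Bu)).
Qed.
Let F_stieltjesB M u : Ball M u -> is_stieltjes B (F u) (density_of B u).
Proof.
move=> Bu; have [mu uM] := Bu; have [N N0 dens] := nemytskii_density hC4 M.
exact: (stieltjes_integral hC1 mPhi kPhi wint g_ge0 bvB kB (dens _ mu uM) (Fcont Bu)).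
Qed.

Let D_neq0 : D != 0. Proof. by rewrite gt_eqF. Qed.
Let DE : D = (1 - ag) * (1 - bd) - ad * bg. Proof. by []. Qed.

Let alpha_eq (x y p q d : R) : d = (1 - p) * (1 - y) - q * x -> d != 0 ->
  forall m n, (m * (1 - y) + n * q) / d * p + 1 * ((m * x + n * (1 - p)) / d * q + 1 * m) =
    (m * (1 - y) + n * q) / d.
Proof. by move=> dE d0 m n; rewrite dE; field; rewrite -dE. Qed.
Let beta_eq (x y p q d : R) : d = (1 - p) * (1 - y) - q * x -> d != 0 ->
  forall m n, (m * (1 - y) + n * q) / d * x + 1 * ((m * x + n * (1 - p)) / d * y + 1 * n) =
    (m * x + n * (1 - p)) / d.
Proof. by move=> dE d0 m n; rewrite dE; field; rewrite -dE. Qed.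

Let fixed_point_functionals M u : Ball M u -> (forall t, t \in `[0, 1] -> S u t = u t) ->
  stieltjes A u = P_of u /\ stieltjes B u = Q_of u.
Proof.
move=> Bu fixu.
have gA := stieltjesP (continuous_stieltjes bvA gc).
have gB := stieltjesP (continuous_stieltjes bvB gc).
have dA := stieltjesP (continuous_stieltjes bvA dc).
have dB := stieltjesP (continuous_stieltjes bvB dc).
split; apply: stieltjesE.
  apply: is_stieltjes_ext fixu _.
  have := S_stieltjes gA dA (F_stieltjesA Bu).
  by rewrite -/ag -/ad (alpha_eq DE D_neq0).
apply: is_stieltjes_ext fixu _.
have := S_stieltjes gB dB (F_stieltjesB Bu).
by rewrite -/bg -/bd (beta_eq DE D_neq0).
Qed.

Let fixed_point_solution (u : R -> R) : {within `[0, 1], continuous u} -> cone0 a b c u ->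
  (forall t, t \in `[0, 1] -> S u t = u t) ->
  cone A B a b c u /\ is_solution k g f gamma delta A B u.
Proof.
move=> uc Ku fixu; have [M _ uM] := continuous_bounded01 uc.
have Bu : Ball M u by split=> //; exact: continuous_measurable01.
have [eA eB] := fixed_point_functionals Bu fixu.
have dA := density_ge0A Bu; have dB := density_ge0B Bu.
split; last first.
  move=> t t01; rewrite -[LHS](fixu _ t01) S_split eA eB !mul1r addrA.
  by rewrite (mulrC (P_of u)) (mulrC (Q_of u)).
split=> //.
- rewrite mulrC -ler_pdivlMr //; apply: norm01_le => t t01.
  by rewrite ler_pdivlMr // mulrC; exact: (cone0_norm_min ab Ku t01).
- by rewrite eA; apply: mulr_ge0 D0; rewrite addr_ge0 // mulr_ge0.
- by rewrite eB; apply: mulr_ge0 D0; rewrite addr_ge0 // mulr_ge0.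
Qed.

Let mass (q : R -> R) (x y : R) : R := \int[leb R]_(s in `[x, y]) (q s * g s).
Let sub_unit : {subset `[0 : R, 1] <= `[0, 1]}. Proof. by []. Qed.

Let massA0 (x y : R) : {subset `[x, y] <= `[0, 1]} -> 0 <= mass (calK k A) x y.
Proof. by move=> sub; have [V _ pA] := profA; exact: (mass_ge0 mPhi wint g_ge0 sub pA kA0). Qed.
Let massB0 (x y : R) : {subset `[x, y] <= `[0, 1]} -> 0 <= mass (calK k B) x y.
Proof. by move=> sub; have [V _ pB] := profB; exact: (mass_ge0 mPhi wint g_ge0 sub pB kB0). Qed.

(** The bracket in condI1; [inf_load] is the one in condI0. *)
Let sup_load (t : R) : R := absA t * mass (calK k A) 0 1 + absB t * mass (calK k B) 0 1 +
  Num.max (mass (fun s => Num.max (k t s) 0) 0 1) (mass (fun s => Num.max (- k t s) 0) 0 1).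
Let inf_load (t : R) : R :=
  cA t * mass (calK k A) a b + cB t * mass (calK k B) a b + mass (k t) a b.

Let absA0 (t : R) : 0 <= absA t. Proof. exact: le_trans (cA_abs t). Qed.
Let absB0 (t : R) : 0 <= absB t. Proof. exact: le_trans (cB_abs t). Qed.
Let cA0 (t : R) : t \in `[a, b] -> 0 <= cA t.
Proof.
move=> tab; apply: le_trans (cone_coef tab (sub01 tab) bd1 bg0).
by apply: mulr_ge0; [exact: ltW|exact: absA0].
Qed.
Let cB0 (t : R) : t \in `[a, b] -> 0 <= cB t.
Proof.
move=> tab; apply: le_trans (cone_coef tab (sub01 tab) ad0 ag1).
by apply: mulr_ge0; [exact: ltW|exact: absB0].
Qed.

Let max_mass_ge0 (t : R) : t \in `[0, 1] ->
  0 <= Num.max (mass (fun s => Num.max (k t s) 0) 0 1) (mass (fun s => Num.max (- k t s) 0) 0 1).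
Proof.
move=> t01; rewrite le_max; apply/orP; left.
apply: (mass_ge0 mPhi wint g_ge0 sub_unit (profile_pos (kernel_profile hC1 kPhi t01))).
by apply: aeW => s _; rewrite le_max lexx orbT.
Qed.

Let mass_part_le (q : R -> R) : profile Phi 1 q ->
  mass (fun s => Num.max (q s) 0) 0 1 <= mass Phi 0 1.
Proof.
move=> pq; have [_ hq] := pq.
apply: (mass_mono mPhi wint g_ge0 (profile_pos pq) (profile_Phi mPhi Phi_ge0)).
apply: filterS2 hq Phi_ge0 => s h1 h2 s01; rewrite ge_max h2 // andbT.
by apply: (le_trans (ler_norm _)); rewrite -[leRHS]mul1r; exact: h1.
Qed.

Let sup_load_ubound : has_ubound [set sup_load t | t in `[0, 1]].
Proof.
have [MA _ hA] := continuous_bounded01 gc; have [MB _ hB] := continuous_bounded01 dc.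
exists ((MA / D * (1 - bd) + MB / D * bg) * mass (calK k A) 0 1 +
  (MA / D * ad + MB / D * (1 - ag)) * mass (calK k B) 0 1 + mass Phi 0 1).
have le2 (t p q : R) : t \in `[0, 1] -> 0 <= p -> 0 <= q ->
    `|gamma t| / D * p + `|delta t| / D * q <= MA / D * p + MB / D * q.
  move=> t01 p0 q0; apply: lerD; do 2 apply: ler_wpM2r => //; [exact: hA|exact: hB].
move=> _ [t t01 <-]; apply: lerD; first apply: lerD.
- by apply: ler_wpM2r; [exact: massA0|exact: le2].
- by apply: ler_wpM2r; [exact: massB0|exact: le2].
- have pk := kernel_profile hC1 kPhi t01.
  by rewrite ge_max (mass_part_le pk) (mass_part_le (profile_opp pk)).
Qed.

Let sup_load_ge0 (t : R) : t \in `[0, 1] -> 0 <= sup_load t.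
Proof.
move=> t01; apply: addr_ge0 (max_mass_ge0 t01).
by apply: addr_ge0; apply: mulr_ge0; rewrite ?absA0 ?absB0 ?massA0 ?massB0.
Qed.

Let inf_load_ge0 (t : R) : t \in `[a, b] -> 0 <= inf_load t.
Proof.
move=> tab; apply: addr_ge0.
  by apply: addr_ge0; apply: mulr_ge0; rewrite ?cA0 ?cB0 ?massA0 ?massB0.
exact: (mass_ge0 mPhi wint g_ge0 sub01 (kernel_profile hC1 kPhi (sub01 tab)) (k_ge0 tab)).
Qed.

Let sum_scale (x y p q r m p' q' r' : R) : 0 <= x -> 0 <= y -> p <= m * p' -> q <= m * q' ->
  r <= m * r' -> x * p + y * q + r <= m * (x * p' + y * q' + r').
Proof.
move=> x0 y0 h1 h2 h3; rewrite !mulrDr; apply: lerD h3.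
by apply: lerD; rewrite mulrCA; exact: ler_wpM2l.
Qed.
Let scale_sum (x y p q r m p' q' r' : R) : 0 <= x -> 0 <= y -> m * p' <= p -> m * q' <= q ->
  m * r' <= r -> m * (x * p' + y * q' + r') <= x * p + y * q + r.
Proof.
move=> x0 y0 h1 h2 h3; rewrite !mulrDr; apply: lerD h3.
by apply: lerD; rewrite mulrCA; exact: ler_wpM2l.
Qed.

(** For |u| <= r the density f(s,u(s)) is at most m r with m times the supremum of
    the bracket below 1. *)
Lemma condI1_contracts (r : R) : 0 < r -> condI1 k g f gamma delta A B r ->
  contracts_at (@measurable01 R) hammerstein r.
Proof.
move=> r0 hI; pose X := sup [set sup_load t | t in `[0, 1]].
have zero_in : (0 : R) \in `[0, 1] by rewrite in_itv /= lexx ler01.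
have leX (t : R) : t \in `[0, 1] -> sup_load t <= X.
  by move=> t01; apply: (ub_le_sup sup_load_ubound); exists t.
have X0 : 0 <= X := le_trans (sup_load_ge0 zero_in) (leX _ zero_in).
have [m [m0 mX hm]] := ess_supf_bound hC4 r0 (hI : (ess_supf f r * X%:E < 1)%E) X0.
exists (m * r * X); first by rewrite mulrAC gtr_pMl.
move=> u [mu ur] t t01; have [N N0 dens] := nemytskii_density hC4 r.
have mr0 : 0 <= m * r by rewrite mulr_ge0 // ltW.
have fm : {ae leb R, forall s, s \in `[0, 1] -> f s (u s) <= m * r}.
  by apply: filterS hm => s h s01; apply: h => //; rewrite in_itv /= -ler_norml ur.
have du : density (m * r) (fun s => f s (u s)).
  have [mf _] := dens _ mu ur; split => //.
  by apply: filterS fm => s h s01; rewrite ger0_norm ?nem0 // h.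
have Bu : Ball r u by [].
have [VA _ pA] := profA; have [VB _ pB] := profB.
have hA : density_of A u <= m * r * mass (calK k A) 0 1.
  exact: (mass_le mPhi wint g_ge0 sub_unit pA du kA0 fm).
have hB : density_of B u <= m * r * mass (calK k B) 0 1.
  exact: (mass_le mPhi wint g_ge0 sub_unit pB du kB0 fm).
have hF := weighted_abs_le_max mPhi wint g_ge0 mr0 (kernel_profile hC1 kPhi t01) du
  (fun s => @nem0 u s) fm.
apply: (@le_trans _ _ (m * r * sup_load t)); last by apply: ler_wpM2l => //; exact: leX.
apply: le_trans (sum_scale (absA0 t) (absB0 t) hA hB hF).
apply: (le_trans (ler_normD _ _)); rewrite lerD2r.
apply: (le_trans (ler_normD _ _)).
rewrite !normrM (ger0_norm (density_ge0A Bu)) (ger0_norm (density_ge0B Bu)).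
by apply: lerD; apply: ler_wpM2r; rewrite ?(density_ge0A Bu) ?(density_ge0B Bu).
Qed.

(** On [a,b] the coefficients and the kernel are nonnegative, so the integrals may
    be restricted to [a,b], where r <= u <= r/c and the density is at least m r. *)
Lemma condI0_expands (r : R) : 0 < r -> condI0 k g f gamma delta A B a b c r ->
  expands_at a b c (@measurable01 R) hammerstein r.
Proof.
move=> r0 hI; pose X := inf [set inf_load t | t in `[a, b]].
have lb0 : lbound [set inf_load t | t in `[a, b]] 0.
  by move=> _ [t tab <-]; exact: inf_load_ge0.
have leX (t : R) : t \in `[a, b] -> X <= inf_load t.
  by move=> tab; apply: ge_inf; [exists 0|exists t].
have X0 : 0 <= X.
  by apply: lb_le_inf lb0; exists (inf_load a); exists a => //=; exact: (a_in ab).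
have [m [m0 mX hm]] := ess_inff_bound r0 (hI : (1 < ess_inff f a b c r * X%:E)%E) X0.
exists (m * r * X); first by rewrite mulrAC ltr_pMl.
move=> M u Bu ur t tab; have [mu uM] := Bu; have [N N0 dens] := nemytskii_density hC4 M.
have du := dens _ mu uM; have t01 := sub01 tab.
have mr0 : 0 <= m * r by rewrite mulr_ge0 // ltW.
have fm : {ae leb R, forall s, s \in `[a, b] -> m * r <= f s (u s)}.
  by apply: filterS hm => s h sab; apply: h => //; rewrite in_itv /= ur.
have lower V q : profile Phi V q -> {ae leb R, forall s, s \in `[0, 1] -> 0 <= q s} ->
    m * r * mass q a b <= \int[leb R]_(s in `[0, 1]) (q s * g s * f s (u s)).
  move=> pq q0; apply: (le_trans (mass_ge mPhi wint g_ge0 sub01 pq du q0 fm)).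
  exact: (weighted_sub mPhi wint g_ge0 sub01 pq du q0 (fun s => @nem0 u s)).
have [VA _ pA] := profA; have [VB _ pB] := profB.
apply: (@le_trans _ _ (m * r * inf_load t)); first by apply: ler_wpM2l => //; exact: leX.
apply: (scale_sum (cA0 tab) (cB0 tab) (lower _ _ pA kA0) (lower _ _ pB kB0)).
exact: (lower _ _ (kernel_profile hC1 kPhi t01) (k_ge0 tab)).
Qed.

Let adm_scale (u : R -> R) (r : R) : measurable01 u -> measurable01 (fun t => r * u t).
Proof. by move=> mu; apply: measurable_funM => //; exact: measurable_cst. Qed.

(** The bounds on u serve to distinguish it from solutions at other radii. *)
Lemma compression_solution (r1 r2 : R) : 0 < r1 -> r1 / c < r2 ->
  condI0 k g f gamma delta A B a b c r1 -> condI1 k g f gamma delta A B r2 ->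
  exists u : R -> R, [/\ cone A B a b c u, is_solution k g f gamma delta A B u,
    forall t, t \in `[a, b] -> r1 < u t & forall t, t \in `[0, 1] -> `|u t| < r2].
Proof.
move=> r10 r12 h0 h1.
have r1r2 : r1 < r2.
  by apply: le_lt_trans r12; rewrite ler_pdivlMr // ler_piMr // ltW.
have := compression_fixed_point (S := hammerstein) ab a0 b1 c_gt0 c_le1 (@step_measurable01 R)
  (@continuous_measurable01 R) S_cone S_equi S_unif r10 r12
  (condI0_expands r10 h0) (condI1_contracts (lt_trans r10 r1r2) h1).
move=> [u [uc Ku fixu lo hi]]; have [Cu su] := fixed_point_solution uc Ku fixu.
by exists u.
Qed.

(** The last bound follows from the one before it and the cone condition; it
    separates u from solutions of norm above r2 / c. *)
Lemma expansion_solution (r1 r2 : R) : 0 < r1 -> r1 < r2 ->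
  condI1 k g f gamma delta A B r1 -> condI0 k g f gamma delta A B a b c r2 ->
  exists u : R -> R, [/\ cone A B a b c u, is_solution k g f gamma delta A B u,
    exists2 t, t \in `[0, 1] & r1 < `|u t|, exists2 t, t \in `[a, b] & u t < r2 &
    forall t, t \in `[0, 1] -> `|u t| < r2 / c].
Proof.
move=> r10 r12 h1 h0.
have := expansion_fixed_point (S := hammerstein) ab a0 b1 c_gt0 c_le1 (@step_measurable01 R)
  (@continuous_measurable01 R) adm_scale S_cone S_bounded S_equi S_unif r10 r12
  (condI1_contracts r10 h1) (condI0_expands (lt_trans r10 r12) h0).
move=> [u [uc Ku fixu lo hi]]; have [Cu su] := fixed_point_solution uc Ku fixu.
exists u; split=> // t t01; have [s sab us] := hi.
by rewrite ltr_pdivlMr // mulrC; apply: le_lt_trans us; exact: Ku.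
Qed.

End Hammerstein.

(** * Multiplicity *)

Definition differ01 (R : realType) (u v : R -> R) : Prop :=
  exists2 t : R, t \in `[0, 1] & u t != v t.

Lemma differ01C (R : realType) (u v : R -> R) : differ01 u v -> differ01 v u.
Proof. by case=> t t01 uv; exists t; rewrite // eq_sym. Qed.

Lemma differ01_sup (R : realType) (r : R) (u v : R -> R) :
  (forall t : R, t \in `[0, 1] -> `|u t| < r) -> (exists2 t : R, t \in `[0, 1] & r < `|v t|) ->
  differ01 u v.
Proof.
move=> ur [t t01 rv]; exists t => //; apply/eqP => uv.
by have := ur _ t01; rewrite uv ltNge (ltW rv).
Qed.

Lemma differ01_min (R : realType) (a b r : R) (u v : R -> R) : {subset `[a, b] <= `[0, 1]} ->
  (exists2 t : R, t \in `[a, b] & u t < r) -> (forall t : R, t \in `[a, b] -> r < v t) ->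
  differ01 u v.
Proof.
move=> sub [t tab ur] rv; exists t; first exact: sub.
by rewrite lt_eqF // (lt_trans ur) // rv.
Qed.

Section Multiplicity.
Variables (R : realType) (k : R -> R -> R) (g : R -> R) (f : R -> R -> R)
  (gamma delta A B : R -> R) (a b c : R).

Definition nonzero_solution (u : R -> R) : Prop :=
  [/\ cone A B a b c u, is_solution k g f gamma delta A B u
    & exists2 t : R, t \in `[0, 1] & u t != 0].

Let solutions := has_nonzero_solutions k g f gamma delta A B a b c.

Lemma nonzero_solutions_seq (us : seq (R -> R)) :
  (forall i, (i < size us)%N -> nonzero_solution (nth (cst 0) us i)) ->
  (forall i j, (i < j < size us)%N -> differ01 (nth (cst 0) us i) (nth (cst 0) us j)) ->
  solutions (size us).
Proof.
move=> sol dif; exists (fun i => nth (cst 0) us i); split=> [i|i j ij]; first exact: sol.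
have [lt_ij|lt_ji|eq_ij] := ltngtP i j.
- by apply: dif; rewrite lt_ij /=.
- by apply/differ01C/dif; rewrite lt_ji /=.
- by move: ij; rewrite -val_eqE /= eq_ij eqxx.
Qed.

Lemma one_solution u : nonzero_solution u -> solutions 1.
Proof.
move=> hu; apply: (@nonzero_solutions_seq [:: u]); first by case.
by move=> [|i] [|j] // /andP[].
Qed.

Lemma two_solutions u v : nonzero_solution u -> nonzero_solution v -> differ01 u v ->
  solutions 2.
Proof.
move=> hu hv uv; apply: (@nonzero_solutions_seq [:: u; v]); first by case=> [|[]].
by move=> [|[|i]] [|[|j]] // /andP[].
Qed.

Lemma three_solutions u v w : nonzero_solution u -> nonzero_solution v -> nonzero_solution w ->
  differ01 u v -> differ01 u w -> differ01 v w -> solutions 3.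
Proof.
move=> hu hv hw uv uw vw.
apply: (@nonzero_solutions_seq [:: u; v; w]); first by case=> [|[|[]]].
by move=> [|[|[|i]]] [|[|[|j]]] // /andP[].
Qed.

End Multiplicity.

Theorem theorem2p12 (R : realType) (k : R -> R -> R) (g : R -> R)
    (f : R -> R -> R) (gamma delta A B Phi : R -> R) (a b c1 c2 c3 : R)
    (hC1 : C1 k)
    (hC2 : C2 k Phi a b c1)
    (hC3 : C3 g Phi a b)
    (hC4 : C4 f)
    (hC5 : C5 k A B)
    (hC6 : C6 A B gamma a b c2)
    (hC7 : C7 A B delta a b c3)
    (hC8 : 0 < detD A B gamma delta) :
  let c := Num.min c1 (Num.min c2 c3) in
  let I1 := condI1 k g f gamma delta A B in
  let I0 := condI0 k g f gamma delta A B a b c in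
  let solutions := has_nonzero_solutions k g f gamma delta A B a b c in
  let S1 := exists r1 r2 : R,
    [/\ 0 < r1, 0 < r2, r1 / c < r2, I0 r1 & I1 r2] in
  let S2 := exists r1 r2 : R,
    [/\ 0 < r1, 0 < r2, r1 < r2, I1 r1 & I0 r2] in
  let S3 := exists r1 r2 r3 : R,
    [/\ 0 < r1, 0 < r2 & 0 < r3] /\
    r1 / c < r2 < r3 /\ [/\ I0 r1, I1 r2 & I0 r3] in
  let S4 := exists r1 r2 r3 : R,
    [/\ 0 < r1, 0 < r2 & 0 < r3] /\
    (r1 < r2 /\ r2 / c < r3) /\ [/\ I1 r1, I0 r2 & I1 r3] in
  let S5 := exists r1 r2 r3 r4 : R,
    [/\ 0 < r1, 0 < r2, 0 < r3 & 0 < r4] /\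
    (r1 / c < r2 < r3 /\ r3 / c < r4) /\ [/\ I0 r1, I1 r2, I0 r3 & I1 r4] in
  let S6 := exists r1 r2 r3 r4 : R,
    [/\ 0 < r1, 0 < r2, 0 < r3 & 0 < r4] /\
    (r1 < r2 /\ r2 / c < r3 < r4) /\ [/\ I1 r1, I0 r2, I1 r3 & I0 r4] in
  [/\ S1 \/ S2 -> solutions 1%N,
      S3 \/ S4 -> solutions 2%N
    & S5 \/ S6 -> solutions 3%N].
Proof.
have [[a0 ab b1] _] := hC2.
have sub : {subset `[a, b] <= `[0, 1]} by move=> t; exact: sub_ab.
have aab := a_in ab.
move=> c I1 I0 solutions.
pose good := nonzero_solution k g f gamma delta A B a b c.
have comp (r1 r2 : R) : 0 < r1 -> r1 / c < r2 -> I0 r1 -> I1 r2 -> exists u : R -> R,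
    [/\ good u, forall t : R, t \in `[a, b] -> r1 < u t & forall t, t \in `[0, 1] -> `|u t| < r2].
  move=> r10 r12 h0 h1.
  have [u [Cu su lo hi]] := compression_solution hC1 hC2 hC3 hC4 hC5 hC6 hC7 hC8 r10 r12 h0 h1.
  exists u; split=> //; split=> //; exists a; first exact: sub.
  by rewrite gt_eqF // (lt_trans r10) // lo.
have expa (r1 r2 : R) : 0 < r1 -> r1 < r2 -> I1 r1 -> I0 r2 -> exists u : R -> R,
    [/\ good u, exists2 t : R, t \in `[0, 1] & r1 < `|u t|, exists2 t, t \in `[a, b] & u t < r2
      & forall t : R, t \in `[0, 1] -> `|u t| < r2 / c].
  move=> r10 r12 h1 h0.
  have [u [Cu su lo hi hic]] := expansion_solution hC1 hC2 hC3 hC4 hC5 hC6 hC7 hC8 r10 r12 h1 h0.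
  exists u; split=> //; split=> //; have [t t01 ht] := lo; exists t => //.
  by rewrite -normr_gt0 (lt_trans r10).
split.
- move=> [[r1 [r2 [r10 _ r12 h1 h2]]]|[r1 [r2 [r10 _ r12 h1 h2]]]].
  + by have [u [gu _ _]] := comp _ _ r10 r12 h1 h2; exact: one_solution gu.
  + by have [u [gu _ _ _]] := expa _ _ r10 r12 h1 h2; exact: one_solution gu.
- move=> [[r1 [r2 [r3 [[r10 r20 _] [/andP[r12 r23] [h1 h2 h3]]]]]]
         |[r1 [r2 [r3 [[r10 r20 _] [[r12 r23] [h1 h2 h3]]]]]]].
  + have [u [gu _ u2]] := comp _ _ r10 r12 h1 h2.
    have [v [gv v2 _ _]] := expa _ _ r20 r23 h2 h3.
    exact: two_solutions gu gv (differ01_sup u2 v2).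
  + have [u [gu _ u2 _]] := expa _ _ r10 r12 h1 h2.
    have [v [gv v2 _]] := comp _ _ r20 r23 h2 h3.
    exact: two_solutions gu gv (differ01_min sub u2 v2).
- move=> [[r1 [r2 [r3 [r4 [[r10 r20 r30 _] [[/andP[r12 r23] r34] [h1 h2 h3 h4]]]]]]]
         |[r1 [r2 [r3 [r4 [[r10 r20 r30 _] [[r12 /andP[r23 r34]] [h1 h2 h3 h4]]]]]]]].
  + have [u [gu _ u2]] := comp _ _ r10 r12 h1 h2.
    have [v [gv v2 v3 _]] := expa _ _ r20 r23 h2 h3.
    have [w [gw w3 _]] := comp _ _ r30 r34 h3 h4.
    have u3 : exists2 t : R, t \in `[a, b] & u t < r3.
      by exists a => //; apply: lt_trans r23; apply: le_lt_trans (u2 _ (sub _ aab)); exact: ler_norm.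
    exact: three_solutions gu gv gw (differ01_sup u2 v2) (differ01_min sub u3 w3)
      (differ01_min sub v3 w3).
  + have [u [gu _ u2 u2c]] := expa _ _ r10 r12 h1 h2.
    have [v [gv v2 v3]] := comp _ _ r20 r23 h2 h3.
    have [w [gw w3 _ _]] := expa _ _ r30 r34 h3 h4.
    have u3 t : t \in `[0, 1] -> `|u t| < r3 by move=> t01; exact: lt_trans (u2c _ t01) r23.
    exact: three_solutions gu gv gw (differ01_min sub u2 v2) (differ01_sup u3 w3)
      (differ01_sup v3 w3).
Qed.
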